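(* Let $\theta$ be the sign function, $\theta(s)=1$ for $s\ge0$ and $\theta(s)=-1$ for $s<0$. Let $a$ be a mean zero, variance one random variable with a symmetric distribution (i.e. $a$ and $-a$ have the same law), $g\sim\mathcal{N}(0,1)$, $\epsilon\in[0,1]$, and let $g_\epsilon$ be given by one of the following two models. Additive model: $g_\epsilon=\sqrt{1-\epsilon}\,g+\sqrt{\epsilon}\,a$, with $a$ independent of $g$. Mixture model: $g_\epsilon=g\mathbf{1}_{A^c}+a\mathbf{1}_A$, where $A$ is an event of probability $\epsilon$ independent of $(g,a)$. Let $\mathbf{g}_\epsilon\in\mathbb{R}^d$ have i.i.d. components distributed as $g_\epsilon$, let $\mathbf{x}\in\mathbb{R}^d$ with $\|\mathbf{x}\|_2=1$, and let $y$ be a real random variable with $E[y\mid\mathbf{g}_\epsilon]=\theta(\langle\mathbf{g}_\epsilon,\mathbf{x}\rangle)$ such that $y\langle\mathbf{g}_\epsilon,\mathbf{t}\rangle$ is integrable for every $\mathbf{t}\in\mathbb{R}^d$. Let $\lambda=E[y\langle\mathbf{g}_\epsilon,\mathbf{x}\rangle]$, $\alpha=\sup_{\mathbf{t}\in B_2^d}|E[y\langle\mathbf{g}_\epsilon,\mathbf{t}\rangle]-\lambda\langle\mathbf{x},\mathbf{t}\rangle|$ and $c_1=\sqrt{2/\pi}-1/2$. Assume $\|\mathbf{x}\|_3^3\le c_1/\gamma_{g_\epsilon}$ and $\|\mathbf{x}\|_\infty\le1/2$. Then in the additive model $$\alpha\le\left(10\,\epsilon^{3/2}\gamma_a\left(\sqrt{1-\epsilon}\left(\sqrt{\tfrac8\pi}\right)^{1/3}+\sqrt{\epsilon}\,\big(E|a|^3\big)^{1/3}\right)^3\|\mathbf{x}\|_\infty\right)^{1/2},$$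 and in the mixture model $$\alpha\le\left(10\,\epsilon\,\gamma_a\left(\left((1-\epsilon)\sqrt{\tfrac8\pi}\right)^{1/3}+\big(\epsilon E|a|^3\big)^{1/3}\right)^3\|\mathbf{x}\|_\infty\right)^{1/2}.$$
   Context: $B_2^d$ is the closed unit Euclidean ball of $\mathbb{R}^d$; $\|\mathbf{x}\|_3^3=\sum_i|x_i|^3$, $\|\mathbf{x}\|_\infty=\max_i|x_i|$. Zero bias distribution: for a mean zero random variable $X$ with finite non-zero variance $\sigma^2$, there is a unique law $\mathcal{L}(X^* )$ such that $E[Xf(X)]=\sigma^2E[f'(X^* )]$ for all Lipschitz $f:\mathbb{R}\to\mathbb{R}$. $\gamma_X=d_1(\mathcal{L}(X),\mathcal{L}(X^* ))\in[0,\infty]$, where $d_1(\mathcal{L}(X),\mathcal{L}(Y))=\inf E|X-Y|$ over all couplings of the two laws (Wasserstein-1 distance). Conventions: $c_1/0=\infty$, $c_1/\infty=0$, $0\cdot\infty=0$. *)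

(* Defs.v *)
From HB Require Import structures.
From mathcomp Require Import all_boot all_order all_algebra.
From mathcomp Require Import all_classical all_reals all_analysis.

Set Implicit Arguments.
Unset Strict Implicit.
Unset Printing Implicit Defensive.

Import Order.TTheory GRing.Theory Num.Theory.
Import numFieldNormedType.Exports.

Local Open Scope classical_set_scope.
Local Open Scope ring_scope.

                                                                              
                                                                
Definition same_law (R : realType) (mu nu : set R -> \bar R) : Prop :=
  forall B : set R, measurable B -> mu B = nu B.

Definition symmetric_law (d : measure_display) (T : measurableType d)
    (R : realType) (P : probability T R) (X : {RV P >-> R}) : Prop :=
  same_law (distribution P X) (pushforward P (fun w => - X w)).

Definition independent_RV (d d1 d2 : measure_display) (T : measurableType d)
    (T1 : measurableType d1) (T2 : measurableType d2) (R : realType)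
    (P : probability T R) (X : T -> T1) (Y : T -> T2) : Prop :=
  forall (B : set T1) (C : set T2), measurable B -> measurable C ->
    P (X @^-1` B `&` Y @^-1` C) = (P (X @^-1` B) * P (Y @^-1` C))%E.

Definition independent_event (d d1 : measure_display) (T : measurableType d)
    (T1 : measurableType d1) (R : realType)
    (P : probability T R) (A : set T) (X : T -> T1) : Prop :=
  forall B : set T1, measurable B ->
    P (A `&` X @^-1` B) = (P A * P (X @^-1` B))%E.

Definition mutually_independent (d : measure_display) (T : measurableType d)
    (R : realType) (P : probability T R) (n : nat)
    (X : 'I_n -> {RV P >-> R}) : Prop :=
  forall (J : {set 'I_n}) (B : 'I_n -> set R), (forall i, measurable (B i)) ->
    P (\bigcap_(i in [set` J]) (X i @^-1` B i))
    = (\prod_(i in J) P (X i @^-1` B i))%E.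

                                                                   
                        
Definition is_cond_expectation (d : measure_display) (T : measurableType d)
    (R : realType) (P : probability T R) (F : set (set T)) (Y Z : T -> R) :
    Prop :=
  [/\ P.-integrable setT (EFin \o Y),
      P.-integrable setT (EFin \o Z),
      forall B : set R, measurable B -> F (Z @^-1` B) &
      forall A : set T, F A ->
        (\int[P]_(w in A) (Z w)%:E = \int[P]_(w in A) (Y w)%:E)%E].

                                                                                
                                                                             
                 
Definition is_zero_bias (R : realType) (mu nu : probability R R) : Prop :=
  forall f : R -> R, lipschitz f ->
    ('E_mu[fun x => (x * f x)%R] = 'V_mu[idfun] * 'E_nu[derive1 f])%E.

                                                                          
                                                                       
Definition zero_bias (R : realType) (mu : probability R R) : probability R R :=
  xget mu [set nu | is_zero_bias mu nu].

Definition coupling (R : realType) (mu nu : probability R R) :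
    set (probability (R * R)%type R) :=
  [set pi | same_law (pushforward pi fst) mu /\
            same_law (pushforward pi snd) nu].

Definition wasserstein1 (R : realType) (mu nu : probability R R) : \bar R :=
  ereal_inf [set (\int[pi]_z `|z.1 - z.2|%:E)%E | pi in coupling mu nu].

Definition gamma (d : measure_display) (T : measurableType d) (R : realType)
    (P : probability T R) (X : {RV P >-> R}) : \bar R :=
  wasserstein1 (distribution P X) (zero_bias (distribution P X)).

Definition dot (R : realType) (n : nat) (u v : 'rV[R]_n) : R :=
  \sum_(i < n) u 0 i * v 0 i.

Definition norm2 (R : realType) (n : nat) (u : 'rV[R]_n) : R :=
  Num.sqrt (\sum_(i < n) u 0 i ^+ 2).

Definition norm3_cubed (R : realType) (n : nat) (u : 'rV[R]_n) : R :=
  \sum_(i < n) `|u 0 i| ^+ 3.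

Definition norm_infty (R : realType) (n : nat) (u : 'rV[R]_n) : R :=
  \big[Num.max/0]_(i < n) `|u 0 i|.

Definition theta (R : realType) (s : R) : R := if 0 <= s then 1 else -1.

Definition c1 (R : realType) : R := Num.sqrt (2 / pi) - 2^-1.

Definition additive_model (d : measure_display) (T : measurableType d)
    (R : realType) (P : probability T R) (eps : R)
    (g a geps : {RV P >-> R}) : Prop :=
  independent_RV P a g /\
  forall w, geps w = Num.sqrt (1 - eps) * g w + Num.sqrt eps * a w.

Definition mixture_model (d : measure_display) (T : measurableType d)
    (R : realType) (P : probability T R) (eps : R)
    (g a geps : {RV P >-> R}) : Prop :=
  exists A : set T,
    [/\ measurable A, P A = eps%:E,
        independent_event P A (fun w => (g w, a w)) &
        forall w, geps w = g w * \1_(~` A) w + a w * \1_A w].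

Definition rvec (d : measure_display) (T : measurableType d) (R : realType)
    (P : probability T R) (n : nat) (G : 'I_n -> {RV P >-> R}) (w : T) :
    'rV[R]_n :=
  \row_(i < n) G i w.

Definition lambda (d : measure_display) (T : measurableType d) (R : realType)
    (P : probability T R) (n : nat) (G : 'I_n -> {RV P >-> R})
    (x : 'rV[R]_n) (y : {RV P >-> R}) : \bar R :=
  'E_P[fun w => (y w * dot (rvec G w) x)%R]%E.

Definition alpha (d : measure_display) (T : measurableType d) (R : realType)
    (P : probability T R) (n : nat) (G : 'I_n -> {RV P >-> R})
    (x : 'rV[R]_n) (y : {RV P >-> R}) : \bar R :=
  ereal_sup [set `| 'E_P[fun w => (y w * dot (rvec G w) t)%R]
                    - lambda G x y * (dot x t)%:E |%E
            | t in [set t : 'rV[R]_n | norm2 t <= 1]].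

(* Main.v *)
Require Import Defs.
From HB Require Import structures.
From mathcomp Require Import all_boot all_order all_algebra.
From mathcomp Require Import all_classical all_reals all_analysis.
From mathcomp Require Import measurable_realfun.
From mathcomp Require Import ring lra.

(** Write [g] for the random vector, [W = <g, x>], [v_i = E[theta(W) g_i]],
    [X] for the sup norm of [x] and [m] for the third absolute moment of a
    component. Testing the conditional expectation of [y] against [g_i] gives
    [E[y g_i] = v_i] ([cond_expectation_pull_out]), so [lambda = <x, v> = E|W|]
    and [alpha] is the Euclidean norm of [v - lambda x], that is
    [alpha^2 = N^2 - lambda^2] with [N = |v|]. If [u = v / N] then
    [N = E[theta(W) <g, u>] <= E|<g, u>| <= 1], whence
    [alpha^2 <= 2 N (N - lambda) <= 2 N (E|<g, u>| - E|<g, x>|)]. Everything is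
    thus reduced to comparing the first absolute moments of two unit
    projections, both of which are close to the Gaussian value.

    The comparison is Stein's method. Say that a law has Stein discrepancy at
    most [D] ([stein_discrepancy_le]) if [E[X f(X)]] and [E[f'(X)]] differ by at
    most [L D] whenever [f'] is bounded and [L]-Lipschitz. The definition of the
    zero bias law and a coupling bound the discrepancy of [a] by [gamma a]
    ([stein_discrepancy_zero_bias]; the zero bias law exists by
    [zero_bias_exists]), integration by parts shows that the normal law has
    discrepancy [0], and conditioning on one summand shows that the discrepancy
    scales like the cube of the coefficient in an independent sum and linearly
    in a mixture. So a component of [g] has discrepancy at most [D], with
    [D = eps^(3/2) gamma a] in the additive model and [D = eps gamma a] in the
    mixture model. The equation [F'(w) - w F(w) = |w| - c] has a solution whose
    derivative is bounded and 1-Lipschitz ([stein_abs], through Mills' ratio),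
    and it yields [| E|<g, u>| - c | <= D sum_i |u_i|^3] for every unit vector
    [u] ([absolute_moment_stein]). The constant [c] cancels in the difference:
    [alpha^2 <= 2 D (N sum_i |u_i|^3 + N sum_i |x_i|^3) <= 2 D (max_i |v_i| + X)].

    There remains the bound [|v_i| <= 4 X m] ([sign_component_le]). Let [S] be
    [W] without its [i]-th term. As [g_i] is symmetric and independent of [S],
    the sign of [W] is correlated with [g_i] only through the event
    [|S| <= |x_i g_i|], and the probability that [S] falls in a short interval
    is controlled by a concentration inequality of Chen-Shao type
    ([concentration]). Altogether [alpha^2 <= 10 D m X] ([sign_alignment]).

    The moment [m] is bounded by Minkowski's inequality in the additive model
    and by superadditivity of the cube in the mixture model. In extended real
    arithmetic the right-hand side vanishes when [eps = 0] or [gamma a = 0];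
    then [D = 0] and [alpha = 0] even if no third moment is finite
    ([sign_alignment0]). It is infinite in the other degenerate cases. *)

Set Implicit Arguments.
Unset Strict Implicit.
Unset Printing Implicit Defensive.

Import Order.TTheory GRing.Theory Num.Theory.
Import numFieldNormedType.Exports.

Local Open Scope classical_set_scope.
Local Open Scope ring_scope.

(** * Integrals of real functions *)
Section integrable_EFin.
Context d (T : measurableType d) (R : realType).
Variable mu : {measure set T -> \bar R}.
Implicit Types f g : T -> R.

Lemma integrable_scale f (c : R) : mu.-integrable setT (fun x => (f x)%:E) ->
  mu.-integrable setT (fun x => (c * f x)%:E).
Proof. by move=> fi; under eq_fun do rewrite EFinM; exact: integrableZl. Qed.

Lemma integrable_add f g : mu.-integrable setT (fun x => (f x)%:E) ->
  mu.-integrable setT (fun x => (g x)%:E) ->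
  mu.-integrable setT (fun x => (f x + g x)%:E).
Proof. by move=> fi gi; under eq_fun do rewrite EFinD; exact: integrableD. Qed.

Lemma integrable_sub f g : mu.-integrable setT (fun x => (f x)%:E) ->
  mu.-integrable setT (fun x => (g x)%:E) ->
  mu.-integrable setT (fun x => (f x - g x)%:E).
Proof. by move=> fi gi; under eq_fun do rewrite EFinB; exact: integrableB. Qed.

Lemma integrable_sumr (I : Type) (s : seq I) (f : I -> T -> R) :
  (forall i, mu.-integrable setT (fun x => (f i x)%:E)) ->
  mu.-integrable setT (fun x => (\sum_(i <- s) f i x)%:E).
Proof.
by move=> fi; under eq_fun do rewrite -sumEFin; exact: integrable_sum.
Qed.

Lemma Rintegral_sum (I : Type) (s : seq I) (f : I -> T -> R) :
  (forall i, mu.-integrable setT (fun x => (f i x)%:E)) ->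
  \int[mu]_x (\sum_(i <- s) f i x) = \sum_(i <- s) \int[mu]_x f i x.
Proof.
move=> fi; elim: s => [|i s IH].
  by rewrite big_nil /Rintegral; under eq_integral do rewrite big_nil; rewrite integral0.
rewrite big_cons -IH -RintegralD//; [|exact: fi|exact: integrable_sumr].
by apply: eq_Rintegral => x _; rewrite big_cons.
Qed.

Lemma integrable_le f g : measurable_fun setT f ->
  mu.-integrable setT (fun x => (g x)%:E) -> (forall x, `|f x| <= g x) ->
  mu.-integrable setT (fun x => (f x)%:E).
Proof.
move=> mf gi fg; apply: le_integrable gi => //; first exact/measurable_EFinP.
by move=> x _; rewrite !abse_EFin lee_fin (le_trans (fg x))// ler_norm.
Qed.

End integrable_EFin.

Lemma integrable_bounded d (T : measurableType d) (R : realType)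
    (P : probability T R) (f : T -> R) (B : R) :
  measurable_fun setT f -> (forall x, `|f x| <= B) ->
  P.-integrable setT (fun x => (f x)%:E).
Proof.
move=> mf fB; apply: (@measurable_bounded_integrable _ _ _ _ f) => //.
- by rewrite [ltLHS](@probability_setT _ _ _ P) ltry.
- exists B; split; first exact: num_real.
  by move=> r Br x _; exact: le_trans (fB _) (ltW Br).
Qed.

Section integral_tools.
Context d (T : measurableType d) (R : realType).
Local Open Scope ereal_scope.

Import HBNNSimple.

(** The almost-everywhere comparison for a function [f] that need not be
    measurable, such as the pointwise derivative of a Lipschitz function: a
    nonnegative integral is a supremum over simple functions below the
    integrand, and these may be compared off the null set [N]. *)
Lemma ge0_integral_eq_off_null (mu : {measure set T -> \bar R})
    (f g : T -> \bar R) (N : set T) :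
  (forall x, 0 <= f x) -> (forall x, 0 <= g x) ->
  measurable_fun setT g -> measurable N -> mu N = 0 ->
  (forall x, ~ N x -> f x = g x) -> \int[mu]_x f x = \int[mu]_x g x.
Proof.
move=> f0 g0 mg mN N0 fg.
have le_off (h1 h2 : T -> \bar R) : (forall x, 0 <= h1 x) ->
    (forall x, 0 <= h2 x) -> measurable_fun setT h1 ->
    (forall x, ~ N x -> h1 x <= h2 x) -> \int[mu]_x h1 x <= \int[mu]_x h2 x.
  move=> h10 h20 mh1 h12.
  rewrite (ge0_negligible_integral mN)// setTD [leLHS]integral_mkcond.
  rewrite !ge0_integralTE//; last first.
    by move=> x; rewrite patchE; case: ifPn.
  apply: le_ereal_sup => _ /= [h hh1 <-]; exists h => // x.
  apply: le_trans (hh1 x) _; rewrite patchE; case: ifPn => //.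
  by rewrite inE => /h12.
apply/eqP; rewrite eq_le; apply/andP; split; last first.
  by apply: le_off => // x /fg ->.
rewrite !ge0_integralTE//; apply: ge_ereal_sup => _ /= [h hf <-].
rewrite -integralT_nnsfun -ge0_integralTE//.
apply: le_off => //.
- by move=> x; rewrite lee_fin; exact: fun_ge0.
- by apply/measurable_EFinP; exact: measurable_funP.
by move=> x Nx; rewrite -fg.
Qed.

Lemma integral_eq_off_null (mu : {measure set T -> \bar R})
    (f g : T -> \bar R) (N : set T) :
  measurable_fun setT g -> measurable N -> mu N = 0 ->
  (forall x, ~ N x -> f x = g x) -> \int[mu]_x f x = \int[mu]_x g x.
Proof.
move=> mg mN N0 fg; rewrite integralE [RHS]integralE; congr (_ - _).
  apply: (@ge0_integral_eq_off_null _ _ _ N) => //.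
    exact: measurable_funepos.
  by move=> x /fg; rewrite !funeposE => ->.
apply: (@ge0_integral_eq_off_null _ _ _ N) => //.
  exact: measurable_funeneg.
by move=> x /fg; rewrite !funenegE => ->.
Qed.

(** The chain rule for densities is available for the Radon-Nikodym derivative,
    and a density [p] agrees with that derivative almost everywhere. *)
Lemma ge0_integral_density (mu : {sigma_finite_measure set T -> \bar R})
    (nu : {finite_measure set T -> \bar R}) (p : T -> \bar R) :
  mu.-integrable setT p -> (forall x, 0 <= p x) ->
  (forall A, measurable A -> nu A = \int[mu]_(x in A) p x) ->
  forall f : T -> \bar R, (forall x, 0 <= f x) -> measurable_fun setT f ->
  \int[nu]_x f x = \int[mu]_x (f x * p x).
Proof.
move=> ip p0 nuE f f0 mf.
have dom : nu `<< mu.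
  apply/null_content_dominatesP => A mA muA.
  rewrite nuE//; apply: null_set_integral => //.
  by apply: measurable_funTS; exact: measurable_int ip.
rewrite -(Radon_Nikodym_SigmaFinite.change_of_variables dom)//.
have ig := Radon_Nikodym_SigmaFinite.f_integrable dom.
apply: ae_eq_integral => //.
- by apply: emeasurable_funM => //; exact: measurable_int ig.
- by apply: emeasurable_funM => //; exact: measurable_int ip.
- apply: ae_eqe_mul2l; apply: integral_ae_eq => //.
    exact: measurable_int ip.
  move=> E _ mE.
  by rewrite -Radon_Nikodym_SigmaFinite.f_integral// nuE.
Qed.

Lemma integral_density (mu : {sigma_finite_measure set T -> \bar R})
    (nu : {finite_measure set T -> \bar R}) (p f : T -> R) :
  mu.-integrable setT (EFin \o p) -> (forall x, 0 <= p x)%R ->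
  (forall A, measurable A -> nu A = \int[mu]_(x in A) (p x)%:E) ->
  measurable_fun setT f ->
  \int[nu]_x (f x)%:E = \int[mu]_x (f x * p x)%:E.
Proof.
move=> ip p0 nuE mf; rewrite integralE [RHS]integralE.
have p0e x : 0 <= (EFin \o p) x by rewrite lee_fin.
rewrite !(@ge0_integral_density mu nu _ ip p0e nuE)//; last 2 first.
- exact/measurable_funeneg/measurable_EFinP.
- exact/measurable_funepos/measurable_EFinP.
congr (_ - _); apply: eq_integral => x _.
- rewrite !funeposE /=; have [fx|fx] := leP 0%R (f x).
    by rewrite !max_l ?lee_fin ?mulr_ge0.
  by rewrite !max_r ?lee_fin ?mul0e// ?mulr_le0_ge0// ltW.
- rewrite !funenegE /=; have [fx|fx] := leP 0%R (f x).
    by rewrite !max_r ?lee_fin ?oppr_le0 ?mul0e// mulr_ge0.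
  rewrite !max_l ?lee_fin ?oppr_ge0 ?mulr_le0_ge0// ?ltW//.
  by rewrite -EFinM mulNr.
Qed.

End integral_tools.

Lemma integrable_fubini_snd d1 d2 (T1 : measurableType d1)
    (T2 : measurableType d2) (R : realType)
    (m1 : {sigma_finite_measure set T1 -> \bar R})
    (m2 : {sigma_finite_measure set T2 -> \bar R}) (f : T1 * T2 -> \bar R) :
  (m1 \x m2)%E.-integrable setT f -> m2.-integrable setT (fubini_G m1 f).
Proof.
move=> fi; have mf := measurable_int _ fi.
apply/integrableP; split; first exact: measurable_fubini_G fi.
have /(integrable21ltyP m1 m2 mf) := fi; apply: le_lt_trans.
apply: ge0_le_integral => //.
- by apply: measurableT_comp => //; exact: measurable_fubini_G fi.
- apply: (@measurable_fun_fubini_tonelli_G _ _ _ _ _ m1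
    (fun z => `|f z|%E)); last by move=> z.
  exact: measurableT_comp.
- move=> u _; apply: le_abse_integral => //.
  exact: (measurableT_comp mf (@pair2_measurable _ _ _ _ u)).
Qed.

Section density_measure.
Context d (T : measurableType d) (R : realType).
Variables (mu : {measure set T -> \bar R}) (p : T -> \bar R).
Hypotheses (mp : measurable_fun setT p) (p0 : forall x, (0 <= p x)%E).
Local Open Scope ereal_scope.

(** The hypotheses are arguments, so that the measure structure can be inferred
    from the term. *)
Definition density_measure of measurable_fun setT p
  & (forall x, (0 <= p x)%E) := fun A => \int[mu]_(x in A) p x.

Local Notation nu := (density_measure mp p0).

Let nu0 : nu set0 = 0.
Proof. by rewrite /density_measure integral_set0. Qed.

Let nu_ge0 A : 0 <= nu A.
Proof. by apply: integral_ge0. Qed.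

Let nu_sigma_additive : semi_sigma_additive nu.
Proof. exact: semi_sigma_additive_nng_induced. Qed.

HB.instance Definition _ := isMeasure.Build _ _ _
  nu nu0 nu_ge0 nu_sigma_additive.

End density_measure.

(** * Lipschitz functions are integrals of their derivative *)
Section lipschitz_ae.
Context {R : realType}.
Notation mu := (@lebesgue_measure R).

Lemma lebesgue_stieltjes_itv (F : cumulative R R) (a b : R) : a <= b ->
  lebesgue_stieltjes_measure F `]a, b] = (F b - F a)%:E.
Proof.
move=> ab; rewrite /lebesgue_stieltjes_measure /measure_extension/=.
rewrite measurable_mu_extE/=; last exact: is_ocitv.
by rewrite wlength_itv_bnd// EFinB.
Qed.

(** The increments of the nondecreasing function [K x - F x] define a second
    Stieltjes measure, and its sum with that of [F] is [K] times Lebesgue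
    measure because the two agree on intervals. *)
Lemma bounded_rate_stieltjes (F : cumulative R R) (K : {nonneg R}) :
  (forall x y, x <= y -> F y - F x <= K%:num * (y - x)) ->
  forall A, measurable A ->
  (lebesgue_stieltjes_measure F A <= K%:num%:E * mu A)%E.
Proof.
move=> FK.
have K0 : 0 <= K%:num by [].
have ndB : nondecreasing (fun x => K%:num * x - F x).
  by move=> x y xy; have := FK _ _ xy; lra.
have rcB : right_continuous (fun x => K%:num * x - F x).
  move=> x; apply: cvgB; last exact: cumulative_is_right_continuous.
  by apply: cvgMr; exact: cvg_within.
have ndK : nondecreasing (fun x => K%:num * x).
  by move=> x y xy; rewrite ler_wpM2l.
have rcK : right_continuous (fun x => K%:num * x).
  by move=> x; apply: cvgMr; exact: cvg_within.
pose B : cumulative R R := HB.pack (fun x => K%:num * x - F x)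
  (isCumulative.Build R _ R _ ndB rcB).
pose k : cumulative R R := HB.pack (fun x => K%:num * x)
  (isCumulative.Build R _ R _ ndK rcK).
have E1 A : measurable A ->
    lebesgue_stieltjes_measure k A = mscale K mu A.
  apply: lebesgue_stieltjes_measure_unique => _ [[a b]/= _ <-].
  have [ab|ba] := leP a b; last first.
    by rewrite set_itv_ge ?measure0// bnd_simp -leNgt ltW.
  rewrite /mscale/= /lebesgue_measure !lebesgue_stieltjes_itv//=.
  by rewrite -EFinM mulrBr.
have E2 A : measurable A -> lebesgue_stieltjes_measure k A =
    measure_add (lebesgue_stieltjes_measure F) (lebesgue_stieltjes_measure B) A.
  apply: lebesgue_stieltjes_measure_unique => _ [[a b]/= _ <-].
  have [ab|ba] := leP a b; last first.
    by rewrite set_itv_ge ?measure0// bnd_simp -leNgt ltW.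
  rewrite [RHS]measure_addE !lebesgue_stieltjes_itv//=.
  have -> : lebesgue_stieltjes_measure F `]a, b] = (F b - F a)%:E.
    exact: lebesgue_stieltjes_itv.
  have -> : lebesgue_stieltjes_measure B `]a, b] = (B b - B a)%:E.
    exact: lebesgue_stieltjes_itv.
  by rewrite -EFinD; congr EFin; rewrite /=; ring.
move=> A mA.
have -> : (K%:num%:E * mu A)%E = mscale K mu A by [].
by rewrite -E1// E2// measure_addE leeDl.
Qed.

Lemma lip_continuous (f : R -> R) (L : R) : 0 <= L ->
  (forall x y, `|f x - f y| <= L * `|x - y|) -> continuous f.
Proof.
move=> L0 fL x; apply/cvgrPdist_le => e e0.
have L1 : 0 < L + 1 by rewrite ltr_wpDl.
near=> y; apply: (le_trans (fL x y)).
apply: (@le_trans _ _ ((L + 1) * `|x - y|)).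
  by rewrite ler_wpM2r// lerDl.
rewrite mulrC -ler_pdivlMr//; near: y.
by apply: cvgr_dist_le; [exact: cvg_id | exact: divr_gt0].
Unshelve. all: by end_near. Qed.

(** Absolute continuity through Radon-Nikodym: [f x + L x] is nondecreasing with
    rate at most [2 L], so its Stieltjes measure has a Lebesgue density on
    bounded intervals; differentiating the integral of that density almost
    everywhere gives the derivative of [f]. *)
Lemma lipschitz_local_density (f : R -> R) (L : {nonneg R}) (N : R) :
  (forall x y, `|f x - f y| <= L%:num * `|x - y|) ->
  exists h : R -> R, [/\ mu.-integrable setT (EFin \o h),
    (forall y, -N < y < N ->
      f y - f (- N) = \int[mu]_(t in `]-N, y]) h t - L%:num * (y + N)) &
    {ae mu, forall x, -N < x < N ->
      derivable f x 1 /\ derive1 f x = h x - L%:num}].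
Proof.
move=> fL.
have L0 : 0 <= L%:num by [].
have cf : continuous f by exact: lip_continuous fL.
have ndF : nondecreasing (fun x => f x + L%:num * x).
  move=> x y xy; have := fL x y.
  rewrite [`|x - y|]distrC [`|y - x|]ger0_norm ?subr_ge0// ler_norml => /andP[].
  by move=> _; lra.
have cF : continuous (fun x => f x + L%:num * x).
  by move=> x; apply: cvgD; [exact: cf|apply: cvgMr; exact: cvg_id].
have rcF := right_continuousW cF.
pose F : cumulative R R := HB.pack (fun x => f x + L%:num * x)
  (isCumulative.Build R _ R _ ndF rcF).
have Frate x y : x <= y -> F y - F x <= (2 * L%:num)%:nng%:num * (y - x).
  move=> xy /=; have := fL x y.
  rewrite [`|x - y|]distrC [`|y - x|]ger0_norm ?subr_ge0// ler_norml => /andP[].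
  by move=> /=; lra.
have Fdom := bounded_rate_stieltjes Frate.
pose D : set (measurableTypeR R) := `]-N, N]%classic.
have mD : measurable D by exact: (measurable_itv `]-N, N]).
have moo : (lebesgue_stieltjes_measure F D < +oo)%E.
  rewrite (le_lt_trans (Fdom _ mD))// lebesgue_measure_itv/=.
  by case: ifP => _; rewrite ?mule0 // -EFinD -EFinM ltry.
pose nu : {finite_measure set (measurableTypeR R) -> \bar R} :=
  mfrestr mD moo.
have dom : nu `<< mu.
  apply/null_content_dominatesP => A mA muA.
  apply/eqP; rewrite eq_le measure_ge0 andbT.
  apply: (le_trans (Fdom _ (measurableI _ _ mA mD))).
  have -> : mu (A `&` D) = 0%E.
    exact: (subset_measure0 (measurableI _ _ mA mD) mA (@subIsetl _ _ _) muA).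
  by rewrite mule0.
pose h := fine \o Radon_Nikodym_SigmaFinite.f nu mu.
have hE : EFin \o h = Radon_Nikodym_SigmaFinite.f nu mu.
  apply/funext => x /=; rewrite fineK//.
  exact: Radon_Nikodym_SigmaFinite.f_fin_num.
have ih : mu.-integrable setT (EFin \o h).
  by rewrite hE; exact: Radon_Nikodym_SigmaFinite.f_integrable.
have ihS (B : set R) : measurable B -> mu.-integrable B (EFin \o h).
  by move=> mB; apply: integrableS ih.
have lh : locally_integrable setT h.
  by apply: open_integrable_locally => //; exact: openT.
pose G y := \int[mu]_(t in `]-N, y]) h t.
have GE y : -N < y < N -> G y = F y - F (-N).
  move=> /andP[Ny yN]; rewrite /G /Rintegral.
  transitivity (fine (nu `]-N, y]%classic)).
    congr fine; rewrite [RHS](Radon_Nikodym_SigmaFinite.f_integral dom).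
      by rewrite -hE.
    exact: (measurable_itv `]-N, y]).
  rewrite -[nu _]/(lebesgue_stieltjes_measure F (`]-N, y] `&` D)) setIidl.
    by rewrite (lebesgue_stieltjes_itv F (ltW Ny)).
  by apply: subset_itvl; rewrite bnd_simp ltW.
exists h; split => //.
  by move=> y Ny; rewrite -/(G y) GE//=; ring.
have := @FTC1 R h (BRight (- N)) (fun y => ihS _ (measurable_itv _)) lh.
apply: filterS; first exact: (ae_filter_ringOfSetsType mu).
move=> x /= FTx /andP[Nx xN].
have [dG G'x] := FTx Nx.
have dLx : derivable (fun y : R => L%:num * y) x 1.
  by apply: derivableM; [exact: derivable_cst|exact: derivable_id].
have dGN : derivable (fun y : R => G y + F (- N)) x 1.
  by apply: (derivableD dG); exact: derivable_cst.
have near_f : {near x, (fun y : R => G y + F (- N) - L%:num * y) =1 f}.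
  near=> y; rewrite GE ?subrK /=; last first.
    by apply/andP; split; near: y; [exact: lt_nbhsr|exact: lt_nbhsl].
  by rewrite addrK.
split; first exact: (near_eq_derivable near_f (derivableB dGN dLx)).
rewrite derive1E -(near_eq_derive _ near_f) (deriveB dGN dLx).
rewrite (deriveD dG (derivable_cst _ _ _)) derive_cst addr0.
rewrite -[in LHS]derive1E G'x; congr (_ - _).
rewrite (deriveM (derivable_cst _ _ _) (@derivable_id _ _ _ _)).
by rewrite derive_id derive_cst scaler0 addr0 /GRing.scale/= mulr1.
Unshelve. all: by end_near. Qed.

Lemma difference_quotient_cvg (f : R -> R) (x : R) : derivable f x 1 ->
  (n.+1%:R * (f (x + n.+1%:R^-1) - f x)) @[n --> \oo] --> derive1 f x.
Proof.
move=> df; rewrite derive1E.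
have h0 : (n.+1%:R^-1 : R) @[n --> \oo] --> 0^'.
  move=> A /= [e /= e0 hA].
  change (\forall n \near \oo, A (n.+1%:R^-1)); near=> n.
  apply: hA => /=; last by rewrite invr_eq0 pnatr_eq0.
  rewrite sub0r normrN ger0_norm//; near: n.
  exact: (near_infty_natSinv_lt (PosNum e0)).
have := cvg_comp _ _ h0 df; apply: cvg_trans; apply: near_eq_cvg.
apply: nearW => n; rewrite /= invrK /GRing.scale/= mulr1.
by rewrite [in RHS](addrC x).
Unshelve. all: by end_near. Qed.

(** The local densities are glued into one bounded measurable [h]: the upper limit
    of the difference quotients of [f] is measurable, and equals the derivative
    wherever it exists. *)
Lemma lipschitz_ftc (f : R -> R) (L : {nonneg R}) :
  (forall x y, `|f x - f y| <= L%:num * `|x - y|) ->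
  exists h : R -> R, [/\ measurable_fun setT h,
    (forall x, `|h x| <= L%:num), {ae mu, forall x, derive1 f x = h x} &
    forall a b, a <= b -> f b - f a = \int[mu]_(t in `]a, b]) h t].
Proof.
move=> fL; have cf : continuous f by exact: lip_continuous fL.
have L0 : 0 <= L%:num by [].
pose q (n : nat) x : R := n.+1%:R * (f (x + n.+1%:R^-1) - f x).
have qL n x : `|q n x| <= L%:num.
  rewrite /q normrM ger0_norm// -ler_pdivlMl//.
  by apply: (le_trans (fL _ _)); rewrite addrAC subrr add0r ger0_norm// mulrC.
(* Truncation keeps the bound on h where f has no derivative. *)
pose h0 x := limn_sup (q ^~ x).
pose h := (cst (- L%:num)) \max (cst L%:num \min h0).
have mq n : measurable_fun setT (q n).
  apply: continuous_measurable_fun => x.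
  apply: cvgM; first exact: cvg_cst.
  apply: cvgB; last exact: cf.
  by apply: continuous_comp; [apply: cvgD; [exact: cvg_id|exact: cvg_cst]|exact: cf].
have mh0 : measurable_fun setT h0.
  apply: measurable_fun_limn_sup => // x _.
    by exists L%:num => _ [n _ <-]; apply: le_trans (ler_norm _) (qL _ _).
  exists (- L%:num) => _ [n _ <-]; rewrite lerNl.
  by apply: le_trans (ler_norm _) _; rewrite normrN.
have mh : measurable_fun setT h.
  by do 2 (apply: measurable_maxr || apply: measurable_minr; first exact: measurable_cst).
have hL x : `|h x| <= L%:num.
  by rewrite ler_norml /h /= le_max lexx/= ge_max ge_min lexx orTb andbT ge0_cp.
have df_h x : derivable f x 1 -> derive1 f x = h x.
  move=> dfx; have qf := difference_quotient_cvg dfx.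
  have h0E : h0 x = derive1 f x.
    by rewrite /h0 (cvg_limn_supE _) //; [exact/cvg_lim | apply/cvg_ex; eexists; exact: qf].
  have : `|derive1 f x| <= L%:num.
    have nqf : (fun n => `|q n x|) @ \oo --> `|derive1 f x|.
      exact: cvg_norm qf.
    rewrite -(cvg_lim (@Rhausdorff R) nqf); apply: limr_le; last exact: nearW.
    by apply/cvg_ex; eexists; exact: nqf.
  by rewrite ler_norml /h/= h0E => /andP[Lf fL']; rewrite (min_idPr fL') (max_idPr Lf).
have [hN hNP] := choice (fun N : R => lipschitz_local_density N fL).
have ae_df : {ae mu, forall x, derivable f x 1}.
  have /ae_foralln : forall n : nat, {ae mu, forall x, -(n%:R) < x < n%:R -> derivable f x 1}.
    move=> n; have [_ _] := hNP n%:R; apply: filterS; first exact: (ae_filter_ringOfSetsType mu).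
    move=> x + xn; by move=> /(_ xn)[].
  apply: filterS => x /(_ (Num.bound `|x : R|)); apply.
  by rewrite -ltr_norml archi_boundP.
exists h; split => //.
  by move: ae_df; apply: filterS; [exact: (ae_filter_ringOfSetsType mu)|move=> x /df_h].
move=> a b ab.
pose N := `|a| + `|b| + 1.
have aN : - N < a < N.
  by rewrite -ltr_norml /N -addrA ltrDl ltr_wpDl.
have bN : - N < b < N.
  by rewrite -ltr_norml /N addrAC addrC ltrDl ltr_wpDl.
have [iN fN aeN] := hNP N.
have -> : f b - f a = (f b - f (-N)) - (f a - f (-N)) by ring.
rewrite !fN//.
have iS (B : set R) : measurable B -> mu.-integrable B (EFin \o hN N).
  by move=> mB; apply: integrableS iN.
have NE : \int[mu]_(t in `]-N, b]) hN N t - \int[mu]_(t in `]-N, a]) hN N t =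
    \int[mu]_(t in `]a, b]) hN N t.
  apply: Rintegral_itvB; first exact: iS.
    by rewrite bnd_simp ltW//; case/andP: aN.
  by rewrite bnd_simp.
have cab : mu.-integrable `]a, b] (EFin \o cst L%:num).
  apply/integrableP; split; first by apply/measurable_EFinP; exact: measurable_cst.
  rewrite [ltLHS](_ : _ = \int[mu]_(x in `]a, b]) cst `|L%:num|%:E x)%E//.
  rewrite integral_cst//= lebesgue_measure_itv/=.
  by case: ifP => _; rewrite ?mule0// -EFinD -EFinM ltry.
transitivity (\int[mu]_(t in `]a, b]) (hN N t - L%:num)).
  rewrite RintegralB//; last exact: iS.
  have muab : fine (mu `]a, b]) = b - a.
    rewrite lebesgue_measure_itv/= lte_fin; case: ltP => //= ba.
    by apply/esym/eqP; rewrite subr_eq0 eq_le ba ab.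
  have -> : \int[mu]_(_ in `]a, b]) L%:num = L%:num * (b - a).
    by rewrite -muab; exact: Rintegral_cst.
  by rewrite -NE; ring.
congr fine; apply: ae_eq_integral => //.
- apply/measurable_EFinP/measurable_funB => //.
  by have /measurable_int/measurable_EFinP := iS _ (measurable_itv `]a, b]).
- by apply/measurable_EFinP; exact: measurable_funTS.
- move: ae_df aeN; apply: filterS2; first exact: (ae_filter_ringOfSetsType mu).
  move=> x /df_h dx Nx; rewrite /= in_itv/= => /andP[ax xb].
  have [|_ <-] := Nx _; last by rewrite dx.
  by move: aN bN => /andP[aN _] /andP[_ bN]; rewrite (lt_trans aN)//= (le_lt_trans xb).
Qed.

End lipschitz_ae.

(** * Existence of the zero bias law *)
Lemma lebesgue_measure_segment_lty {R : realType} (a b : R) :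
  (lebesgue_measure (`[a, b]%classic : set R) < +oo)%E.
Proof.
by rewrite lebesgue_measure_itv/=; case: ifP => // _; rewrite -EFinD ltry.
Qed.

Section zero_bias_density.
Context {R : realType}.
Variable mu : probability R R.
Notation leb := (@lebesgue_measure R).
Hypothesis int1 : mu.-integrable setT (fun x => x%:E).
Hypothesis int2 : mu.-integrable setT (fun x => (x ^+ 2)%:E).
Hypothesis mean0 : (\int[mu]_x x%:E = 0)%E.

(** For [X] of law [mu], the zero bias density is [u |-> E[X 1(X > u)]]. Its
    integrand changes sign; subtracting [X 1(u < 0)], of mean zero, gives the
    nonnegative kernel below, to which Tonelli's theorem applies. *)
Definition zb_kernel (x u : R) : R := x * ((u < x)%R%:R - (u < 0)%R%:R).

Definition zb_density (u : R) : R := \int[mu]_x zb_kernel x u.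

Lemma zb_kernel_ge0 x u : 0 <= zb_kernel x u.
Proof.
rewrite /zb_kernel; case: ltP => ux; case: ltP => u0 /=; rewrite ?subrr ?mulr0//.
  by rewrite subr0 mulr1 (le_trans u0)// ltW.
by rewrite sub0r mulrN1 oppr_ge0 (le_trans ux)// ltW.
Qed.

Lemma zb_kernel_le x u : zb_kernel x u <= `|x|.
Proof.
rewrite /zb_kernel; case: ltP => ux; case: ltP => u0 /=;
  rewrite ?subrr ?mulr0//.
  by rewrite subr0 mulr1 ler_norm.
by rewrite sub0r mulrN1 -normrN ler_norm.
Qed.

Lemma measurable_zb_kernel :
  measurable_fun setT (fun z : R * R => zb_kernel z.1 z.2).
Proof.
apply: measurable_funM; first exact: measurable_fst.
apply: measurable_funB.
  apply: (measurableT_comp (f := fun b : bool => b%:R : R)) => //.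
  by apply: measurable_fun_ltr; [exact: measurable_snd|exact: measurable_fst].
apply: (measurableT_comp (f := fun b : bool => b%:R : R)) => //.
by apply: measurable_fun_ltr; [exact: measurable_snd|exact: measurable_cst].
Qed.

Lemma measurable_zb_kernel_snd x : measurable_fun setT (zb_kernel x).
Proof.
exact: (measurableT_comp measurable_zb_kernel (@pair1_measurable _ _ _ _ x)).
Qed.

Section kernel_identity.
Variables (f h : R -> R) (L : {nonneg R}).
Hypotheses (mh : measurable_fun setT h) (hL : forall x, `|h x| <= L%:num).
Hypothesis ftc : forall a b, a <= b -> f b - f a = \int[leb]_(t in `]a, b]) h t.

Let h_int (a b : R) : leb.-integrable `[a, b] (EFin \o h).
Proof.
apply: measurable_bounded_integrable => //.
- exact: lebesgue_measure_segment_lty.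
- exact: measurable_funTS.
- exists L%:num; split; first exact: num_real.
  by move=> r Lr x _; exact: le_trans (hL x) (ltW Lr).
Qed.

Let h_intS (a b : R) B : measurable B -> B `<=` `[a, b] ->
  leb.-integrable B (EFin \o h).
Proof. by move=> mB Bab; apply: integrableS (h_int a b). Qed.

(** For [x >= 0] the kernel is [x] times the indicator of [0 <= u < x], and for
    [x < 0] it is [- x] times that of [x <= u < 0]: in both cases the integral
    of [h] over the interval between [0] and [x] appears. *)
Lemma integral_zb_kernel_fst x :
  leb.-integrable setT (fun u => (zb_kernel x u * h u)%:E) /\
  \int[leb]_u (zb_kernel x u * h u) = x * (f x - f 0).
Proof.
have [x0|x0] := leP 0 x.
  have E : (fun u => zb_kernel x u * h u) = (fun u => x * (h \_ `[0, x[) u).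
    apply/funext => u; rewrite /zb_kernel patchE -mulrA; congr (_ * _).
    have -> : (u \in `[0, x[%classic) = (0 <= u < x).
      by apply/idP/idP; rewrite inE /= in_itv.
    case: ltP => ux; case: ltP => u0 /=; rewrite ?subrr ?subr0 ?mul0r ?mul1r//.
    by have := lt_le_trans u0 (le_trans x0 ux); rewrite ltxx.
  have i0x : leb.-integrable `[0, x[ (EFin \o h).
    by apply: (h_intS (a := 0) (b := x)) => //; exact: subset_itv_co_cc.
  have iE : leb.-integrable setT (EFin \o (h \_ `[0, x[)).
    by rewrite -restrict_EFin; apply/integrable_restrict => //; rewrite setTI.
  split.
    apply: eq_integrable (integrable_scale x iE) => // u _.
    by rewrite /= (congr1 (@^~ u) E).
  rewrite E RintegralZl// -Rintegral_mkcond; congr (_ * _).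
  rewrite Rintegral_itv_bndo_bndc// -Rintegral_itv_obnd_cbnd ?ftc//.
  by apply: (h_intS (a := 0) (b := x)) => //; exact: subset_itv_oc_cc.
have E : (fun u => zb_kernel x u * h u) = (fun u => - x * (h \_ `[x, 0[) u).
  apply/funext => u; rewrite /zb_kernel patchE -mulrA mulNr -mulrN; congr (_ * _).
  have -> : (u \in `[x, 0[%classic) = (x <= u < 0).
    by apply/idP/idP; rewrite inE /= in_itv.
  case: ltP => ux; case: ltP => u0 /=;
    rewrite ?subrr ?sub0r ?subr0 ?oppr0 ?mul0r ?mulN1r//.
  by have := lt_le_trans (lt_trans ux x0) u0; rewrite ltxx.
have ix0 : leb.-integrable `[x, 0[ (EFin \o h).
  by apply: (h_intS (a := x) (b := 0)) => //; exact: subset_itv_co_cc.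
have iE : leb.-integrable setT (EFin \o (h \_ `[x, 0[)).
  by rewrite -restrict_EFin; apply/integrable_restrict => //; rewrite setTI.
split.
  apply: eq_integrable (integrable_scale (- x) iE) => // u _.
  by rewrite /= (congr1 (@^~ u) E).
rewrite E RintegralZl// -Rintegral_mkcond.
rewrite Rintegral_itv_bndo_bndc// -Rintegral_itv_obnd_cbnd.
  by rewrite -ftc ?(ltW x0)//; ring.
by apply: (h_intS (a := x) (b := 0)) => //; exact: subset_itv_oc_cc.
Qed.

End kernel_identity.

Lemma integral_zb_kernel x : (\int[leb]_u (zb_kernel x u)%:E)%E = (x ^+ 2)%:E.
Proof.
have [||i1 e1] := @integral_zb_kernel_fst id (cst 1) 1%:nng (@measurable_cst _ _ _ _ _ _) _ _ x.
- by move=> u; rewrite normr1.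
- move=> a b ab; have <- : fine (leb (`]a, b]%classic : set R)) = b - a.
    rewrite lebesgue_measure_itv/= lte_fin; case: ltP => //= ba.
    by apply/esym/eqP; rewrite subr_eq0 eq_le ba ab.
  by rewrite -[LHS]mul1r; apply/esym; exact: Rintegral_cst.
rewrite -[LHS]fineK.
  congr EFin; rewrite expr2 -[X in _ * X]subr0 -[RHS]e1.
  by congr fine; apply: eq_integral => u _; rewrite mulr1.
apply: integrable_fin_num => //.
by apply: eq_integrable i1 => // u _; rewrite mulr1.
Qed.

Lemma integrable_zb_kernel u : mu.-integrable setT (fun x => (zb_kernel x u)%:E).
Proof.
apply: le_integrable int1 => //.
  apply/measurable_EFinP.
  exact: (measurableT_comp measurable_zb_kernel (@pair2_measurable _ _ _ _ u)).
by move=> x _; rewrite !abse_EFin lee_fin ger0_norm ?zb_kernel_ge0// zb_kernel_le.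
Qed.

Lemma zb_density_ge0 u : 0 <= zb_density u.
Proof. by apply: Rintegral_ge0 => x _; exact: zb_kernel_ge0. Qed.

Lemma integral_zb_kernel_snd (c u : R) :
  (\int[mu]_x (zb_kernel x u * c)%:E)%E = (c * zb_density u)%:E.
Proof.
under eq_integral do rewrite EFinM.
rewrite integralZr//; last exact: integrable_zb_kernel.
rewrite muleC EFinM; congr (_ * _)%E; rewrite /zb_density /Rintegral fineK//.
by apply: integrable_fin_num => //; exact: integrable_zb_kernel.
Qed.

(** Exchanging the integrals over [u] and over the law of [X], then integrating
    the kernel in [u] first. *)
Lemma zb_density_fubini (f h : R -> R) (L : {nonneg R}) :
  measurable_fun setT h -> (forall x, `|h x| <= L%:num) ->
  (forall a b, a <= b -> f b - f a = \int[leb]_(t in `]a, b]) h t) ->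
  leb.-integrable setT (fun u => (h u * zb_density u)%:E) /\
  (\int[leb]_u (h u * zb_density u)%:E = \int[mu]_x (x * (f x - f 0))%:E)%E.
Proof.
move=> mh hL ftc.
pose K z : \bar R := (zb_kernel z.1 z.2 * h z.2)%:E.
have mK : measurable_fun setT K.
  apply/measurable_EFinP/measurable_funM; first exact: measurable_zb_kernel.
  exact: measurableT_comp.
have iK : (mu \x leb)%E.-integrable setT K.
  apply/integrable12ltyP => //.
  apply: (@le_lt_trans _ _ (\int[mu]_x (L%:num * x ^+ 2)%:E)%E); last first.
    by have /integrable_lty := integrable_scale L%:num int2; exact.
  apply: ge0_le_integral => //.
  - by move=> x _; exact: integral_ge0.
  - apply: (@measurable_fun_fubini_tonelli_F _ _ _ _ _ leb
      (fun z => `|K z|%E)); last by move=> z.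
    exact: measurableT_comp.
  - by apply/measurable_EFinP/measurable_funM => //; exact: exprn_measurable.
  - move=> x _; rewrite EFinM -integral_zb_kernel -ge0_integralZl//.
    + apply: ge0_le_integral => //.
      * apply: measurableT_comp => //.
        exact: (measurableT_comp mK (@pair1_measurable _ _ _ _ x)).
      * apply/measurable_EFinP/measurable_funM => //.
        exact: measurable_zb_kernel_snd.
      * move=> u _; rewrite /K abse_EFin -EFinM lee_fin normrM mulrC.
        by rewrite /= (ger0_norm (zb_kernel_ge0 _ _)) ler_wpM2r ?zb_kernel_ge0.
    + by apply/measurable_EFinP; exact: measurable_zb_kernel_snd.
    + by move=> u _; rewrite lee_fin zb_kernel_ge0.
have iG := integrable_fubini_snd iK.
split.
  apply: eq_integrable iG => // u _.
  by rewrite /fubini_G /K /= integral_zb_kernel_snd.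
under eq_integral do rewrite -integral_zb_kernel_snd.
rewrite [LHS](integral21_prod_meas1 iK) -(integral12_prod_meas1 iK).
apply: eq_integral => x _.
have [i1 e1] := integral_zb_kernel_fst mh hL ftc x.
by rewrite -e1 /Rintegral fineK//; exact: integrable_fin_num.
Qed.

Lemma integral_zb_density :
  leb.-integrable setT (fun u => (zb_density u)%:E) /\
  (\int[leb]_u (zb_density u)%:E = \int[mu]_x (x ^+ 2)%:E)%E.
Proof.
have [||i1 e1] := @zb_density_fubini id (cst 1) 1%:nng (@measurable_cst _ _ _ _ _ _).
- by move=> u; rewrite normr1.
- move=> a b ab; have <- : fine (leb (`]a, b]%classic : set R)) = b - a.
    rewrite lebesgue_measure_itv/= lte_fin; case: ltP => //= ba.
    by apply/esym/eqP; rewrite subr_eq0 eq_le ba ab.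
  by rewrite -[LHS]mul1r; apply/esym; exact: Rintegral_cst.
split; first by apply: eq_integrable i1 => // u _; rewrite mul1r.
transitivity (\int[leb]_u (1 * zb_density u)%:E)%E.
  by apply: eq_integral => u _; rewrite mul1r.
by rewrite e1; apply: eq_integral => x _; rewrite subr0 expr2.
Qed.

Lemma integral_mul_lipschitz (f : R -> R) (L : {nonneg R}) :
  (forall x y, `|f x - f y| <= L%:num * `|x - y|) ->
  mu.-integrable setT (fun x => (x * f x)%:E) /\
  (\int[mu]_x (x * (f x - f 0))%:E = \int[mu]_x (x * f x)%:E)%E.
Proof.
move=> fL.
have cf : continuous f by exact: lip_continuous fL.
have i0 : mu.-integrable setT (fun x => (x * f 0)%:E).
  by under eq_fun do rewrite mulrC; exact: integrable_scale.
have iB : mu.-integrable setT (fun x => (x * (f x - f 0))%:E).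
  apply: le_integrable (integrable_scale L%:num int2) => //.
    apply/measurable_EFinP/measurable_funM => //.
    by apply: measurable_funB => //; exact: continuous_measurable_fun.
  move=> x _; rewrite !abse_EFin lee_fin expr2 !normrM (@ger0_norm _ L%:num)//.
  by rewrite mulrCA ler_wpM2l//; apply: le_trans (fL _ _) _; rewrite subr0.
have E x : (x * f x)%:E = ((x * (f x - f 0))%:E + (x * f 0)%:E)%E.
  by rewrite -EFinD -mulrDr subrK.
split; first by under eq_fun do rewrite E; exact: integrableD.
under [RHS]eq_integral do rewrite E.
rewrite integralD//.
have -> : (\int[mu]_x (x * f 0)%:E = 0)%E; last by rewrite adde0.
by under eq_integral do rewrite EFinM; rewrite integralZr// mean0 mul0e.
Qed.

Hypothesis var1 : (\int[mu]_x (x ^+ 2)%:E = 1)%E.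

Let p0 u : (0 <= (zb_density u)%:E)%E.
Proof. by rewrite lee_fin zb_density_ge0. Qed.

Let mp : measurable_fun setT (fun u => (zb_density u)%:E).
Proof. by have [/measurable_int] := integral_zb_density. Qed.

Let nu : {measure set (measurableTypeR R) -> \bar R} :=
  density_measure leb mp p0.

Let nuT : nu setT = 1%E.
Proof. by rewrite /nu/= /density_measure (integral_zb_density).2 var1. Qed.

(** Lebesgue measure lives on an alias of [R] with its own measurable structure;
    this identity carries the law of density [zb_density] back to [R] itself. *)
Let idTR : measurableTypeR R -> R := idfun.

#[local] HB.instance Definition _ :=
  @isMeasurableFun.Build _ _ _ _ idTR (@measurable_id _ _ setT).

(** [zb_density] is a probability density because [E[X^2] = 1]. For Lipschitz [f]
    the zero bias identity is Fubini's theorem for the kernel, applied to the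
    bounded measurable version of [f'] given by [lipschitz_ftc]. *)
Lemma zero_bias_exists : exists nu : probability R R, is_zero_bias mu nu.
Proof.
have [nuP nuPE] : exists nuP : probability (measurableTypeR R) R,
    forall A, measurable A -> nuP A = (\int[leb]_(x in A) (zb_density x)%:E)%E.
  pose nuP : probability (measurableTypeR R) R :=
    HB.pack (density_measure leb mp p0)
    (Measure_isProbability.Build _ (measurableTypeR R) R nu nuT).
  by exists nuP.
pose idP : {RV nuP >-> R} := idTR.
exists (distribution nuP idP) => f [M0 [_ Mf]].
have M1 : M0 < `|M0| + 1 by rewrite (le_lt_trans (ler_norm _))// ltrDl.
pose L : {nonneg R} := NngNum (addr_ge0 (normr_ge0 M0) ler01).
have fL (x y : R) : `|f x - f y| <= L%:num * `|x - y|.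
  exact: (Mf _ M1 (x, y) (conj I I)).
have [h [mh hL aeh ftc]] := lipschitz_ftc fL.
have -> : ('V_mu[idfun] = 1)%E.
  rewrite /variance covariance.unlock expectation.unlock.
  rewrite mean0 -var1 /=; apply: eq_integral => x _ /=.
  by rewrite -[LHS]/((x - 0) * (x - 0))%:E subr0 expr2.
have [i1 e1] := integral_mul_lipschitz fL.
have [i2 e2] := zb_density_fubini mh hL ftc.
rewrite mul1e expectation.unlock -e1 -e2.
have [N [mN N0 fN]] := aeh.
transitivity (\int[distribution nuP idP]_x (h x)%:E)%E; last first.
  apply/esym; apply: (@integral_eq_off_null _ R R _ _ _ N) => //.
  - exact/measurable_EFinP.
  - apply: (eq_trans (nuPE N mN)); apply: null_set_integral => //.
    exact: measurable_funTS.
  - by move=> x Nx; congr EFin; apply: contrapT => fh; apply: Nx; apply: fN.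
rewrite integral_distribution; last 2 first.
- exact/measurable_EFinP.
- exact: (@integrable_bounded _ _ _ nuP h L%:num mh hL).
by rewrite (integral_density (integral_zb_density).1 zb_density_ge0 nuPE mh).
Qed.

End zero_bias_density.

(** * Laws, independence and the Stein discrepancy *)
Section laws.
Context d (T : measurableType d) (R : realType) (P : probability T R).

(** Laws are compared with a measure [mu] that is arbitrary, so that a law known
    only up to equality on measurable sets can be used for change of variables. *)
Definition has_law d' (T' : measurableType d') (X : T -> T')
  (mu : {measure set T' -> \bar R}) :=
  forall B, measurable B -> P (X @^-1` B) = mu B.

Section change_of_variables.
Context d' (T' : measurableType d') (X : T -> T').
Variable mu : {measure set T' -> \bar R}.
Hypotheses (mX : measurable_fun setT X) (lawX : has_law X mu).
Local Open Scope ereal_scope.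

Let XRV : {mfun T >-> T'} := HB.pack X (isMeasurableFun.Build _ _ _ _ X mX).

Lemma ge0_integral_law (h : T' -> \bar R) : measurable_fun setT h ->
  (forall y, 0 <= h y) -> \int[P]_w h (X w) = \int[mu]_y h y.
Proof.
move=> mh h0.
transitivity (\int[distribution P XRV]_y h y).
  by rewrite ge0_integral_distribution.
by apply: eq_measure_integral => A mA _; exact: lawX.
Qed.

Lemma integral_law (h : T' -> R) : measurable_fun setT h ->
  \int[P]_w (h (X w))%:E = \int[mu]_y (h y)%:E.
Proof.
move=> mh; rewrite [LHS]integralE [RHS]integralE; congr (_ - _).
  rewrite -(@ge0_integral_law (fun y => (h y)%:E)^\+)//.
    by apply: eq_integral => w _; rewrite !funeposE.
  exact/measurable_funepos/measurable_EFinP.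
rewrite -(@ge0_integral_law (fun y => (h y)%:E)^\-)//.
  by apply: eq_integral => w _; rewrite !funenegE.
exact/measurable_funeneg/measurable_EFinP.
Qed.

Lemma Rintegral_law (h : T' -> R) : measurable_fun setT h ->
  (\int[P]_w h (X w) = \int[mu]_y h y)%R.
Proof. by move=> mh; rewrite /Rintegral integral_law. Qed.

Lemma integrable_law (h : T' -> R) : measurable_fun setT h ->
  P.-integrable setT (fun w => (h (X w))%:E) <->
  mu.-integrable setT (fun y => (h y)%:E).
Proof.
move=> mh.
have E : \int[P]_w `|(h (X w))%:E| = \int[mu]_y `|(h y)%:E|.
  rewrite -(@ge0_integral_law (fun y => `|(h y)%:E|))//.
  by apply: measurableT_comp => //; exact/measurable_EFinP.
split=> /integrableP[_ ih]; apply/integrableP; split.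
- exact/measurable_EFinP.
- by rewrite -E.
- by apply/measurable_EFinP; exact: measurableT_comp.
- by rewrite E.
Qed.

End change_of_variables.

Section independence.
Context d1 d2 (T1 : measurableType d1) (T2 : measurableType d2).
Variables (X : T -> T1) (Y : T -> T2).
Variables (mu : probability T1 R) (nu : probability T2 R).
Hypotheses (mX : measurable_fun setT X) (mY : measurable_fun setT Y).
Hypotheses (lawX : has_law X mu) (lawY : has_law Y nu).
Hypothesis indep : independent_RV P X Y.

Let mXY : measurable_fun setT (fun w => (X w, Y w)).
Proof. exact: measurable_fun_pair. Qed.

Let XYRV : {mfun T >-> (T1 * T2)%type} :=
  HB.pack (fun w => (X w, Y w)) (isMeasurableFun.Build _ _ _ _ _ mXY).

Lemma independent_joint_law : has_law (fun w => (X w, Y w)) (mu \x nu)%E.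
Proof.
move=> B mB; apply/esym.
apply: (@product_measure_unique _ _ _ _ _ mu nu (distribution P XYRV)) => //.
by move=> A C mA mC; rewrite -lawX// -lawY// -indep.
Qed.

Lemma independent_Fubini (h : T1 * T2 -> R) : measurable_fun setT h ->
  P.-integrable setT (fun w => (h (X w, Y w))%:E) ->
  (forall t, mu.-integrable setT (fun s => (h (s, t))%:E)) ->
  nu.-integrable setT (fun t => (\int[mu]_s h (s, t))%:E) /\
  \int[P]_w h (X w, Y w) = \int[nu]_t \int[mu]_s h (s, t).
Proof.
move=> mh ih it.
have ih2 : (mu \x nu)%E.-integrable setT (EFin \o h).
  by apply/(integrable_law mXY independent_joint_law).
have GE t : (\int[mu]_s (h (s, t))%:E = (\int[mu]_s h (s, t))%:E)%E.
  by rewrite /Rintegral fineK//; exact: integrable_fin_num.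
split.
  apply: eq_integrable (integrable_fubini_snd ih2) => // t _.
  exact: GE.
rewrite (Rintegral_law mXY independent_joint_law)// /Rintegral.
rewrite -(integral21_prod_meas1 ih2); congr fine.
by apply: eq_integral => t _; exact: GE.
Qed.

End independence.
End laws.

Section stein_discrepancy.
Context {R : realType}.

(** A quantitative form of Stein's characterization of the standard normal law,
    for which the left-hand side is always [0]. *)
Definition stein_discrepancy_le (mu : probability R R) (D : R) : Prop :=
  forall (f f' : R -> R) (B L : R), 0 < L ->
    (forall x : R, is_derive x (1 : R) f (f' x)) -> (forall x, `|f' x| <= B) ->
    (forall x y, `|f' x - f' y| <= L * `|x - y|) ->
    `|\int[mu]_x (x * f x) - \int[mu]_x f' x| <= L * D.

Lemma bounded_derive_lipschitz (f f' : R -> R) (B : R) :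
  (forall x : R, is_derive x (1 : R) f (f' x)) -> (forall x, `|f' x| <= B) ->
  forall x y, `|f x - f y| <= B * `|x - y|.
Proof.
move=> df fB x y.
wlog xy : x y / x < y.
  move=> W; case: (ltgtP x y) => [/W//|/W|->].
    by rewrite distrC [`|x - _|]distrC.
  by rewrite !subrr normr0 mulr0.
have cf : {within `[x, y], continuous f}.
  apply: continuous_subspaceT => z.
  by apply/differentiable_continuous/derivable1_diffP; exact: ex_derive.
have [c _ fxy] := MVT xy (fun z _ => df z) cf.
by rewrite distrC fxy normrM [`|x - y|]distrC ler_wpM2r.
Qed.

(** For a coupling [(X, Z)] of [mu] and its zero bias law, the difference is
    [E[f'(Z) - f'(X)]], which is at most [L E|Z - X|]; take the infimum over
    couplings. *)
Lemma stein_discrepancy_zero_bias (mu nu : probability R R) (D : R) :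
  is_zero_bias mu nu -> ('V_mu[idfun] = 1)%E ->
  (wasserstein1 mu nu <= D%:E)%E -> stein_discrepancy_le mu D.
Proof.
move=> zb var1 W f f' B L L0 df fB fL.
have cf' : continuous f' by exact: lip_continuous (ltW L0) fL.
have mf' : measurable_fun setT f' by exact: continuous_measurable_fun.
have B0 : 0 <= B by exact: le_trans (fB 0).
have if' d (T : measurableType d) (p : probability T R) (X : T -> R) :
    measurable_fun setT X -> p.-integrable setT (fun w => (f' (X w))%:E).
  by move=> mX; apply: (@integrable_bounded _ _ _ _ _ B) => //; exact: measurableT_comp.
have f_lip : lipschitz f.
  exists B; split; first exact: num_real.
  move=> M BM [x y] _ /=.
  apply: le_trans (bounded_derive_lipschitz df fB x y) _.
  by rewrite ler_wpM2r// ltW.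
have -> : \int[mu]_x (x * f x) = \int[nu]_x f' x.
  rewrite /Rintegral; congr fine.
  have := zb _ f_lip; rewrite var1 mul1e expectation.unlock => ->.
  by apply: eq_integral => x _; rewrite derive1E derive_val.
suff key pi : coupling mu nu pi ->
    ((L^-1 * `|\int[nu]_x f' x - \int[mu]_x f' x|)%:E <=
     \int[pi]_z `|z.1 - z.2|%:E)%E.
  have : ((L^-1 * `|\int[nu]_x f' x - \int[mu]_x f' x|)%:E <= D%:E)%E.
    apply: le_trans W; apply: le_ereal_inf_tmp => _ [pi cpi <-]; exact: key.
  by rewrite lee_fin mulrC ler_pdivrMr// mulrC.
move=> [law1 law2].
have l1 : has_law pi (fst : R * R -> R) mu by exact: law1.
have l2 : has_law pi (snd : R * R -> R) nu by exact: law2.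
rewrite -(Rintegral_law (@measurable_fst _ _ _ _) l1 mf').
rewrite -(Rintegral_law (@measurable_snd _ _ _ _) l2 mf').
have i1 := if' _ _ pi _ (@measurable_fst _ _ R R).
have i2 := if' _ _ pi _ (@measurable_snd _ _ R R).
have mdf : measurable_fun setT (fun z : R * R => f' z.2 - f' z.1).
  apply: measurable_funB; apply: measurableT_comp => //.
have mdist : measurable_fun setT (fun z : R * R => `|z.1 - z.2|).
  apply: measurableT_comp => //; apply: measurable_funB => //.
rewrite -RintegralB// EFinM lee_pdivrMl//.
apply: (@le_trans _ _ (\int[pi]_z `|f' z.2 - f' z.1|%:E)%E).
  rewrite EFin_normr_Rintegral//; last exact: integrable_sub.
  by apply: le_abse_integral => //; exact/measurable_EFinP.
rewrite -ge0_integralZl//; last 2 first.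
- exact/measurable_EFinP.
- exact: ltW.
apply: ge0_le_integral => //.
- by apply/measurable_EFinP; exact: measurableT_comp.
- by apply: measurable_funeM; exact/measurable_EFinP.
- by move=> z _; rewrite -EFinM lee_fin distrC.
Qed.

End stein_discrepancy.

(** * The standard normal law *)
Section gaussian.
Context {R : realType}.
Notation leb := (@lebesgue_measure R).

Lemma is_derive_continuous (f f' : R -> R) :
  (forall x : R, is_derive x (1 : R) f (f' x)) -> continuous f.
Proof.
move=> df x; apply/differentiable_continuous/derivable1_diffP.
exact: ex_derive.
Qed.

Lemma cvg0_inverse_bound (F : R -> R) (C : R) :
  (forall x, 1 <= x -> `|F x| <= C / x) -> F x @[x --> +oo] --> 0.
Proof.
move=> FC; apply/cvgrPdist_le => e e0; near=> x.
have x1 : 1 <= x by by near: x; exact: nbhs_pinfty_ge.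
have x0 : 0 < x by exact: lt_le_trans x1.
rewrite sub0r normrN; apply: (le_trans (FC x x1)).
rewrite ler_pdivrMr// mulrC -ler_pdivrMr//.
Unshelve. all: by end_near. Qed.

(** By dominated convergence the integral is the limit of the integrals over
    [[- n, n]], which are [F n - F (- n)]. *)
Lemma integral_derivative_eq0 (F F' : R -> R) (C : R) :
  (forall x : R, is_derive x (1 : R) F (F' x)) -> continuous F' ->
  leb.-integrable setT (fun x => (F' x)%:E) ->
  (forall x, 1 <= `|x| -> `|F x| <= C / `|x|) ->
  (\int[leb]_x (F' x)%:E = 0)%E.
Proof.
move=> dF cF' iF' FC.
have cF := is_derive_continuous dF.
have mF' : measurable_fun setT F' by exact: continuous_measurable_fun.
pose fn (n : nat) (x : R) : \bar R := ((F' \_ `[- n.+1%:R, n.+1%:R]) x)%:E.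
have lim1 : (\int[leb]_x fn n x)%E @[n --> \oo] --> (\int[leb]_x (F' x)%:E)%E.
  apply: (@dominated_cvg _ _ _ leb setT measurableT fn _ (fun x => `|F' x|%:E)).
  - move=> n; apply/measurable_EFinP.
    by apply/measurable_restrict => //; rewrite setTI; exact: measurable_funTS.
  - move=> x _; apply: cvg_near_cst; near=> n.
    rewrite /fn patchE mem_set//= in_itv/= -ler_norml.
    near: n; apply: filterS (nbhs_infty_ger `|x|) => n xn.
    by rewrite (le_trans xn)// ler_nat.
  - by [].
  - exact: (integrable_norm iF').
  - move=> n x _; rewrite /fn abse_EFin lee_fin patchE.
    by case: ifPn => // _; rewrite normr0.
have fnE n : (\int[leb]_x fn n x = (F n.+1%:R - F (- n.+1%:R))%:E)%E.
  pose N : R := n.+1%:R.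
  transitivity (\int[leb]_(x in `[(- N)%R, N]) (F' x)%:E)%E.
    rewrite [RHS]integral_mkcond; apply: eq_integral => x _.
    by rewrite [in RHS]restrict_EFin.
  rewrite (@continuous_FTC2 _ F' F)//.
  - by rewrite -subr_gt0 opprK -natrD ltr0n.
  - exact: continuous_subspaceT.
  - split => //; first by apply: cvg_at_right_filter; exact: cF.
    by apply: cvg_at_left_filter; exact: cF.
  - by move=> x _; rewrite derive1E derive_val.
have lim2 : (\int[leb]_x fn n x)%E @[n --> \oo] --> (0 : \bar R).
  under eq_fun do rewrite fnE.
  apply: cvg_EFin; first exact: nearW.
  have h : (n.+1%:R : R) @[n --> \oo] --> +oo.
    by apply/cvgryPge => A; apply: filterS (nbhs_infty_ger A) => m Am;
      rewrite (le_trans Am)// ler_nat.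
  rewrite -[0 in X in _ --> X](subr0 0); apply: cvgB.
    apply: cvg_comp h (@cvg0_inverse_bound F C _) => x x1.
    by have := FC x; rewrite ger0_norm; [apply | exact: le_trans x1].
  apply: (cvg_comp _ _ h (@cvg0_inverse_bound (fun x => F (- x)) C _)) => x x1.
  by have := FC (-x); rewrite normrN ger0_norm; [apply | exact: le_trans x1].
exact: cvg_unique lim1 lim2.
Unshelve. all: by end_near. Qed.

Lemma pow_le_cube (u : R) : 0 <= u -> u <= 1 + u ^+ 3 /\ u ^+ 2 <= 1 + u ^+ 3.
Proof.
move=> u0; have u3 : 0 <= u ^+ 3 by exact: exprn_ge0.
have [u1|/ltW u1] := leP u 1.
  by split; rewrite (@le_trans _ _ 1) ?lerDl// exprn_ile1.
split; rewrite (@le_trans _ _ (u ^+ 3)) ?lerDr ?ler_weXn2l//.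
by rewrite -[leLHS]expr1 ler_weXn2l.
Qed.

Definition gauss_phi (x : R) : R := normal_peak 1 * expR (- (x ^+ 2 / 2)).

Lemma normal_pdf01 (x : R) : normal_pdf 0 1 x = gauss_phi x.
Proof.
rewrite normal_pdfE ?oner_neq0// /normal_fun /gauss_phi subr0.
by rewrite expr1n mulNr.
Qed.

Lemma gauss_phi_ge0 x : 0 <= gauss_phi x.
Proof. by rewrite mulr_ge0 ?normal_peak_ge0 ?expR_ge0. Qed.

Lemma is_derive_gauss_phi (x : R) : is_derive x (1 : R) gauss_phi (- x * gauss_phi x).
Proof.
rewrite /gauss_phi.
have d1 : is_derive x (1 : R) (fun y : R => - (y ^+ 2 / 2)) (- x).
  by apply: is_derive_eq; rewrite scaler0 scaler0 add0r /GRing.scale/=; lra.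
by apply: is_derive_eq; rewrite /GRing.scale/=; ring.
Qed.

Lemma continuous_gauss_phi : continuous gauss_phi.
Proof. exact: is_derive_continuous is_derive_gauss_phi. Qed.

Lemma measurable_gauss_phi : measurable_fun setT gauss_phi.
Proof. exact: continuous_measurable_fun continuous_gauss_phi. Qed.

(** Makes the boundary terms of the integrations by parts [O(1/x)], for functions
    of at most cubic growth; it is the square of [exp t >= 1 + t] at
    [t = x^2 / 4]. *)
Lemma gauss_phi_tail x : x ^+ 4 * gauss_phi x <= 16 * normal_peak 1.
Proof.
rewrite /gauss_phi mulrCA mulrC ler_wpM2r ?normal_peak_ge0//.
rewrite expRN ler_pdivrMr ?expR_gt0//.
have -> : x ^+ 2 / 2 = x ^+ 2 / 4 + x ^+ 2 / 4 by field.
rewrite expRD; have := expR_ge1Dx (x ^+ 2 / 4).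
set E := expR _ => h.
have x2 : 0 <= x ^+ 2 by rewrite sqr_ge0.
have -> : x ^+ 4 = (x ^+ 2) ^+ 2 by rewrite -exprM.
nra.
Qed.

Lemma integrable_gauss_phi : leb.-integrable setT (fun x => (gauss_phi x)%:E).
Proof.
apply: eq_integrable (integrable_normal_pdf 0 1) => // x _.
by rewrite normal_pdf01.
Qed.

Lemma gauss_third_moment :
  (\int[leb]_x (`|x| ^+ 3 * gauss_phi x)%:E = (4 * normal_peak 1)%:E)%E.
Proof.
pose f x := `|x| ^+ 3 * gauss_phi x.
have cf : continuous f.
  move=> x; apply: cvgM; last exact: continuous_gauss_phi.
  apply: (@continuous_comp _ _ _ (fun x : R => `|x|) (fun x : R => x ^+ 3)).
    exact: norm_continuous.
  exact: exprn_continuous.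
have f0 x : 0 <= f x by rewrite mulr_ge0 ?exprn_ge0 ?gauss_phi_ge0.
rewrite (ge0_symfun_integralT f0 cf); last first.
  by move=> x /=; rewrite /f normrN /gauss_phi sqrrN.
(* A primitive of x^3 phi x, since phi' x = - x phi x. *)
pose F x := - (x ^+ 2 + 2) * gauss_phi x.
have dF (x : R) : is_derive x (1 : R) F (x ^+ 3 * gauss_phi x).
  have dg := is_derive_gauss_phi x.
  by apply: is_derive_eq; rewrite /GRing.scale/=; ring.
have cF := is_derive_continuous dF.
rewrite -set_itvcy (@ge0_continuous_FTC2y _ f F 0 0)//.
- rewrite -EFinB -EFinM; congr EFin.
  by rewrite /F /gauss_phi expr0n/= mul0r oppr0 expR0; ring.
- exact: continuous_subspaceT.
- apply: (@cvg0_inverse_bound F (48 * normal_peak 1)) => x x1.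
  have x0 : 0 < x by exact: lt_le_trans x1.
  have p2 : 0 <= x ^+ 2 + 2 by rewrite addr_ge0 ?sqr_ge0.
  rewrite ler_pdivlMr// /F normrM normrN (ger0_norm p2).
  rewrite (ger0_norm (gauss_phi_ge0 x)).
  apply: (@le_trans _ _ (3 * x ^+ 4 * gauss_phi x)).
    rewrite mulrAC ler_wpM2r ?gauss_phi_ge0//.
    have h2 : 1 <= x ^+ 2 by rewrite exprn_ege1.
    have h1 : x <= x ^+ 2 by rewrite expr2 ler_peMr// ltW.
    have -> : x ^+ 4 = x ^+ 2 * x ^+ 2 by rewrite -exprD.
    nra.
  by rewrite -mulrA; have := gauss_phi_tail x; lra.
- by apply: cvg_at_right_filter; exact: cF.
- move=> x /[!in_itv]/=/andP[x0 _].
  by rewrite derive1E derive_val /f ger0_norm// ltW.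
Qed.

Lemma integrable_gauss_bound (h : R -> R) (C D : R) : measurable_fun setT h ->
  (forall x, `|h x| <= C + D * `|x| ^+ 3) ->
  leb.-integrable setT (fun x => (h x * gauss_phi x)%:E).
Proof.
move=> mh hb.
have i3 : leb.-integrable setT (fun x => (`|x| ^+ 3 * gauss_phi x)%:E).
  apply/integrableP; split.
    apply/measurable_EFinP/measurable_funM; last exact: measurable_gauss_phi.
    by apply: measurable_funX; apply: continuous_measurable_fun; exact: norm_continuous.
  rewrite [ltLHS](_ : _ = (4 * normal_peak 1)%:E) ?ltry//.
  rewrite -gauss_third_moment; apply: eq_integral => x _.
  by rewrite abse_EFin ger0_norm// mulr_ge0 ?exprn_ge0 ?gauss_phi_ge0.
apply: (@integrable_le _ (measurableTypeR R) R leb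
  (fun x => h x * gauss_phi x) (fun x => C * gauss_phi x + D * (`|x| ^+ 3 * gauss_phi x))).
- exact: measurable_funM mh measurable_gauss_phi.
- by apply: integrable_add; apply: integrable_scale => //; exact: integrable_gauss_phi.
- move=> x; rewrite normrM (ger0_norm (gauss_phi_ge0 x)).
  have -> : C * gauss_phi x + D * (`|x : R| ^+ 3 * gauss_phi x) =
      (C + D * `|x : R| ^+ 3) * gauss_phi x by ring.
  by rewrite ler_wpM2r ?gauss_phi_ge0.
Qed.

(** The derivative [f' phi - x f phi] of [f phi] integrates to [0]. *)
Lemma gauss_integration_by_parts (f f' : R -> R) (B : R) :
  (forall x : R, is_derive x (1 : R) f (f' x)) -> continuous f' ->
  (forall x, `|f' x| <= B) ->
  leb.-integrable setT (fun x => (f' x * gauss_phi x)%:E) /\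
  leb.-integrable setT (fun x => (x * f x * gauss_phi x)%:E) /\
  \int[leb]_x (x * f x * gauss_phi x) = \int[leb]_x (f' x * gauss_phi x).
Proof.
move=> df cf' fB.
have B0 : 0 <= B by exact: le_trans (fB 0).
have cf := is_derive_continuous df.
have mf : measurable_fun setT f by exact: continuous_measurable_fun.
have mf' : measurable_fun setT f' by exact: continuous_measurable_fun.
have fL x : `|f x| <= `|f 0| + B * `|x|.
  have := bounded_derive_lipschitz df fB x 0; rewrite subr0 => h.
  by rewrite -[f x](subrK (f 0)) (le_trans (ler_normD _ _))// addrC lerD2l.
have i1 : leb.-integrable setT (fun x => (f' x * gauss_phi x)%:E).
  by apply: (@integrable_gauss_bound _ B 0) => // x; rewrite mul0r addr0.
have i2 : leb.-integrable setT (fun x => (x * f x * gauss_phi x)%:E).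
  apply: (@integrable_gauss_bound _ (`|f 0| + B) (`|f 0| + B)) => //.
    exact: measurable_funM.
  move=> x; rewrite normrM.
  apply: (@le_trans _ _ (`|x| * (`|f 0| + B * `|x|))); first by rewrite ler_wpM2l.
  have [h1 h2] := pow_le_cube (normr_ge0 x).
  have := ler_wpM2l (normr_ge0 (f 0)) h1; have := ler_wpM2l B0 h2.
  by rewrite expr2; lra.
split => //; split => //.
have dF (x : R) : is_derive x (1 : R) (fun x => f x * gauss_phi x)
    (f' x * gauss_phi x - x * f x * gauss_phi x).
  have d1 := df x; have d2 := is_derive_gauss_phi x.
  by apply: is_derive_eq; rewrite /GRing.scale/=; ring.
apply/eqP; rewrite eq_sym -subr_eq0 -RintegralB//; apply/eqP; rewrite /Rintegral.
rewrite (@integral_derivative_eq0 _ _ ((`|f 0| + B) * 16 * normal_peak 1) dF)//.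
- move=> x; apply: cvgB; apply: cvgM; try exact: continuous_gauss_phi; first exact: cf'.
  by apply: cvgM; [exact: cvg_id|exact: cf].
- exact: integrable_sub.
- move=> x x1; have x0 : 0 < `|x| by exact: lt_le_trans x1.
  rewrite ler_pdivlMr// normrM (ger0_norm (gauss_phi_ge0 x)).
  have h := gauss_phi_tail x.
  apply: (@le_trans _ _ ((`|f 0| + B) * (x ^+ 4 * gauss_phi x))); last first.
    by rewrite -mulrA ler_wpM2l// addr_ge0.
  rewrite mulrAC [leRHS]mulrA ler_wpM2r ?gauss_phi_ge0//.
  have f1 : `|f x| <= (`|f 0| + B) * `|x|.
    by rewrite (le_trans (fL x))// mulrDl lerD2r ler_peMr.
  apply: (@le_trans _ _ ((`|f 0| + B) * `|x| * `|x|)); first by rewrite ler_wpM2r.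
  rewrite -mulrA ler_wpM2l ?addr_ge0//.
  have -> : x ^+ 4 = `|x| ^+ 4 by rewrite -normrX ger0_norm// exprn_even_ge0.
  by rewrite -expr2 ler_weXn2l.
Qed.

Section standard_normal.
Variable mu : probability R R.
Hypothesis mu_normal : same_law mu (normal_prob 0 1).

Lemma integral_normal (h : R -> R) : measurable_fun setT h ->
  (\int[mu]_x (h x)%:E = \int[leb]_x (h x * gauss_phi x)%:E)%E.
Proof.
move=> mh.
rewrite (@integral_law _ _ _ mu _ (measurableTypeR R) idfun (normal_prob 0 1))//;
  last exact: (@measurable_id _ R setT).
rewrite (@integral_density _ _ _ leb (normal_prob 0 1) gauss_phi h)//.
- exact: integrable_gauss_phi.
- exact: gauss_phi_ge0.
- by move=> A mA; apply: eq_integral => x _; rewrite normal_pdf01.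
Qed.

Lemma integrable_normal (h : R -> R) : measurable_fun setT h ->
  leb.-integrable setT (fun x => (h x * gauss_phi x)%:E) ->
  mu.-integrable setT (fun x => (h x)%:E).
Proof.
move=> mh /integrableP[_ ih]; apply/integrableP; split; first exact/measurable_EFinP.
apply: le_lt_trans ih; rewrite (@integral_normal (fun x => `|h x|)).
  rewrite le_eqVlt; apply/orP; left; apply/eqP; apply: eq_integral => x _.
  by rewrite abse_EFin normrM (ger0_norm (gauss_phi_ge0 x)).
exact: measurableT_comp.
Qed.

Lemma normal_third_moment :
  (\int[mu]_x (`|x| ^+ 3)%:E = (Num.sqrt (8 / pi))%:E)%E.
Proof.
rewrite (@integral_normal (fun x => `|x| ^+ 3)); last first.
  by apply: measurable_funX; apply: continuous_measurable_fun; exact: norm_continuous.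
rewrite gauss_third_moment; congr EFin; rewrite /normal_peak expr1n mul1r.
have pi0 : 0 < pi :> R by exact: pi_gt0.
have pin0 : pi != 0 :> R by rewrite gt_eqF.
have -> : 8 / pi = 16 / (pi *+ 2) :> R.
  by rewrite -(mulr_natr pi 2) invfM mulrA mulrAC; congr (_ / _); lra.
rewrite sqrtrM// sqrtrV; last by rewrite mulrn_wge0// ltW.
congr (_ * _); have -> : 16 = 4 ^+ 2 :> R by rewrite -natrX.
by rewrite sqrtr_sqr ger0_norm.
Qed.

(** Integration by parts with [f = 1] and [f = id]. *)
Lemma normal_moments : [/\ mu.-integrable setT (fun x => x%:E),
  mu.-integrable setT (fun x => (x ^+ 2)%:E),
  (\int[mu]_x x%:E = 0)%E & (\int[mu]_x (x ^+ 2)%:E = 1)%E].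
Proof.
have d1 (x : R) : is_derive x (1 : R) (fun=> 1 : R) (0 : R).
  exact: is_derive_cst.
have [_ [i1 e1]] : leb.-integrable setT (fun x => (0 * gauss_phi x)%:E) /\
    leb.-integrable setT (fun x => (x * 1 * gauss_phi x)%:E) /\
    \int[leb]_x (x * 1 * gauss_phi x) = \int[leb]_x (0 * gauss_phi x).
  apply: (@gauss_integration_by_parts (fun=> 1) (fun=> 0) 0) => //.
    by move=> x; exact: cvg_cst.
  by move=> x; rewrite normr0.
have d2 (x : R) : is_derive x (1 : R) (id : R -> R) (1 : R).
  exact: is_derive_id.
have [i0 [i2 e2]] : leb.-integrable setT (fun x => (1 * gauss_phi x)%:E) /\
    leb.-integrable setT (fun x => (x * x * gauss_phi x)%:E) /\
    \int[leb]_x (x * x * gauss_phi x) = \int[leb]_x (1 * gauss_phi x).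
  apply: (@gauss_integration_by_parts id (fun=> 1) 1) => //.
    by move=> x; exact: cvg_cst.
  by move=> x; rewrite normr1.
have I1 : mu.-integrable setT (fun x => x%:E).
  by apply: integrable_normal => //; apply: eq_integrable i1 => // x _; rewrite mulr1.
have I2 : mu.-integrable setT (fun x => (x ^+ 2)%:E).
  by apply: integrable_normal => //; exact: exprn_measurable.
split => //.
- rewrite -[LHS]fineK; last exact: integrable_fin_num.
  rewrite (@integral_normal id)//; congr EFin.
  transitivity (\int[leb]_x (x * 1 * gauss_phi x)).
    by apply: eq_Rintegral => x _; rewrite mulr1.
  rewrite e1 /Rintegral; under eq_integral do rewrite mul0r.
  by rewrite integral0.
- rewrite -[LHS]fineK; last exact: integrable_fin_num.
  rewrite (@integral_normal (fun x => x ^+ 2)); last exact: exprn_measurable.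
  congr EFin; rewrite -[LHS]/(\int[leb]_x (x * x * gauss_phi x)) e2.
  transitivity (\int[leb]_x normal_pdf 0 1 x); last first.
    by rewrite /Rintegral integral_normal_pdf.
  by apply: eq_Rintegral => x _; rewrite normal_pdf01 mul1r.
Qed.

Lemma normal_stein : stein_discrepancy_le mu 0.
Proof.
move=> f f' B L L0 df fB fL; rewrite mulr0.
have cf' : continuous f' by exact: lip_continuous (ltW L0) fL.
have [_ [_ e]] := gauss_integration_by_parts df cf' fB.
have mf : measurable_fun setT f.
  by apply: continuous_measurable_fun; exact: is_derive_continuous df.
rewrite /Rintegral (@integral_normal (fun x => x * f x)); last exact: measurable_funM.
rewrite (@integral_normal f'); last exact: continuous_measurable_fun.
by rewrite [X in X - _]e subrr normr0.
Qed.

Lemma normal_symmetric : has_law mu (fun x => - x) mu.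
Proof.
move=> B mB; have mNB : measurable ((fun x : R => - x) @^-1` B).
  by rewrite -[X in measurable X]setTI; exact: (oppr_measurable measurableT).
rewrite [LHS]mu_normal// [RHS]mu_normal// /normal_prob.
pose NB : set R := (fun x : R => - x) @^-1` B.
transitivity (\int[leb]_(x in NB)
    ((fun y : R => (normal_pdf 0 1 y)%:E) \o (-%R : R -> R)) x)%E.
  by apply: eq_integral => x _ /=; rewrite !normal_pdf01 /gauss_phi sqrrN.
rewrite -(@ge0_integral_pushforward _ _ (measurableTypeR R) (measurableTypeR R) R)//.
- apply: eq_measure_integral; first exact: oppr_measurable.
  by move=> mN A mA _; exact: lebesgue_measureN.
- exact: oppr_measurable.
- apply: measurable_funTS; apply/measurable_EFinP; exact: measurable_normal_pdf.
- by move=> y _; rewrite lee_fin normal_pdf_ge0.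
Qed.

End standard_normal.
End gaussian.

(** * Sums of independent variables *)
Lemma Rintegral_norm_le d (T : measurableType d) (R : realType)
    (P : probability T R) (F : T -> R) (K : R) :
  P.-integrable setT (fun w => (F w)%:E) -> (forall w, `|F w| <= K) ->
  `|\int[P]_w F w| <= K.
Proof.
move=> iF FK; apply: (le_trans (le_normr_Rintegral measurableT iF)).
have -> : K = \int[P]_w K.
  by rewrite Rintegral_cst// [X in fine X]probability_setT mulr1.
apply: le_Rintegral => //; first exact: integrable_norm iF.
exact: finite_measure_integrable_cst.
Qed.

Section stein_step.
Context d (T : measurableType d) (R : realType) (P : probability T R).
Variables (X Y : T -> R) (mu : probability R R).
Hypotheses (mX : measurable_fun setT X) (mY : measurable_fun setT Y).
Hypothesis lawX : has_law P X mu.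
Hypothesis indep : independent_RV P X Y.
Hypotheses (X2 : mu.-integrable setT (fun x => (x ^+ 2)%:E))
           (Y2 : P.-integrable setT (fun w => (Y w ^+ 2)%:E)).
Let YRV : {RV P >-> R} := HB.pack Y (isMeasurableFun.Build _ _ _ _ Y mY).
Let nu := distribution P YRV.
Let lawY : has_law P Y nu. Proof. by []. Qed.
Variables (f f' : R -> R) (B L : R).
Hypotheses (L0 : 0 < L) (df : forall x : R, is_derive x (1 : R) f (f' x))
  (fB : forall x, `|f' x| <= B)
  (fL : forall x y, `|f' x - f' y| <= L * `|x - y|).
Variable c : R.

Let B0 : 0 <= B. Proof. exact: le_trans (fB 0). Qed.

Let mf : measurable_fun setT f.
Proof. by apply: continuous_measurable_fun; exact: is_derive_continuous df. Qed.

Let mf' : measurable_fun setT f'.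
Proof. by apply: continuous_measurable_fun; exact: lip_continuous (ltW L0) fL. Qed.

Let K := `|f 0| + B * `|c| + B.

Let bound s t : `|s * f (c * s + t)| <= K * (1 + s ^+ 2 + t ^+ 2).
Proof.
have h : `|f (c * s + t)| <= `|f 0| + B * (`|c| * `|s| + `|t|).
  rewrite -[f _](subrK (f 0)) (le_trans (ler_normD _ _))// addrC lerD2l.
  apply: (le_trans (bounded_derive_lipschitz df fB _ _)); rewrite subr0 ler_wpM2l//.
  by rewrite (le_trans (ler_normD _ _))// normrM.
rewrite normrM; apply: (@le_trans _ _ (`|s| * (`|f 0| + B * (`|c| * `|s| + `|t|)))).
  by rewrite ler_wpM2l.
have <- : `|s| ^+ 2 = s ^+ 2 by rewrite -normrX ger0_norm// sqr_ge0.
have <- : `|t| ^+ 2 = t ^+ 2 by rewrite -normrX ger0_norm// sqr_ge0.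
rewrite /K; move: (normr_ge0 s) (normr_ge0 t) (normr_ge0 (f 0)) (normr_ge0 c) B0.
move: (`|s|) (`|t|) (`|f 0|) (`|c|) B => u v a b e u0 v0 a0 b0 e0.
have h1 : u <= 1 + u ^+ 2 + v ^+ 2.
  have := sqr_ge0 (u - 1); have := sqr_ge0 v; rewrite sqrrB expr1n mulr1; lra.
have h2 : u * v <= 1 + u ^+ 2 + v ^+ 2.
  have := sqr_ge0 (u - v); have := sqr_ge0 u; have := sqr_ge0 v.
  by rewrite sqrrB; lra.
have h3 : u ^+ 2 <= 1 + u ^+ 2 + v ^+ 2 by have := sqr_ge0 v; lra.
have := ler_wpM2l a0 h1; have := ler_wpM2l e0 h2.
have := ler_wpM2l (mulr_ge0 e0 b0) h3.
by rewrite !expr2; lra.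
Qed.

Let mh : measurable_fun setT (fun z : R * R => z.1 * f (c * z.1 + z.2)).
Proof.
apply: measurable_funM; first exact: measurable_fst.
apply: measurableT_comp => //; apply: measurable_funD; last exact: measurable_snd.
by apply: measurable_funM => //; exact: measurable_fst.
Qed.

Let mh' : measurable_fun setT (fun z : R * R => f' (c * z.1 + z.2)).
Proof.
apply: measurableT_comp => //; apply: measurable_funD; last exact: measurable_snd.
by apply: measurable_funM => //; exact: measurable_fst.
Qed.

Lemma integrable_stein_step :
  P.-integrable setT (fun w => (X w * f (c * X w + Y w))%:E).
Proof.
apply: (@integrable_le _ _ _ _ _ (fun w => K * (1 + X w ^+ 2 + Y w ^+ 2))).
- exact: (measurableT_comp mh (measurable_fun_pair mX mY)).
- apply: integrable_scale; apply: integrable_add => //.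
  apply: integrable_add; first exact: finite_measure_integrable_cst.
  by apply/(integrable_law mX lawX (exprn_measurable 2)).
- by move=> w; exact: bound.
Qed.

(** With [Y] frozen at [t], the function [s |-> f (c s + t)] has derivative
    [c f' (c s + t)], which is [c^2 L]-Lipschitz; the discrepancy of [X] then
    costs [c^2 L D], and one more factor [c] is in front. Fubini's theorem
    integrates this over [t]. *)
Lemma stein_step (D : R) : stein_discrepancy_le mu D ->
  `|c * (\int[P]_w (X w * f (c * X w + Y w)))
    - c ^+ 2 * \int[P]_w f' (c * X w + Y w)| <= `|c| ^+ 3 * (L * D).
Proof.
move=> sd; have [->|c0] := eqVneq c 0.
  by rewrite expr0n/= !mul0r subrr normr0 expr0n mul0r.
have it t : mu.-integrable setT (fun s => (s * f (c * s + t))%:E).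
  apply: (@integrable_le _ R R mu (fun s => s * f (c * s + t))
    (fun s => K * (1 + s ^+ 2 + t ^+ 2))).
  - exact: (measurableT_comp mh (@pair2_measurable _ _ _ _ t)).
  - apply: integrable_scale; apply: integrable_add; last first.
      exact: finite_measure_integrable_cst.
    by apply: integrable_add => //; exact: finite_measure_integrable_cst.
  - by move=> s; exact: bound.
have it' t : mu.-integrable setT (fun s => (f' (c * s + t))%:E).
  apply: (@integrable_bounded _ _ _ _ _ B) => //.
  exact: (measurableT_comp mh' (@pair2_measurable _ _ _ _ t)).
have iP' : P.-integrable setT (fun w => (f' (c * X w + Y w))%:E).
  apply: (@integrable_bounded _ _ _ _ _ B) => //.
  exact: (measurableT_comp mh' (measurable_fun_pair mX mY)).
have [i1 ->] := independent_Fubini mX mY lawX lawY indep mh integrable_stein_step it.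
have [i2 ->] := independent_Fubini mX mY lawX lawY indep mh' iP' it'.
rewrite -!RintegralZl// -RintegralB//; last 2 first.
- exact: integrable_scale.
- exact: integrable_scale.
apply: Rintegral_norm_le.
  by apply: integrable_sub; exact: integrable_scale.
move=> t /=.
have c20 : 0 < c ^+ 2 by rewrite exprn_even_gt0.
have dphi (s : R) : is_derive s (1 : R) (fun s => f (c * s + t)) (c * f' (c * s + t)).
  have d1 : is_derive s (1 : R) (fun s : R => c * s + t) c.
    by apply: is_derive_eq; rewrite /GRing.scale/=; ring.
  have d2 := df (c * s + t).
  have := @is_derive1_comp _ f (fun s : R => c * s + t) s _ _ d2 d1.
  by move=> h; apply: is_derive_eq; rewrite mulrC.
have := sd (fun s => f (c * s + t)) (fun s => c * f' (c * s + t)) (`|c| * B)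
  (c ^+ 2 * L) (mulr_gt0 c20 L0) dphi.
have -> : \int[mu]_s (c * f' (c * s + t)) = c * \int[mu]_s f' (c * s + t).
  by apply: RintegralZl => //; exact: it'.
have -> : c * (\int[mu]_s (s * f (c * s + t))) - c ^+ 2 * (\int[mu]_s f' (c * s + t)) =
    c * (\int[mu]_s (s * f (c * s + t)) - c * \int[mu]_s f' (c * s + t)) by ring.
move=> H; rewrite normrM exprS -mulrA ler_wpM2l//.
have <- : c ^+ 2 = `|c| ^+ 2 by rewrite -normrX ger0_norm// ltW.
rewrite mulrA; apply: H => x; first by rewrite normrM ler_wpM2l.
move=> y; rewrite -mulrBr normrM.
apply: (le_trans (ler_wpM2l (normr_ge0 c) (fL _ _))).
have -> : c * x + t - (c * y + t) = c * (x - y) by ring.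
have -> : c ^+ 2 = `|c| * `|c| by rewrite -normrM -expr2 ger0_norm// ltW.
by rewrite normrM le_eqVlt; apply/orP; left; apply/eqP; ring.
Qed.

End stein_step.

Lemma independent_expectation_mul d (T : measurableType d) (R : realType)
    (P : probability T R) (X Y : T -> R) (mu nu : probability R R) :
  measurable_fun setT X -> measurable_fun setT Y ->
  has_law P X mu -> has_law P Y nu -> independent_RV P X Y ->
  mu.-integrable setT (fun x => x%:E) -> nu.-integrable setT (fun x => x%:E) ->
  P.-integrable setT (fun w => (X w * Y w)%:E) ->
  \int[P]_w (X w * Y w) = (\int[mu]_x x) * (\int[nu]_x x).
Proof.
move=> mX mY lawX lawY indep iX iY iXY.
have mh : measurable_fun setT (fun z : R * R => z.1 * z.2).
  by apply: measurable_funM; [exact: measurable_fst|exact: measurable_snd].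
have it t : mu.-integrable setT (fun s => (s * t)%:E).
  by under eq_fun do rewrite mulrC; exact: integrable_scale.
have [_ ->] := independent_Fubini mX mY lawX lawY indep mh iXY it.
rewrite -RintegralZl//; apply: eq_Rintegral => t _ /=.
by rewrite -RintegralZr.
Qed.

Section standardized.
Context {R : realType}.

Definition standardized (mu : probability R R) : Prop :=
  [/\ mu.-integrable setT (fun x => x%:E),
      mu.-integrable setT (fun x => (x ^+ 2)%:E),
      \int[mu]_x x = 0 & \int[mu]_x (x ^+ 2) = 1].

Definition symmetric_dist (mu : probability R R) : Prop :=
  has_law mu (fun x => - x) mu.

Lemma normal_standardized (mu : probability R R) :
  same_law mu (normal_prob 0 1) -> standardized mu.
Proof.
by move=> /normal_moments[i1 i2 e1 e2]; split; rewrite // /Rintegral ?e1 ?e2.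
Qed.

Section sums.
Context d (T : measurableType d) (P : probability T R).
Variables (X Y Z : {RV P >-> R}) (c e : R).
Hypothesis indep : independent_RV P X Y.
Hypothesis ZE : forall w, Z w = c * Y w + e * X w.
Let muX := distribution P X.
Let muY := distribution P Y.
Let muZ := distribution P Z.

Let lawX : has_law P X muX. Proof. by []. Qed.
Let lawY : has_law P Y muY. Proof. by []. Qed.
Let lawZ : has_law P Z muZ. Proof. by []. Qed.
Let mX : measurable_fun setT X. Proof. by []. Qed.
Let mY : measurable_fun setT Y. Proof. by []. Qed.
Let mZ : measurable_fun setT Z. Proof. by []. Qed.

Lemma independent_RV_sym : independent_RV P Y X.
Proof. by move=> B C mB mC; rewrite setIC indep// muleC. Qed.

(** The cross term of the square vanishes by independence. *)
Lemma independent_sum_standardized : c ^+ 2 + e ^+ 2 = 1 ->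
  standardized muX -> standardized muY -> standardized muZ.
Proof.
move=> ce [iX1 iX2 X0 X1] [iY1 iY2 Y0 Y1].
have jX1 : P.-integrable setT (fun w => (X w)%:E).
  by apply/(integrable_law mX lawX (h := id)).
have jY1 : P.-integrable setT (fun w => (Y w)%:E).
  by apply/(integrable_law mY lawY (h := id)).
have jX2 : P.-integrable setT (fun w => (X w ^+ 2)%:E).
  by apply/(integrable_law mX lawX (exprn_measurable 2)).
have jY2 : P.-integrable setT (fun w => (Y w ^+ 2)%:E).
  by apply/(integrable_law mY lawY (exprn_measurable 2)).
have jXY : P.-integrable setT (fun w => (X w * Y w)%:E).
  apply: (@integrable_le _ _ _ _ (fun w => X w * Y w)
    (fun w => X w ^+ 2 + Y w ^+ 2)) => //.
  - exact: measurable_funM.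
  - exact: integrable_add.
  - move=> w; rewrite ler_norml; have := sqr_ge0 (X w - Y w).
    have := sqr_ge0 (X w + Y w); have := sqr_ge0 (X w); have := sqr_ge0 (Y w).
    by rewrite sqrrD sqrrB; move=> *; apply/andP; split; lra.
have XY0 : \int[P]_w (X w * Y w) = 0.
  by rewrite (independent_expectation_mul mX mY lawX lawY)// X0 mul0r.
have jZ1 : P.-integrable setT (fun w => (Z w)%:E).
  under eq_fun do rewrite ZE.
  by apply: integrable_add; exact: integrable_scale.
have Z2E w : Z w ^+ 2 = c ^+ 2 * Y w ^+ 2 + (2 * c * e) * (X w * Y w) + e ^+ 2 * X w ^+ 2.
  by rewrite ZE; ring.
have jZ2 : P.-integrable setT (fun w => (Z w ^+ 2)%:E).
  under eq_fun do rewrite Z2E.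
  by apply: integrable_add; [apply: integrable_add|]; exact: integrable_scale.
split.
- by apply/(integrable_law mZ lawZ (h := id)).
- by apply/(integrable_law mZ lawZ (exprn_measurable 2)).
- rewrite -(Rintegral_law mZ lawZ (h := id))//.
  under eq_Rintegral do rewrite ZE.
  rewrite RintegralD ?RintegralZl//; try exact: integrable_scale.
  rewrite (Rintegral_law mX lawX (h := id))// (Rintegral_law mY lawY (h := id))//.
  by rewrite X0 Y0 !mulr0 addr0.
- rewrite -(Rintegral_law mZ lawZ (exprn_measurable 2)).
  under eq_Rintegral do rewrite Z2E.
  rewrite !RintegralD ?RintegralZl//; try exact: integrable_scale; last first.
    by apply: integrable_add; exact: integrable_scale.
  rewrite XY0 (Rintegral_law mX lawX (exprn_measurable 2)).
  rewrite (Rintegral_law mY lawY (exprn_measurable 2)).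
  by rewrite X1 Y1 mulr0 !mulr1 addr0.
Qed.

Lemma independent_sum_symmetric :
  symmetric_dist muX -> symmetric_dist muY -> symmetric_dist muZ.
Proof.
move=> sX sY B mB.
pose NX w := - X w; pose NY w := - Y w.
have mN : measurable_fun setT (fun x : R => - x) by exact: oppr_measurable.
have mNX : measurable_fun setT NX by exact: measurableT_comp.
have mNY : measurable_fun setT NY by exact: measurableT_comp.
have mNpre C : measurable C -> measurable ((fun x : R => - x) @^-1` C).
  by move=> mC; rewrite -[X in measurable X]setTI; exact: mN.
have lawNX : has_law P NX muX by move=> C mC; exact: sX.
have lawNY : has_law P NY muY by move=> C mC; exact: sY.
have indepN : independent_RV P NX NY.
  by move=> C D mC mD; exact: (indep (mNpre _ mC) (mNpre _ mD)).
have mh : measurable_fun setT (fun z : R * R => c * z.2 + e * z.1).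
  by apply: measurable_funD; apply: measurable_funM.
pose S := (fun z : R * R => c * z.2 + e * z.1) @^-1` B.
have mS : measurable S by rewrite -[S]setTI; exact: mh.
transitivity (P ((fun w => (NX w, NY w)) @^-1` S)).
  rewrite /muZ /distribution /pushforward; congr (P _); apply/seteqP.
  by split=> w /=; rewrite /S /NX /NY /= ZE !mulrN -opprD.
rewrite (independent_joint_law mNX mNY lawNX lawNY indepN mS).
rewrite -(independent_joint_law mX mY lawX lawY indep mS).
rewrite /muZ /distribution /pushforward; congr (P _); apply/seteqP.
by split=> w /=; rewrite /S /= ZE.
Qed.

(** [E[Z f(Z)]] splits along the two summands of [Z], and [E[f'(Z)]] is split in
    the same way with weights [c^2] and [e^2]. *)
Lemma independent_sum_stein (D1 D2 : R) : c ^+ 2 + e ^+ 2 = 1 ->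
  standardized muX -> standardized muY ->
  stein_discrepancy_le muX D1 -> stein_discrepancy_le muY D2 ->
  stein_discrepancy_le muZ (`|e| ^+ 3 * D1 + `|c| ^+ 3 * D2).
Proof.
move=> ce [_ iX2 _ _] [_ iY2 _ _] sX sY f f' B L L0 df fB fL.
have mf : measurable_fun setT f.
  by apply: continuous_measurable_fun; exact: is_derive_continuous df.
have mf' : measurable_fun setT f'.
  by apply: continuous_measurable_fun; exact: lip_continuous (ltW L0) fL.
have scaled (k : R) (U V : {RV P >-> R}) : independent_RV P U V ->
    (distribution P V).-integrable setT (fun x => (x ^+ 2)%:E) ->
    [/\ measurable_fun setT (fun w => k * V w),
        independent_RV P U (fun w => k * V w) &
        P.-integrable setT (fun w => ((k * V w) ^+ 2)%:E)].
  move=> UV iV; have mk : measurable_fun setT (fun x : R => k * x).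
    exact: measurable_funM.
  split; first exact: measurableT_comp.
    move=> C D mC mD; apply: (UV C ((fun x : R => k * x) @^-1` D)) => //.
    by rewrite -[X in measurable X]setTI; exact: mk.
  under eq_fun do rewrite exprMn; apply: integrable_scale.
  by apply/(integrable_law (mu := distribution P V) (X := V) _ _ (exprn_measurable 2)).
have [m1 i1 s1] := scaled c X Y indep iY2.
have [m2 i2 s2] := scaled e Y X independent_RV_sym iX2.
have h1 := stein_step mX m1 lawX i1 iX2 s1 L0 df fB fL e sX.
have h2 := stein_step mY m2 lawY i2 iY2 s2 L0 df fB fL c sY.
have j1 := integrable_stein_step mX m1 lawX iX2 s1 df fB e.
have j2 := integrable_stein_step mY m2 lawY iY2 s2 df fB c.
rewrite -(Rintegral_law mZ lawZ (h := fun x => x * f x)); last exact: measurable_funM.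
rewrite -(Rintegral_law mZ lawZ mf').
have -> : \int[P]_w (Z w * f (Z w)) = c * (\int[P]_w (Y w * f (c * Y w + e * X w)))
    + e * (\int[P]_w (X w * f (e * X w + c * Y w))).
  rewrite -!RintegralZl// -RintegralD//; try exact: integrable_scale.
  apply: eq_Rintegral => w _; rewrite ZE mulrDl !mulrA; congr (_ * _ + _ * f _).
  exact: addrC.
have E1 : \int[P]_w f' (e * X w + c * Y w) = \int[P]_w f' (Z w).
  by apply: eq_Rintegral => w _; rewrite ZE addrC.
have E2 : \int[P]_w f' (c * Y w + e * X w) = \int[P]_w f' (Z w).
  by apply: eq_Rintegral => w _; rewrite ZE.
rewrite E1 in h1; rewrite E2 in h2.
move: h1 h2; set A1 := _ * (\int[P]_w (X w * _)); set A2 := _ * (\int[P]_w (Y w * _)).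
set I := \int[P]_w _ => h1 h2.
have -> : A2 + A1 - I = (A2 - c ^+ 2 * I) + (A1 - e ^+ 2 * I).
  by rewrite -[X in _ - X = _]mul1r -ce; ring.
apply: (le_trans (ler_normD _ _)); apply: (le_trans (lerD h2 h1)).
by rewrite le_eqVlt; apply/orP; left; apply/eqP; ring.
Qed.

End sums.
End standardized.

(** * Mixtures *)
Lemma standardized_expectations (R : realType) (mu : probability R R) :
  standardized mu ->
  (\int[mu]_x x%:E = 0)%E /\ (\int[mu]_x (x ^+ 2)%:E = 1)%E.
Proof.
move=> [i1 i2 e1 e2]; split.
- rewrite -[LHS]fineK; last exact: integrable_fin_num.
  by rewrite -[fine _]/(\int[mu]_x x) e1.
- rewrite -[LHS]fineK; last exact: integrable_fin_num.
  by rewrite -[fine _]/(\int[mu]_x (x ^+ 2)) e2.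
Qed.

Section mixtures.
Context {R : realType}.
Context d (T : measurableType d) (P : probability T R).
Variables (X Y Z : {RV P >-> R}) (e : R) (A : set T).
Hypotheses (e01 : 0 <= e <= 1) (mA : measurable A) (PA : P A = e%:E).
Hypothesis indep : independent_event P A (fun w => (Y w, X w)).
Hypothesis ZE : forall w, Z w = Y w * \1_(~` A) w + X w * \1_A w.
Let muX := distribution P X.
Let muY := distribution P Y.
Let muZ := distribution P Z.

Let e0 : 0 <= e. Proof. by case/andP: e01. Qed.
Let e1 : 0 <= 1 - e. Proof. by rewrite subr_ge0; case/andP: e01. Qed.

Lemma mixture_law B : measurable B ->
  (muZ B = (1 - e)%:E * muY B + e%:E * muX B)%E.
Proof.
move=> mB.
have mXB : measurable (X @^-1` B) by rewrite -[X in measurable X]setTI; exact: measurable_funP.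
have mYB : measurable (Y @^-1` B) by rewrite -[X in measurable X]setTI; exact: measurable_funP.
have PXA : (P (A `&` X @^-1` B) = e%:E * muX B)%E.
  have := indep (measurableX measurableT mB); rewrite PA.
  have -> : (fun w => (Y w, X w)) @^-1` ([set: R] `*` B) = X @^-1` B.
    by apply/seteqP; split=> w //= [].
  by [].
have PYA : (P (A `&` Y @^-1` B) = e%:E * muY B)%E.
  have := indep (measurableX mB measurableT); rewrite PA.
  have -> : (fun w => (Y w, X w)) @^-1` (B `*` [set: R]) = Y @^-1` B.
    by apply/seteqP; split=> w //= [].
  by [].
have ZB : Z @^-1` B = (Y @^-1` B `\` A) `|` (A `&` X @^-1` B).
  apply/seteqP; split=> w /=; rewrite ZE !indicE in_setC.
    case: (boolP (w \in A)) => /= wA.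
      by rewrite mulr0 add0r mulr1 => Bw; right; split => //; exact/set_mem.
    by rewrite mulr0 addr0 mulr1 => Bw; left; split => // Aw; move: wA; rewrite mem_set.
  case=> [[Bw wA]|[wA Bw]].
    by rewrite memNset//= mulr0 addr0 mulr1.
  by rewrite mem_set//= mulr0 add0r mulr1.
have PU : (P (Z @^-1` B) = P (Y @^-1` B `\` A) + P (A `&` X @^-1` B))%E.
  rewrite ZB measureU//; first exact: measurableD.
    exact: measurableI.
  by apply/seteqP; split=> w //= [[_ nA] [wA _]].
have PD : (P (Y @^-1` B `\` A) = P (Y @^-1` B) - P (A `&` Y @^-1` B))%E.
  rewrite setIC measureD//.
  by rewrite (le_lt_trans (probability_le1 P mYB))// ltry.
rewrite -[muZ B]/(P (Z @^-1` B)) PU PXA PD PYA -[P (Y @^-1` B)]/(muY B).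
congr (_ + _)%E.
have muYf : muY B \is a fin_num by exact: fin_num_measure.
by rewrite -(fineK muYf) -!EFinM -EFinB; congr EFin; ring.
Qed.

Let mix := measure_add (mscale (NngNum e1) muY) (mscale (NngNum e0) muX).

Let mixE B : measurable B -> muZ B = mix B.
Proof. by move=> mB; rewrite mixture_law// /mix measure_addE. Qed.

Lemma ge0_mixture_integral (h : R -> \bar R) : measurable_fun setT h ->
  (forall x, 0 <= h x)%E ->
  (\int[muZ]_x h x = (1 - e)%:E * \int[muY]_x h x + e%:E * \int[muX]_x h x)%E.
Proof.
move=> mh h0.
transitivity (\int[mix]_x h x)%E.
  by apply: eq_measure_integral => B mB _; exact: mixE.
by rewrite ge0_integral_measure_add// !ge0_integral_mscale.
Qed.

Lemma mixture_Rintegral (h : R -> R) : measurable_fun setT h ->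
  muX.-integrable setT (fun x => (h x)%:E) ->
  muY.-integrable setT (fun x => (h x)%:E) ->
  muZ.-integrable setT (fun x => (h x)%:E) /\
  \int[muZ]_x h x = (1 - e) * (\int[muY]_x h x) + e * (\int[muX]_x h x).
Proof.
move=> mh iX iY.
have nn (k : R -> R) : measurable_fun setT k -> (forall x, 0 <= k x) ->
    muX.-integrable setT (fun x => (k x)%:E) ->
    muY.-integrable setT (fun x => (k x)%:E) ->
    muZ.-integrable setT (fun x => (k x)%:E) /\
    \int[muZ]_x k x = (1 - e) * (\int[muY]_x k x) + e * (\int[muX]_x k x).
  move=> mk k0 jX jY.
  have k0e x : (0 <= (k x)%:E)%E by rewrite lee_fin.
  have mke : measurable_fun setT (fun x => (k x)%:E) by exact/measurable_EFinP.
  have E : (\int[muZ]_x (k x)%:E =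
      ((1 - e) * (\int[muY]_x k x) + e * (\int[muX]_x k x))%:E)%E.
    have kX : (\int[muX]_x (k x)%:E = (\int[muX]_x k x)%:E)%E.
      by rewrite /Rintegral fineK//; exact: integrable_fin_num.
    have kY : (\int[muY]_x (k x)%:E = (\int[muY]_x k x)%:E)%E.
      by rewrite /Rintegral fineK//; exact: integrable_fin_num.
    by rewrite (ge0_mixture_integral mke k0e) kX kY.
  split; last by rewrite [LHS]/Rintegral E.
  apply/integrableP; split => //.
  rewrite [ltLHS](_ : _ = \int[muZ]_x (k x)%:E)%E; first by rewrite E ltry.
  by apply: eq_integral => x _; rewrite gee0_abs.
have mn : measurable_fun setT (fun x => `|h x|) by exact: measurableT_comp.
have nX := integrable_norm iX; have nY := integrable_norm iY.
have [jn en] := nn _ mn (fun x => normr_ge0 (h x)) nX nY.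
have s0 x : 0 <= `|h x| + h x by have := ler_norm (- h x); rewrite normrN; lra.
have [js es] := nn (fun x => `|h x| + h x) (measurable_funD mn mh) s0
  (integrable_add nX iX) (integrable_add nY iY).
have hE x : h x = (`|h x| + h x) - `|h x| by rewrite addrAC subrr add0r.
split; first by under eq_fun do rewrite hE; exact: integrable_sub.
transitivity (\int[muZ]_x ((`|h x| + h x) - `|h x|)).
  by apply: eq_Rintegral => x _; rewrite -hE.
rewrite RintegralB// es en !RintegralD//; ring.
Qed.

Lemma mixture_standardized :
  standardized muX -> standardized muY -> standardized muZ.
Proof.
move=> [iX1 iX2 X0 X1] [iY1 iY2 Y0 Y1].
have [j1 E1] := mixture_Rintegral (@measurable_id _ R setT) iX1 iY1.
have [j2 E2] := mixture_Rintegral (exprn_measurable 2) iX2 iY2.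
split => //; first by rewrite E1 X0 Y0 !mulr0 addr0.
by rewrite E2 X1 Y1; ring.
Qed.

Lemma mixture_symmetric :
  symmetric_dist muX -> symmetric_dist muY -> symmetric_dist muZ.
Proof.
move=> sX sY B mB.
have mNB : measurable ((fun x : R => - x) @^-1` B).
  by rewrite -[X in measurable X]setTI; exact: oppr_measurable.
apply: (eq_trans (mixture_law mNB)); apply: (eq_trans _ (esym (mixture_law mB))).
by congr (_ * _ + _ * _)%E; [exact: sY|exact: sX].
Qed.

(** Both sides of the Stein identity are affine in the law. *)
Lemma mixture_stein (D1 D2 : R) : standardized muX -> standardized muY ->
  stein_discrepancy_le muX D1 -> stein_discrepancy_le muY D2 ->
  stein_discrepancy_le muZ ((1 - e) * D2 + e * D1).
Proof.
move=> stX stY sX sY f f' B L L0 df fB fL.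
have mf : measurable_fun setT f.
  by apply: continuous_measurable_fun; exact: is_derive_continuous df.
have mf' : measurable_fun setT f'.
  by apply: continuous_measurable_fun; exact: lip_continuous (ltW L0) fL.
have if' (p : probability R R) : p.-integrable setT (fun x => (f' x)%:E).
  exact: integrable_bounded fB.
have B0 : 0 <= B by exact: le_trans (fB 0).
have ixf (p : probability R R) : standardized p ->
    p.-integrable setT (fun x => (x * f x)%:E).
  move=> sp; have [m0 _] := standardized_expectations sp; have [i1 i2 _ _] := sp.
  have [//|//] := @integral_mul_lipschitz R p i1 i2 m0 f (NngNum B0).
  exact: bounded_derive_lipschitz df fB.
have [_ E1] := mixture_Rintegral mf' (if' _) (if' _).
have [_ E2] := mixture_Rintegral (measurable_funM (@measurable_id _ R setT) mf)
  (ixf _ stX) (ixf _ stY).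
rewrite E1 E2; have h1 := sX _ _ _ _ L0 df fB fL; have h2 := sY _ _ _ _ L0 df fB fL.
set a1 := \int[muY]_x (x * f x) in h2 *; set a2 := \int[muY]_x f' x in h2 *.
set b1 := \int[muX]_x (x * f x) in h1 *; set b2 := \int[muX]_x f' x in h1 *.
have -> : (1 - e) * a1 + e * b1 - ((1 - e) * a2 + e * b2) =
   (1 - e) * (a1 - a2) + e * (b1 - b2) by ring.
apply: (le_trans (ler_normD _ _)); rewrite !normrM (ger0_norm e0) (ger0_norm e1).
apply: (le_trans (lerD (ler_wpM2l e1 h2) (ler_wpM2l e0 h1))).
by rewrite le_eqVlt; apply/orP; left; apply/eqP; ring.
Qed.

End mixtures.

(** * The Stein equation of the absolute value *)
Section stein_solution.
Context {R : realType}.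
Notation leb := (@lebesgue_measure R).
Notation phi := (@gauss_phi R).

Lemma gauss_phi_gt0 x : 0 < phi x.
Proof. by rewrite mulr_gt0 ?expR_gt0// normal_peak_gt0. Qed.

Lemma is_derive_le0_nonincreasing (f f' : R -> R) (a : R) :
  (forall x : R, is_derive x (1 : R) f (f' x)) ->
  (forall x, a <= x -> f' x <= 0) ->
  forall x y, a <= x -> x <= y -> f y <= f x.
Proof.
move=> df f0 x y ax; rewrite le_eqVlt => /predU1P[->//|xy].
have cf : {within `[x, y], continuous f}.
  by apply: continuous_subspaceT; exact: is_derive_continuous df.
have [c /[!in_itv]/=/andP[xc _] fxy] := MVT xy (fun z _ => df z) cf.
by rewrite -subr_le0 fxy mulr_le0_ge0 ?subr_ge0 ?(ltW xy)// f0// (le_trans ax)// ltW.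
Qed.

Definition gauss_tail (x : R) : R := 1 - \int[leb]_(t in `]-oo, x]) phi t.

Lemma is_derive_gauss_tail (x : R) : is_derive x (1 : R) gauss_tail (- phi x).
Proof.
have iphi (B : set R) : measurable B -> leb.-integrable B (EFin \o phi).
  by move=> mB; apply: integrableS integrable_gauss_phi.
have [dG G'] : derivable (fun x : R => \int[leb]_(t in `]-oo, x]) phi t) x 1 /\
    derive1 (fun x : R => \int[leb]_(t in `]-oo, x]) phi t) x = phi x.
  apply: (@continuous_FTC1 R phi (BInfty _ true) x (x + 1)) => //.
  - by rewrite ltrDl.
  - exact: iphi.
  - exact: ltNyr.
  - exact: continuous_gauss_phi.
have d1 : is_derive x (1 : R) (fun x : R => \int[leb]_(t in `]-oo, x]) phi t) (phi x).
  by apply: DeriveDef => //; rewrite -derive1E.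
move: d1; rewrite /gauss_tail; set G := (fun y => \int[leb]_(t in _) _) => d1.
by have -> : - phi x = 0 - phi x by [rewrite sub0r]; exact: is_deriveB.
Qed.

Lemma gauss_tailE x : (\int[leb]_(t in `]x, +oo[) (phi t)%:E = (gauss_tail x)%:E)%E.
Proof.
have iphi (B : set R) : measurable B -> leb.-integrable B (EFin \o phi).
  by move=> mB; apply: integrableS integrable_gauss_phi.
have phi0 (B : set R) : forall t, B t -> (0 <= (phi t)%:E)%E.
  by move=> t _; rewrite lee_fin gauss_phi_ge0.
have mphi (B : set R) : measurable_fun B (EFin \o phi).
  by apply/measurable_EFinP/measurable_funTS; exact: measurable_gauss_phi.
have tot : (\int[leb]_t (phi t)%:E = 1)%E.
  rewrite -(@integral_normal_pdf R 0 1).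
  by apply: eq_integral => t _; rewrite normal_pdf01.
have sp : (\int[leb]_(t in `]-oo, x]) (phi t)%:E + \int[leb]_(t in `]x, +oo[) (phi t)%:E
    = 1)%E.
  rewrite -tot -[in RHS](@setUv _ `]-oo, x]) setCitvl ge0_integral_setU//.
  - exact: mphi.
  - exact: phi0.
  - rewrite -setCitvl disj_set2E setICr; exact: eqxx.
have fin1 : (\int[leb]_(t in `]-oo, x]) (phi t)%:E \is a fin_num)%E.
  exact: integrable_fin_num (iphi _ _).
rewrite /gauss_tail EFinB /Rintegral fineK// -sp.
by rewrite addeAC subee// add0e.
Qed.

Lemma gauss_tail_ge0 x : 0 <= gauss_tail x.
Proof.
rewrite -lee_fin -gauss_tailE; apply: integral_ge0 => t _.
by rewrite lee_fin gauss_phi_ge0.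
Qed.

Lemma gauss_phi_le x : phi x <= normal_peak 1.
Proof.
rewrite /gauss_phi ler_piMr ?normal_peak_ge0// -expR0 ler_expR.
by rewrite oppr_le0 divr_ge0 ?sqr_ge0.
Qed.

(** On [t > x] replace [x] by [t] under the integral; [t phi t] has primitive
    [- phi]. *)
Lemma gauss_tail_mills_upper x : 0 < x -> x * gauss_tail x <= phi x.
Proof.
move=> x0; rewrite -lee_fin EFinM -gauss_tailE.
have m1 : measurable_fun setT (fun t : R => (t * phi t)%:E).
  by apply/measurable_EFinP/measurable_funM => //; exact: measurable_gauss_phi.
have dF (t : R) : is_derive t (1 : R) (fun t => - phi t) (t * phi t).
  have dg := is_derive_gauss_phi t.
  by apply: is_derive_eq; rewrite mulNr opprK.
have cF := is_derive_continuous dF.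
have E : (\int[leb]_(t in `[x, +oo[) (t * phi t)%:E = (phi x)%:E)%E.
  rewrite (@ge0_continuous_FTC2y _ (fun t => t * phi t) (fun t => - phi t) x 0)//.
  - by rewrite sub0e -EFinN opprK.
  - move=> t xt; rewrite mulr_ge0 ?gauss_phi_ge0//.
    by rewrite (le_trans (ltW x0)).
  - apply: continuous_subspaceT => t.
    by apply: cvgM; [exact: cvg_id|exact: continuous_gauss_phi].
  - apply: (@cvg0_inverse_bound _ (fun t => - phi t) (16 * normal_peak 1)) => t t1.
    have t0 : 0 < t by exact: lt_le_trans t1.
    rewrite ler_pdivlMr// normrN ger0_norm ?gauss_phi_ge0//.
    apply: le_trans (gauss_phi_tail t); rewrite mulrC ler_wpM2r ?gauss_phi_ge0//.
    by rewrite -[leLHS]expr1 ler_weXn2l.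
  - by apply: cvg_at_right_filter; exact: cF.
  - by move=> t _; rewrite derive1E derive_val.
rewrite -E -ge0_integralZl_EFin//; last 3 first.
  - by move=> t _; rewrite lee_fin gauss_phi_ge0.
  - by apply/measurable_EFinP/measurable_funTS; exact: measurable_gauss_phi.
  - exact: ltW.
apply: (@le_trans _ _ (\int[leb]_(t in `]x, +oo[) (t * phi t)%:E)%E).
  apply: ge0_le_integral => //.
  - by move=> t _; rewrite -EFinM lee_fin mulr_ge0 ?gauss_phi_ge0 ?ltW.
  - apply/measurable_EFinP/measurable_funTS/measurable_funM => //.
    exact: measurable_gauss_phi.
  - exact: measurable_funTS.
  - move=> t /=; rewrite in_itv/= andbT => xt.
    by rewrite -EFinM lee_fin ler_wpM2r ?gauss_phi_ge0 ?ltW.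
apply: ge0_subset_integral => //.
- exact: measurable_funTS.
- move=> t /=; rewrite in_itv/= andbT => xt.
  by rewrite lee_fin mulr_ge0 ?gauss_phi_ge0 ?(le_trans (ltW x0)).
- by move=> t /=; rewrite !in_itv/= !andbT; exact: ltW.
Qed.

(** The difference of the two sides is nonincreasing and its negative part is
    [O(1/y)] at infinity, so it is nonnegative. *)
Lemma gauss_tail_mills_lower x : 0 <= x -> x / (1 + x ^+ 2) * phi x <= gauss_tail x.
Proof.
move=> x0; pose D x := gauss_tail x - x / (1 + x ^+ 2) * phi x.
have p1 (z : R) : 0 < 1 + z ^+ 2 by rewrite ltr_wpDr ?sqr_ge0.
have dD (z : R) : is_derive z (1 : R) D (- (2 * phi z / (1 + z ^+ 2) ^+ 2)).
  have d1 := is_derive_gauss_tail z; have d2 := is_derive_gauss_phi z.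
  have p0 : 1 + z ^+ 2 != 0 by rewrite gt_eqF.
  apply: is_derive_eq; rewrite /GRing.scale/=.
  by field.
have D_dec := is_derive_le0_nonincreasing (a := x) dD.
have D_low y : 0 < y -> - normal_peak 1 <= D y * y.
  move=> y0; rewrite /D mulrBl.
  have h1 : 0 <= gauss_tail y * y by rewrite mulr_ge0 ?gauss_tail_ge0 ?ltW.
  have h2 : y / (1 + y ^+ 2) * phi y * y <= normal_peak 1.
    have -> : y / (1 + y ^+ 2) * phi y * y = y ^+ 2 / (1 + y ^+ 2) * phi y by ring.
    rewrite -[leRHS]mul1r ler_pM ?gauss_phi_le ?gauss_phi_ge0//.
      by rewrite divr_ge0 ?sqr_ge0 ?ltW.
    by rewrite ler_pdivrMr// mul1r lerDr.
  by lra.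
rewrite -subr_ge0 -/(D x) leNgt; apply/negP => Dx0.
pose C : R := normal_peak 1; have C0 : 0 <= C by exact: normal_peak_ge0.
(* A point so far out that D y <= D x < 0 contradicts D y >= - C / y. *)
pose y := x + 1 + C / (- D x).
have q0 : 0 <= C / (- D x) by rewrite divr_ge0// oppr_ge0 ltW.
have xy : x <= y by rewrite /y; lra.
have y0 : 0 < y by rewrite /y; lra.
have Dxy : D y <= D x.
  apply: D_dec => // z _; rewrite oppr_le0 divr_ge0 ?sqr_ge0//.
  by rewrite mulr_ge0 ?gauss_phi_ge0.
have := D_low y y0; have : D y * y <= D x * y by rewrite ler_pM2r.
have -> : D x * y = D x * (x + 1) - C.
  by rewrite /y; move: (D x) Dx0 => e e0; have en0 : e != 0 by [rewrite lt_eqF]; field.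
rewrite -/C; have : D x * (x + 1) < 0 by rewrite nmulr_rlt0 ?ltr_wpDl.
by lra.
Qed.

Definition mills (x : R) : R := gauss_tail x / phi x.

Lemma is_derive_mills (x : R) : is_derive x (1 : R) mills (x * mills x - 1).
Proof.
have d1 := is_derive_gauss_tail x; have d2 := is_derive_gauss_phi x.
have p0 : phi x != 0 by rewrite gt_eqF ?gauss_phi_gt0.
by apply: is_derive_eq; rewrite /mills /GRing.scale/=; field.
Qed.

Lemma mills_ge0 x : 0 <= mills x.
Proof. by rewrite divr_ge0 ?gauss_tail_ge0 ?gauss_phi_ge0. Qed.

Lemma mills_bounds x : 0 <= x -> x * mills x <= 1 /\ x <= (1 + x ^+ 2) * mills x.
Proof.
move=> x0; have p1 : 0 < 1 + x ^+ 2 by rewrite ltr_wpDr ?sqr_ge0.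
split.
  rewrite mulrA ler_pdivrMr ?gauss_phi_gt0// mul1r.
  move: x0; rewrite le_eqVlt => /predU1P[<-|]; first by rewrite mul0r gauss_phi_ge0.
  exact: gauss_tail_mills_upper.
rewrite mulrA ler_pdivlMr ?gauss_phi_gt0// mulrC.
rewrite -ler_pdivrMl// mulrCA.
by have := gauss_tail_mills_lower x0; rewrite [X in X <= _](_ : _ = phi x * ((1 + x ^+ 2)^-1 * x)); [by []|ring].
Qed.

Lemma mills_le0 x : 0 <= x -> mills x <= mills 0.
Proof.
move=> x0; apply: (is_derive_le0_nonincreasing is_derive_mills) x0 => //.
by move=> z z0; rewrite subr_le0; have [] := mills_bounds z0.
Qed.

Lemma mills0_gt0 : 0 < mills 0.
Proof.
have [_ h] := mills_bounds (ler01 : 0 <= 1 :> R).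
by have := mills_le0 (ler01 : 0 <= 1 :> R); move: h; rewrite expr1n; lra.
Qed.

(** On [x >= 0] the solution is [M / M(0) - 1], where Mills' ratio [M] satisfies
    [M' = x M - 1] and hence [M' - x M = - 1]; the value at [0] is chosen so that
    the odd extension is continuous. The derivative of [M'] is
    [M'' = (1 + x^2) M - x = M + x M'], nonnegative by the lower Mills bound and
    at most [M <= M(0)] because [M' <= 0] by the upper one; so [M' / M(0)] is
    1-Lipschitz. *)
Lemma stein_abs_half_line : exists (K : R) (A A1 : R -> R),
  [/\ 0 < K, A 0 = 0, forall x : R, is_derive x (1 : R) A (A1 x),
    (forall x, 0 <= x -> A1 x - x * A x = x - K) /\ (forall x, 0 <= x -> `|A1 x| <= K) &
    forall x y, 0 <= x -> 0 <= y -> `|A1 x - A1 y| <= `|x - y| ].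
Proof.
(* The constant c of the Stein equation is K^-1. *)
pose K : R := mills 0; have K0 : 0 < K := mills0_gt0.
have Kn0 : K != 0 by rewrite gt_eqF.
pose A (x : R) : R := K^-1 * mills x - 1.
pose A1 x : R := K^-1 * (x * mills x - 1).
have dA (x : R) : is_derive x (1 : R) A (A1 x).
  have d1 := is_derive_mills x.
  by apply: is_derive_eq; rewrite /GRing.scale/=; rewrite /A1; ring.
pose A2 x : R := K^-1 * ((1 + x ^+ 2) * mills x - x).
have dA1 (x : R) : is_derive x (1 : R) A1 (A2 x).
  have d1 := is_derive_mills x.
  by apply: is_derive_eq; rewrite /GRing.scale/=; rewrite /A2; ring.
have A2_ge0 x : 0 <= x -> 0 <= A2 x.
  move=> x0; rewrite mulr_ge0 ?invr_ge0 ?(ltW K0)// subr_ge0.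
  by have [] := mills_bounds x0.
have A2_le1 x : 0 <= x -> A2 x <= 1.
  move=> x0; rewrite ler_pdivrMl// mulr1.
  have [h1 _] := mills_bounds x0; have := mills_le0 x0; rewrite -/K => h2.
  have : x * (x * mills x) <= x * 1 by rewrite ler_wpM2l.
  by rewrite mulrDl mul1r expr2 -mulrA; lra.
exists K^-1, A, A1; split => //.
- by rewrite invr_gt0.
- by rewrite /A mulVf ?subrr.
- split=> x x0; first by rewrite /A /A1; ring.
  rewrite normrM gtr0_norm ?invr_gt0// ler_piMr ?invr_ge0 ?(ltW K0)//.
  have [h1 _] := mills_bounds x0.
  have : 0 <= x * mills x by rewrite mulr_ge0 ?mills_ge0.
  by rewrite ler_norml; lra.
- have key x y : 0 <= x -> x <= y -> 0 <= A1 y - A1 x <= y - x.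
    move=> x0 xy.
    have d1 (z : R) : is_derive z (1 : R) (fun z => - A1 z) (- A2 z).
      by have d := dA1 z; apply: is_derive_eq.
    have d2 (z : R) : is_derive z (1 : R) (fun z => A1 z - z) (A2 z - 1).
      by have d := dA1 z; apply: is_derive_eq.
    have h1 : A1 y - y <= A1 x - x.
      apply: (is_derive_le0_nonincreasing (a := 0) d2) => // z z0.
      by rewrite subr_le0 A2_le1.
    have h2 : - A1 y <= - A1 x.
      apply: (is_derive_le0_nonincreasing (a := 0) d1) => // z z0.
      by rewrite oppr_le0 A2_ge0.
    by lra.
  move=> x y x0 y0; wlog xy : x y x0 y0 / x <= y.
    by move=> H; have [/H->//|/ltW/H] := leP x y; rewrite distrC (distrC y); exact.
  by have /andP[h1 h2] := key _ _ x0 xy; rewrite distrC (distrC x) (ger0_norm h1) ger0_norm ?subr_ge0.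
Qed.

(** At [0] the difference quotient of the extension at [h] is that of [A] at
    [|h|]. *)
Lemma is_derive_odd_extension (A A1 : R -> R) : A 0 = 0 ->
  (forall x : R, is_derive x (1 : R) A (A1 x)) ->
  forall x : R, is_derive x (1 : R) (fun x => if 0 <= x then A x else - A (- x)) (A1 `|x|).
Proof.
move=> A0 dA x; set F := fun x => _.
have [x0|x0|<-] := ltgtP 0 x.
- rewrite gtr0_norm//; apply: (near_eq_is_derive _ (dA x)).
  near=> y; rewrite /F ifT//.
  by near: y; exact: lt_le_nbhsr.
- rewrite ltr0_norm//; apply: (@near_eq_is_derive _ _ _ (fun y => - A (- y))).
    near=> y; rewrite /F ifF//; apply/negbTE; rewrite -ltNge.
    by near: y; exact: lt_nbhsl.
  have d1 := dA (- x).
  have d2 : is_derive x (1 : R) (fun y => A (- y)) (- A1 (- x)).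
    have d3 : is_derive x (1 : R) (fun y : R => - y) (- 1) by exact: is_derive_eq.
    by have := is_derive1_comp d1 d3; rewrite mulrN1.
  by apply: is_derive_eq; rewrite opprK.
- rewrite normr0.
  have [dA0 <-] := dA 0.
  have Q : (fun k : R => k^-1 *: (A (k *: 1 + 0) - A 0)) @ 0^' --> 'D_1 A 0 by exact: dA0.
  have N : (fun h : R => `|h|) @ 0^' --> 0^'.
    move=> U [e /= e0 eU]; exists e => //= h /=.
    rewrite sub0r normrN => he h0; apply: eU => /=; last by rewrite normr_eq0.
    by rewrite sub0r normrN normr_id.
  have QF : (fun h : R => h^-1 *: (F (h *: 1 + 0) - F 0)) @ 0^' --> 'D_1 A 0.
    apply: cvg_trans (cvg_comp _ _ N Q); apply: near_eq_cvg.
    near=> h; rewrite /= /F lexx A0 !subr0 !addr0 /GRing.scale/= !mulr1.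
    have [h0|h0] := leP 0 h; first by rewrite ger0_norm.
    by rewrite ltr0_norm// invrN mulNr mulrN.
  by apply: DeriveDef; [apply/cvg_ex; exists ('D_1 A 0)|exact: cvg_lim].
Unshelve. all: by end_near. Qed.

Lemma stein_abs : exists (c : R) (F F' : R -> R),
  [/\ forall x : R, is_derive x (1 : R) F (F' x),
    forall x, F' x - x * F x = `|x| - c,
    forall x, `|F' x| <= c &
    forall x y, `|F' x - F' y| <= `|x - y| ].
Proof.
have [K [A [A1 [K0 A0 dA [ode bd] lp]]]] := stein_abs_half_line.
exists K, (fun x => if 0 <= x then A x else - A (- x)), (fun x => A1 `|x|).
split.
- exact: is_derive_odd_extension.
- move=> x; case: ifPn => x0; first by rewrite ger0_norm// ode.
  move: x0; rewrite -ltNge => x0; rewrite ltr0_norm//.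
  by rewrite -ode ?oppr_ge0 ?ltW// mulNr mulrN.
- by move=> x; exact: bd.
- move=> x y; apply: le_trans (lp _ _ _ _) _ => //.
  exact: ler_dist_dist.
Qed.

End stein_solution.

(** * Linear combinations of independent components *)
Section linear_combinations.
Context d (T : measurableType d) (R : realType) (P : probability T R).
Variables (n : nat) (G : 'I_n -> {RV P >-> R}).
Hypothesis indepG : mutually_independent G.

(** Dynkin's theorem: for fixed [B], the measures [E |-> P (G_j in B, E)] and
    [E |-> P (G_j in B) P E] agree on the rectangles in the components other
    than [j], a pi-system that makes the sum measurable since [z j = 0]. *)
Lemma independent_linear_combination (j : 'I_n) (z : 'I_n -> R) : z j = 0 ->
  independent_RV P (G j) (fun w => \sum_(i < n) z i * G i w).
Proof.
move=> zj B C mB mC.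
have mG i D : measurable D -> measurable (G i @^-1` D).
  by move=> mD; rewrite -[X in measurable X]setTI; exact: measurable_funP.
pose rect (D : 'I_n -> set R) := \bigcap_(i in [set` [set~ j]%SET]) (G i @^-1` D i).
pose Pi : set (set T) := [set E | exists2 D, (forall i, measurable (D i)) & E = rect D].
have Pim : Pi `<=` measurable.
  move=> _ [D mD ->]; apply: fin_bigcap_measurable; first exact: finite_finset.
  by move=> i _; exact: mG.
have PiI : setI_closed Pi.
  move=> _ _ [D mD ->] [D' mD' ->]; exists (fun i => D i `&` D' i).
    by move=> i; exact: measurableI.
  by rewrite /rect -bigcapI; apply: eq_bigcapr => i _; rewrite preimage_setI.
have PiT : Pi setT.
  by exists (fun=> setT) => //; rewrite /rect; apply/seteqP; split.
have mB' := mG j B mB.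
pose m1 := mrestr P mB'.
pose r := fine (P (G j @^-1` B)).
have r0 : 0 <= r by exact: fine_ge0.
pose m2 := mscale (NngNum r0) P.
have rE : (r%:E = P (G j @^-1` B))%E by rewrite fineK// fin_num_measure.
have m12 E : Pi E -> m1 E = m2 E.
  move=> [D mD ->]; rewrite /m1 /m2 /mrestr /mscale /= rE.
  pose D' i := if i == j then B else D i.
  have mD' i : measurable (D' i) by rewrite /D'; case: ifP.
  have -> : rect D `&` G j @^-1` B = \bigcap_(i in [set` [set: 'I_n]%SET]) (G i @^-1` D' i).
    apply/seteqP; split => w.
      move=> [wD wB] i _ /=; rewrite /D'; case: eqP => [->//|/eqP ij].
      by apply: wD; rewrite /= !inE.
    move=> wD; split; last by have := wD j; rewrite /= /D' eqxx; apply; rewrite inE.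
    move=> i /=; rewrite !inE => ij; have := wD i; rewrite /= /D' (negbTE ij).
    by apply; rewrite inE.
  have -> := indepG [set: 'I_n]%SET mD'.
  have -> : P (rect D) = _ := indepG [set~ j]%SET mD.
  rewrite (bigD1 j) ?inE//= {1}/D' eqxx; congr (_ * _)%E.
  apply: eq_big => [i|i /andP[_ ij]]; first by rewrite !inE.
  by rewrite /D' (negbTE ij).
have mZ : <<s Pi >> ((fun w => \sum_(i < n) z i * G i w) @^-1` C).
  have mZ : measurable_fun setT
      ((fun w => \sum_(i < n) z i * G i w) : g_sigma_algebraType Pi -> R).
    apply: measurable_sum => i; have [->|ij] := eqVneq i j.
      by under eq_fun do rewrite zj mul0r; exact: measurable_cst.
    apply: measurable_funM => // _ D mD; rewrite setTI.
    apply: sub_sigma_algebra; exists (fun k => if k == i then D else setT).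
      by move=> k; case: ifP.
    apply/seteqP; split => w /=; first by move=> wD k _ /=; case: eqP => [->|].
    by move=> /(_ i) /=; rewrite !inE eqxx; apply.
  by have := mZ measurableT _ mC; rewrite setTI.
have cover : \bigcup_(k : nat) [set: T] = [set: T].
  by apply/seteqP; split => // w _; exists 0%N.
have m1oo (k : nat) : (m1 setT < +oo)%E by rewrite /m1 /mrestr setTI -rE ltry.
have := g_sigma_algebra_measure_unique Pi Pim (fun=> setT) (fun=> PiT) cover
  m1 m2 PiI m12 m1oo _ mZ.
by move=> h; rewrite -rE setIC; exact: h.
Qed.

Lemma independent_pair (j k : 'I_n) : j != k -> independent_RV P (G j) (G k).
Proof.
move=> jk; have z0 : (fun i : 'I_n => (i == k)%:R : R) j = 0 by rewrite (negbTE jk).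
have := @independent_linear_combination j (fun i => (i == k)%:R) z0.
suff -> : (fun w => \sum_(i < n) (i == k)%:R * G i w) = G k by [].
apply/funext => w; rewrite (bigD1 k)//= eqxx mul1r big1 ?addr0// => i ik.
by rewrite (negbTE ik) mul0r.
Qed.

End linear_combinations.

Section uncorrelated.
Context d (T : measurableType d) (R : realType) (P : probability T R).

Lemma independent_RV_comp (X Y : T -> R) (u v : R -> R) :
  measurable_fun setT u -> measurable_fun setT v ->
  independent_RV P X Y -> independent_RV P (u \o X) (v \o Y).
Proof.
move=> mu mv indep B C mB mC; apply: (indep (u @^-1` B) (v @^-1` C)).
  by rewrite -[X in measurable X]setTI; exact: mu.
by rewrite -[X in measurable X]setTI; exact: mv.
Qed.

Lemma independent_Rintegral_mul (X Y : T -> R) :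
  independent_RV P X Y -> P.-integrable setT (fun w => (X w)%:E) ->
  P.-integrable setT (fun w => (Y w)%:E) ->
  P.-integrable setT (fun w => (X w * Y w)%:E) ->
  \int[P]_w (X w * Y w) = (\int[P]_w X w) * (\int[P]_w Y w).
Proof.
move=> indep iX iY iXY.
have mX : measurable_fun setT X by apply/measurable_EFinP; exact: measurable_int iX.
have mY : measurable_fun setT Y by apply/measurable_EFinP; exact: measurable_int iY.
pose XRV : {RV P >-> R} := HB.pack X (isMeasurableFun.Build _ _ _ _ X mX).
pose YRV : {RV P >-> R} := HB.pack Y (isMeasurableFun.Build _ _ _ _ Y mY).
have lX : has_law P X (distribution P XRV) by [].
have lY : has_law P Y (distribution P YRV) by [].
rewrite (independent_expectation_mul mX mY lX lY)//.
- by rewrite (Rintegral_law mX lX (h := id))// (Rintegral_law mY lY (h := id)).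
- by apply/(integrable_law mX lX (h := id)).
- by apply/(integrable_law mY lY (h := id)).
Qed.

Lemma integrable_mul_sqr (X Y : T -> R) :
  measurable_fun setT X -> measurable_fun setT Y ->
  P.-integrable setT (fun w => (X w ^+ 2)%:E) ->
  P.-integrable setT (fun w => (Y w ^+ 2)%:E) ->
  P.-integrable setT (fun w => (X w * Y w)%:E).
Proof.
move=> mX mY iX iY.
apply: (@integrable_le _ _ _ P (fun w => X w * Y w) (fun w => X w ^+ 2 + Y w ^+ 2)).
- exact: measurable_funM.
- exact: integrable_add.
- move=> w; rewrite ler_norml; have := sqr_ge0 (X w - Y w).
  have := sqr_ge0 (X w + Y w); have := sqr_ge0 (X w); have := sqr_ge0 (Y w).
  by rewrite sqrrD sqrrB; move=> *; apply/andP; split; lra.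
Qed.

Lemma integrable_of_sqr (X : T -> R) : measurable_fun setT X ->
  P.-integrable setT (fun w => (X w ^+ 2)%:E) -> P.-integrable setT (fun w => (X w)%:E).
Proof.
move=> mX iX; apply: (@integrable_le _ _ _ P X (fun w => 1 + X w ^+ 2)) => //.
- by apply: integrable_add => //; exact: finite_measure_integrable_cst.
- move=> w; rewrite ler_norml; have := sqr_ge0 (X w - 1); have := sqr_ge0 (X w + 1).
  by rewrite sqrrD sqrrB; move=> *; apply/andP; split; lra.
Qed.

Lemma uncorrelated_sum_sqr n (X : 'I_n -> T -> R) :
  (forall j, measurable_fun setT (X j)) ->
  (forall j, P.-integrable setT (fun w => (X j w ^+ 2)%:E)) ->
  (forall j, \int[P]_w X j w = 0) ->
  (forall j k, j != k -> independent_RV P (X j) (X k)) ->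
  P.-integrable setT (fun w => ((\sum_(j < n) X j w) ^+ 2)%:E) /\
  \int[P]_w (\sum_(j < n) X j w) ^+ 2 = \sum_(j < n) \int[P]_w X j w ^+ 2.
Proof.
move=> mX iX2 X0 indep.
have iX j : P.-integrable setT (fun w => (X j w)%:E) by exact: integrable_of_sqr.
have iXX j k : P.-integrable setT (fun w => (X j w * X k w)%:E).
  exact: integrable_mul_sqr.
have E w : (\sum_(j < n) X j w) ^+ 2 = \sum_(j < n) \sum_(k < n) X j w * X k w.
  by rewrite expr2 mulr_suml; apply: eq_bigr => j _; rewrite mulr_sumr.
split.
  by under eq_fun do rewrite E; do 2 apply: integrable_sumr => ?.
under eq_Rintegral do rewrite E.
rewrite Rintegral_sum => [|j]; last exact: integrable_sumr.
apply: eq_bigr => j _; rewrite Rintegral_sum//.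
rewrite (bigD1 j)//= big1 ?addr0 => [|k kj].
  by apply: eq_Rintegral => w _; rewrite expr2.
by rewrite independent_Rintegral_mul ?X0 ?mul0r//; apply: indep; rewrite eq_sym.
Qed.

(** [|X| <= X^2 / (2 s) + s / 2], instead of Cauchy-Schwarz. *)
Lemma expectation_norm_le (X : T -> R) (s : R) : 0 < s -> measurable_fun setT X ->
  P.-integrable setT (fun w => (X w ^+ 2)%:E) ->
  \int[P]_w X w ^+ 2 <= s ^+ 2 -> \int[P]_w `|X w| <= s.
Proof.
move=> s0 mX iX2 Xs.
have i1 : P.-integrable setT (fun w => ((2 * s)^-1 * X w ^+ 2)%:E) by exact: integrable_scale.
have i2 : P.-integrable setT (fun=> (s / 2)%:E) by exact: finite_measure_integrable_cst.
apply: (@le_trans _ _ (\int[P]_w ((2 * s)^-1 * X w ^+ 2 + s / 2))).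
  apply: le_Rintegral => //.
  - by apply: integrable_norm; exact: integrable_of_sqr.
  - exact: integrable_add.
  - move=> w _; have s2 : 0 < 2 * s by rewrite mulr_gt0.
    rewrite -(ler_pM2l s2) mulrDr mulrA mulfV ?gt_eqF// mul1r.
    have -> : X w ^+ 2 = `|X w| ^+ 2 by rewrite real_normK ?num_real.
    by have := sqr_ge0 (`|X w| - s); rewrite sqrrB; lra.
have cst : \int[P]_w (s / 2) = s / 2.
  by rewrite Rintegral_cst// [X in fine X]probability_setT mulr1.
rewrite RintegralD// cst RintegralZl//.
have : (2 * s)^-1 * \int[P]_w X w ^+ 2 <= (2 * s)^-1 * s ^+ 2.
  by rewrite ler_wpM2l// invr_ge0 mulr_ge0// ltW.
have -> : (2 * s)^-1 * s ^+ 2 = s / 2 by field; rewrite gt_eqF.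
by lra.
Qed.

End uncorrelated.

(** * Concentration of a linear combination *)
Section clamp.
Context {R : realType}.

Definition clamp (b x : R) : R := Num.max (- b) (Num.min x b).

Lemma measurable_clamp b : measurable_fun setT (clamp b).
Proof. by apply: measurable_maxr => //; exact: measurable_minr. Qed.

Lemma clampP b x : 0 <= b ->
  [\/ x <= - b /\ clamp b x = - b, - b <= x <= b /\ clamp b x = x
    | b <= x /\ clamp b x = b].
Proof.
move=> b0; rewrite /clamp; have [h1|h1] := leP x b; last first.
  by apply: Or33; rewrite ltW// max_r//; lra.
have [h2|h2] := leP (- b) x; first by apply: Or32.
by apply: Or31; rewrite ltW.
Qed.

Lemma clamp_norm b x : 0 <= b -> `|clamp b x| <= b.
Proof.
by move=> b0; rewrite ler_norml; case: (clampP x b0) => -[h ->]; lra.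
Qed.

Lemma clamp_increment_ge0 b u x : 0 <= b -> 0 <= x * (clamp b u - clamp b (u - x)).
Proof.
move=> b0; suff mono y z : y <= z -> clamp b y <= clamp b z.
  have [x0|x0] := leP 0 x.
    by rewrite mulr_ge0// subr_ge0 mono//; lra.
  by rewrite mulr_le0// ?(ltW x0)// subr_le0 mono//; lra.
move=> yz; case: (clampP y b0) => -[h ->]; case: (clampP z b0) => -[h' ->]; lra.
Qed.

(** If [|u| <= t] then [u] is in the linear range of the clamp, and moving from
    [u] to [u - x] passes through a stretch of length at least [min |x| e]
    before saturation. *)
Lemma clamp_increment_ge t e u x : 0 <= e -> `|u| <= t ->
  `|x| * Num.min `|x| e <= x * (clamp (t + e) u - clamp (t + e) (u - x)).
Proof.
move=> e0 ut; have t0 : 0 <= t by exact: le_trans ut.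
move: ut; rewrite ler_norml => /andP[u1 u2].
have b0 : 0 <= t + e by exact: addr_ge0.
have -> : clamp (t + e) u = u by case: (clampP u b0) => -[h ->]; lra.
have [x0|x0] := leP 0 x.
  rewrite ger0_norm// ler_wpM2l//; case: (clampP (u - x) b0) => -[h ->]; case: (leP x e) => h1; lra.
have -> : x * (u - clamp (t + e) (u - x)) = - x * (clamp (t + e) (u - x) - u) by ring.
have nx0 : 0 <= - x by lra.
rewrite ltr0_norm// ler_wpM2l//.
by case: (clampP (u - x) b0) => -[h ->]; case: (leP (- x) e) => h1; lra.
Qed.

(** For [|x| > e] this is [(2 e - |x|)^2 >= 0]. *)
Lemma mul_min_ge (x e : R) : 0 < e -> `|x| ^+ 2 - (4 * e)^-1 * `|x| ^+ 3 <= `|x| * Num.min `|x| e.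
Proof.
move=> e0; have e4 : 0 < 4 * e by rewrite mulr_gt0.
have i0 : 0 <= (4 * e)^-1 by rewrite invr_ge0 ltW.
move: (normr_ge0 x); move: (`|x|) => y y0.
have [ye|ye] := leP y e.
  by rewrite -expr2 gerBl mulr_ge0// exprn_ge0.
rewrite -subr_ge0.
have -> : y * e - (y ^+ 2 - (4 * e)^-1 * y ^+ 3) = (4 * e)^-1 * (y * (2 * e - y) ^+ 2).
  by field; rewrite gt_eqF.
by rewrite mulr_ge0// mulr_ge0// sqr_ge0.
Qed.

End clamp.

Section concentration.
Context d (T : measurableType d) (R : realType) (P : probability T R).
Variables (n : nat) (G : 'I_n -> {RV P >-> R}) (mu : probability R R).
Hypotheses (indepG : mutually_independent G) (lawG : forall i, has_law P (G i) mu).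
Hypotheses (std : standardized mu).

Let mG i : measurable_fun setT (G i). Proof. exact: measurable_funP. Qed.

Lemma integrable_component_sqr i : P.-integrable setT (fun w => (G i w ^+ 2)%:E).
Proof.
by case: std => _ i2 _ _; apply/(integrable_law (mG i) (lawG i) (exprn_measurable 2)).
Qed.

Lemma component_moments i : \int[P]_w G i w = 0 /\ \int[P]_w G i w ^+ 2 = 1.
Proof.
case: std => _ _ e1 e2; split.
  by rewrite (Rintegral_law (mG i) (lawG i) (h := id)).
by rewrite (Rintegral_law (mG i) (lawG i) (exprn_measurable 2)).
Qed.

Variable z : 'I_n -> R.
Let S w := \sum_(i < n) z i * G i w.

Lemma measurable_linear_combination : measurable_fun setT S.
Proof. by apply: measurable_sum => i; apply: measurable_funM. Qed.

Lemma linear_combination_sqr : P.-integrable setT (fun w => (S w ^+ 2)%:E) /\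
  \int[P]_w S w ^+ 2 = \sum_(i < n) z i ^+ 2.
Proof.
have iS j : P.-integrable setT (fun w => ((z j * G j w) ^+ 2)%:E).
  under eq_fun do rewrite exprMn.
  by apply: integrable_scale; exact: integrable_component_sqr.
have iG i : P.-integrable setT (fun w => (G i w)%:E).
  by apply: integrable_of_sqr => //; exact: integrable_component_sqr.
have [] := @uncorrelated_sum_sqr _ _ _ P n (fun j w => z j * G j w) _ iS.
- by move=> j; exact: measurable_funM.
- move=> j; rewrite RintegralZl//; last exact: iG.
  have -> : \int[P]_w G j w = 0 := (component_moments j).1.
  by rewrite mulr0.
- move=> j k jk.
  apply: (@independent_RV_comp _ _ _ P (G j) (G k) (fun x => z j * x) (fun x => z k * x)).
  + exact: measurable_funM.
  + exact: measurable_funM.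
  + exact: independent_pair.
move=> i1 e1; split => //; rewrite [LHS]e1; apply: eq_bigr => j _.
under eq_Rintegral do rewrite exprMn.
by rewrite RintegralZl// ?(component_moments j).2 ?mulr1//; exact: integrable_component_sqr.
Qed.

Lemma integrable_linear_combination : P.-integrable setT (fun w => (S w)%:E).
Proof.
apply: integrable_of_sqr; first exact: measurable_linear_combination.
by case: linear_combination_sqr.
Qed.

Variables (m delta s : R).
Hypotheses (i3 : mu.-integrable setT (fun x => (`|x| ^+ 3)%:E))
  (mE : m = \int[mu]_x `|x| ^+ 3) (delta0 : 0 < delta) (s0 : 0 < s)
  (sE : s ^+ 2 = \sum_(i < n) z i ^+ 2)
  (lyapunov : (\sum_(i < n) `|z i| ^+ 3) * m <= delta * s ^+ 2).

(* N is a truncated version of the sum of the squares z_j^2 G_j^2; its mean is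
   comparable to the variance s^2 and it concentrates around its mean. *)
Let eta j (g : R) := `|z j * g| * Num.min `|z j * g| delta.
Let N w := \sum_(j < n) eta j (G j w).
Let e := \int[P]_w N w.

Let eta_ge0 j g : 0 <= eta j g.
Proof. by rewrite mulr_ge0// le_min normr_ge0 ltW. Qed.

Let eta_sqr j g : eta j g ^+ 2 <= (delta * z j) ^+ 2 * g ^+ 2.
Proof.
rewrite -exprMn -[leRHS]real_normK ?num_real ?ler_sqr ?nnegrE//.
rewrite -mulrA [leRHS]normrM (gtr0_norm delta0) /eta mulrC ler_wpM2r//.
by rewrite ge_min lexx orbT.
Qed.

Let meta j : measurable_fun setT (eta j).
Proof.
have mz : measurable_fun setT (fun g : R => `|z j * g|).
  by apply: measurableT_comp => //; exact: measurable_funM.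
by apply: measurable_funM => //; exact: measurable_minr.
Qed.

Let metaG j : measurable_fun setT (fun w => eta j (G j w)).
Proof. exact: measurableT_comp. Qed.

Let ieta2 j : P.-integrable setT (fun w => (eta j (G j w) ^+ 2)%:E).
Proof.
apply: (@integrable_le _ _ _ P _ (fun w => (delta * z j) ^+ 2 * G j w ^+ 2)).
- exact: measurable_funX.
- by apply: integrable_scale; exact: integrable_component_sqr.
- by move=> w; rewrite ger0_norm ?sqr_ge0.
Qed.

Let ieta j : P.-integrable setT (fun w => (eta j (G j w))%:E).
Proof. by apply: integrable_of_sqr. Qed.

Let iN : P.-integrable setT (fun w => (N w)%:E).
Proof. exact: integrable_sumr. Qed.

Let mN : measurable_fun setT N.
Proof. by apply: measurable_sum. Qed.

Lemma truncated_variance_ge : 3 / 4 * s ^+ 2 <= e.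
Proof.
rewrite /e /N Rintegral_sum//.
have cube j : P.-integrable setT (fun w => (`|G j w| ^+ 3)%:E) /\
    \int[P]_w `|G j w| ^+ 3 = m.
  have m3 : measurable_fun setT (fun x : R => `|x| ^+ 3).
    by apply: measurable_funX; exact: normr_measurable.
  by rewrite mE (Rintegral_law (mG j) (lawG j) m3) (integrable_law (mG j) (lawG j) m3).
have low j : z j ^+ 2 - (4 * delta)^-1 * (`|z j| ^+ 3 * m) <= \int[P]_w eta j (G j w).
  have [c1 c2] := cube j.
  have j1 := integrable_component_sqr j.
  have -> : z j ^+ 2 - (4 * delta)^-1 * (`|z j| ^+ 3 * m) =
      \int[P]_w (z j ^+ 2 * G j w ^+ 2 - (4 * delta)^-1 * `|z j| ^+ 3 * `|G j w| ^+ 3).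
    rewrite RintegralB//; [|exact: integrable_scale|exact: integrable_scale].
    rewrite !RintegralZl// c2.
    have -> : \int[P]_w G j w ^+ 2 = 1 := (component_moments j).2.
    by rewrite mulr1 mulrA.
  apply: le_Rintegral => //.
  - by apply: integrable_sub; exact: integrable_scale.
  - exact: ieta.
  move=> w _; have := mul_min_ge (z j * G j w) delta0; rewrite -/(eta j (G j w)).
  congr (_ <= _); rewrite real_normK ?num_real// normrM; ring.
apply: le_trans (ler_sum _ (fun j _ => low j)).
rewrite sumrB -sE -mulr_sumr -mulr_suml.
have d4 : 0 < 4 * delta by rewrite mulr_gt0.
have : (4 * delta)^-1 * ((\sum_(i < n) `|z i| ^+ 3) * m) <= s ^+ 2 / 4.
  by rewrite ler_pdivrMl//; apply: le_trans lyapunov _; lra.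
by lra.
Qed.

(** The terms of [N] are independent and at most [delta |z_j G_j|], so that the
    variance of [N] is at most [delta^2 s^2]. *)
Lemma truncated_variance_deviation : \int[P]_w `|N w - e| <= delta * s.
Proof.
pose e_ j := \int[P]_w eta j (G j w).
have NE w : N w - e = \sum_(j < n) (eta j (G j w) - e_ j).
  by rewrite sumrB /e /N Rintegral_sum.
have sqE j w : (eta j (G j w) - e_ j) ^+ 2 =
    eta j (G j w) ^+ 2 + (- (2 * e_ j) * eta j (G j w) + e_ j ^+ 2) by ring.
have icst (c : R) : P.-integrable setT (fun=> c%:E) by exact: finite_measure_integrable_cst.
have cst (c : R) : \int[P]_w c = c.
  by rewrite Rintegral_cst// [X in fine X]probability_setT mulr1.
have isq j : P.-integrable setT (fun w => ((eta j (G j w) - e_ j) ^+ 2)%:E).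
  under eq_fun do rewrite sqE.
  by apply: integrable_add => //; apply: integrable_add => //; exact: integrable_scale.
have [j1 E] : P.-integrable setT (fun w => ((\sum_(j < n) (eta j (G j w) - e_ j)) ^+ 2)%:E) /\
    \int[P]_w (\sum_(j < n) (eta j (G j w) - e_ j)) ^+ 2 =
    \sum_(j < n) \int[P]_w (eta j (G j w) - e_ j) ^+ 2.
  apply: (@uncorrelated_sum_sqr _ _ _ P n (fun j w => eta j (G j w) - e_ j)) => //.
  - by move=> j; exact: measurable_funB.
  - by move=> j; rewrite (RintegralB _ (ieta j) (icst _))// cst subrr.
  - move=> j k jk; apply: (@independent_RV_comp _ _ _ P (G j) (G k)
      (fun x => eta j x - e_ j) (fun x => eta k x - e_ k)).
    + exact: measurable_funB.
    + exact: measurable_funB.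
    + exact: independent_pair.
under eq_Rintegral do rewrite NE.
apply: expectation_norm_le => //; first by rewrite mulr_gt0.
  by apply: measurable_sum => j; exact: measurable_funB.
rewrite [leLHS]E exprMn sE mulr_sumr; apply: ler_sum => j _.
under eq_Rintegral do rewrite sqE.
have i1 : P.-integrable setT (fun w => (- (2 * e_ j) * eta j (G j w))%:E).
  exact: integrable_scale.
rewrite (RintegralD _ (ieta2 j) (integrable_add i1 (icst _)))//.
rewrite (RintegralD _ i1 (icst _))// cst (RintegralZl _ _ (ieta j))// -/(e_ j).
have : \int[P]_w eta j (G j w) ^+ 2 <= delta ^+ 2 * z j ^+ 2.
  apply: (@le_trans _ _ (\int[P]_w ((delta * z j) ^+ 2 * G j w ^+ 2))).
    apply: le_Rintegral => //; first exact: ieta2.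
    by apply: integrable_scale; exact: integrable_component_sqr.
  rewrite RintegralZl//; last exact: integrable_component_sqr.
  have -> : \int[P]_w G j w ^+ 2 = 1 := (component_moments j).2.
  by rewrite mulr1 exprMn.
by have := sqr_ge0 (e_ j); lra.
Qed.

(** Chen and Shao's argument. Take [f] the identity clamped at [t + delta].
    Removing from [S] the [j]-th term makes it independent of [G_j], so
    [E[S f(S)]] is the sum of [E[z_j G_j (f(S) - f(S - z_j G_j))]]; each
    integrand is nonnegative, and on [|S| <= t] their sum is at least [N].
    Hence [E[N 1(|S| <= t)] <= (t + delta) s]. Replacing [N] by its mean costs
    half of its mean deviation, because the indicator minus [1/2] is bounded by
    [1/2] and [N] minus its mean is centred. *)
Lemma concentration (t : R) : 0 <= t ->
  3 / 4 * s ^+ 2 * \int[P]_w (if `|S w| <= t then 1 else 0) <= s * (t + 3 / 2 * delta).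
Proof.
move=> t0; pose I w : R := if `|S w| <= t then 1 else 0.
have mS := measurable_linear_combination.
have mI : measurable_fun setT I.
  apply: measurable_fun_ifT => //; apply: measurable_fun_ler => //.
  exact: measurableT_comp.
have iI : P.-integrable setT (fun w => (I w)%:E).
  apply: (@integrable_bounded _ _ _ _ _ 1) => // w.
  by rewrite /I; case: ifP; rewrite ?normr1 ?normr0.
rewrite -[X in _ * X <= _]/(\int[P]_w I w).
pose b := t + delta; have b0 : 0 <= b by rewrite addr_ge0 ?(ltW delta0).
have mf : measurable_fun setT (fun w => clamp b (S w)).
  by apply: measurableT_comp mS; exact: measurable_clamp.
have iG j : P.-integrable setT (fun w => (G j w)%:E).
  by apply: integrable_of_sqr => //; exact: integrable_component_sqr.
have iX (X : T -> R) j : measurable_fun setT X ->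
    P.-integrable setT (fun w => (G j w * clamp b (X w))%:E).
  move=> mX; apply: (@integrable_le _ _ _ P _ (fun w => b * `|G j w|)).
  - apply: measurable_funM => //; apply: measurableT_comp mX; exact: measurable_clamp.
  - by apply: integrable_scale; exact: integrable_norm (iG j).
  - by move=> w; rewrite normrM mulrC ler_wpM2r// clamp_norm.
have mSj j : measurable_fun setT (fun w => S w - z j * G j w).
  by apply: measurable_funB => //; exact: measurable_funM.
have drop j : \int[P]_w (G j w * clamp b (S w - z j * G j w)) = 0.
  have SE : (fun w => S w - z j * G j w) =
      (fun w => \sum_(i < n) (if i == j then 0 else z i) * G i w).
    apply/funext => w; rewrite /S (bigD1 j)//= [RHS](bigD1 j)//= eqxx mul0r add0r.
    rewrite addrAC subrr add0r; apply: eq_bigr => i /negbTE ij.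
    by rewrite ij.
  rewrite (@independent_Rintegral_mul _ _ _ P (G j)
    (fun w => clamp b (S w - z j * G j w))) //.
  - have -> : \int[P]_w G j w = 0 := (component_moments j).1.
    by rewrite mul0r.
  - apply: (@independent_RV_comp _ _ _ P (G j) (fun w => S w - z j * G j w) id (clamp b)).
    + exact: measurable_id.
    + exact: measurable_clamp.
    + by rewrite SE; apply: independent_linear_combination; rewrite // eqxx.
  - apply: (@integrable_bounded _ _ _ _ _ b) => [|w]; last exact: clamp_norm.
    by apply: measurableT_comp (mSj j); exact: measurable_clamp.
  - exact: iX.
pose W w := \sum_(j < n) z j * G j w * (clamp b (S w) - clamp b (S w - z j * G j w)).
have WE w j : z j * G j w * (clamp b (S w) - clamp b (S w - z j * G j w)) =
    z j * (G j w * clamp b (S w)) - z j * (G j w * clamp b (S w - z j * G j w)) by ring.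
have iW j : P.-integrable setT (fun w =>
    (z j * G j w * (clamp b (S w) - clamp b (S w - z j * G j w)))%:E).
  by under eq_fun do rewrite WE; apply: integrable_sub; apply: integrable_scale; exact: iX.
have intW : \int[P]_w W w = \int[P]_w (S w * clamp b (S w)).
  rewrite Rintegral_sum//.
  have SfE w : S w * clamp b (S w) = \sum_(j < n) z j * (G j w * clamp b (S w)).
    by rewrite {1}/S mulr_suml; apply: eq_bigr => j _; rewrite mulrA.
  under [RHS]eq_Rintegral do rewrite SfE.
  rewrite Rintegral_sum => [|j]; last by apply: integrable_scale; exact: iX.
  apply: eq_bigr => j _; under eq_Rintegral do rewrite WE.
  rewrite RintegralB//; [|by apply: integrable_scale; exact: iX..].
  by rewrite [X in _ - X]RintegralZl ?drop ?mulr0 ?subr0//; exact: iX.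
have intSf : \int[P]_w (S w * clamp b (S w)) <= b * s.
  have [iS2 ES2] := linear_combination_sqr.
  have iS := integrable_linear_combination.
  apply: (@le_trans _ _ (\int[P]_w (b * `|S w|))).
    apply: le_Rintegral => //.
    - apply: (@integrable_le _ _ _ P _ (fun w => b * `|S w|)).
      + exact: measurable_funM.
      + by apply: integrable_scale; exact: integrable_norm iS.
      + by move=> w; rewrite normrM mulrC ler_wpM2r// clamp_norm.
    - by apply: integrable_scale; exact: integrable_norm iS.
    - move=> w _; apply: le_trans (ler_norm _) _.
      by rewrite normrM mulrC ler_wpM2r// clamp_norm.
  rewrite RintegralZl//; last exact: integrable_norm iS.
  by rewrite ler_wpM2l// expectation_norm_le// sE; rewrite ES2.
have INW w : I w * N w <= W w.
  rewrite /I; case: ifP => h.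
    rewrite mul1r; apply: ler_sum => j _.
    by apply: clamp_increment_ge => //; exact: ltW.
  by rewrite mul0r; apply: sumr_ge0 => j _; exact: clamp_increment_ge0.
have split_I w : e * I w + 2^-1 * (N w - e) - 2^-1 * `|N w - e| <= I w * N w.
  have := ler_norm (N w - e); have := ler_norm (- (N w - e)); rewrite normrN.
  by rewrite /I; case: ifP => _; lra.
have icst (c : R) : P.-integrable setT (fun=> c%:E) by exact: finite_measure_integrable_cst.
have cst (c : R) : \int[P]_w c = c.
  by rewrite Rintegral_cst// [X in fine X]probability_setT mulr1.
have iNe : P.-integrable setT (fun w => (N w - e)%:E) by exact: integrable_sub.
have iaNe : P.-integrable setT (fun w => `|N w - e|%:E) by exact: integrable_norm iNe.
have k1 : P.-integrable setT (fun w => (e * I w)%:E) by exact: integrable_scale.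
have k2 : P.-integrable setT (fun w => (2^-1 * (N w - e))%:E) by exact: integrable_scale.
have k3 : P.-integrable setT (fun w => (2^-1 * `|N w - e|)%:E) by exact: integrable_scale.
have k4 : P.-integrable setT (fun w => (e * I w + 2^-1 * (N w - e))%:E).
  exact: integrable_add.
have lower : e * \int[P]_w I w - 2^-1 * \int[P]_w `|N w - e| <= \int[P]_w W w.
  have -> : e * \int[P]_w I w - 2^-1 * \int[P]_w `|N w - e| =
      \int[P]_w (e * I w + 2^-1 * (N w - e) - 2^-1 * `|N w - e|).
    rewrite (RintegralB _ k4 k3)// (RintegralD _ k1 k2)//.
    rewrite (RintegralZl _ _ iI)// (RintegralZl _ _ iNe)// (RintegralZl _ _ iaNe)//.
    by rewrite (RintegralB _ iN (icst _))// cst -/e subrr mulr0 addr0.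
  apply: le_Rintegral => //.
  - exact: integrable_sub.
  - exact: integrable_sumr.
  - by move=> w _; exact: le_trans (split_I w) (INW w).
have I0 : 0 <= \int[P]_w I w.
  by apply: Rintegral_ge0 => // w _; rewrite /I; case: ifP.
have := ler_wpM2r I0 truncated_variance_ge.
have := truncated_variance_deviation; rewrite intW in lower.
by move: intSf lower; rewrite /b; lra.
Qed.

End concentration.

(** * Correlation of the components with the sign *)
Lemma measurable_theta (R : realType) : measurable_fun setT (@theta R).
Proof. by apply: measurable_fun_ifT => //; exact: measurable_fun_ler. Qed.

Lemma theta_norm (R : realType) (s : R) : `|theta s| = 1.
Proof. by rewrite /theta; case: ifP; rewrite ?normrN1 ?normr1. Qed.

Lemma theta_mul (R : realType) (s : R) : theta s * s = `|s|.
Proof.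
rewrite /theta; case: ifPn => s0; first by rewrite mul1r ger0_norm.
by rewrite mulN1r ltr0_norm// ltNge.
Qed.

(** Adding [a] or [- a] to [s] gives the same sign unless [|s| <= |a|]. *)
Lemma theta_flip (R : realType) (s a : R) :
  `|theta (a + s) - theta (- a + s)| <= 2 * (if `|s| <= `|a| then 1 else 0).
Proof.
case: ifPn => h.
  rewrite (le_trans (ler_normB _ _))// !theta_norm; lra.
move: h; rewrite -ltNge => h.
have -> : theta (a + s) = theta (- a + s); last by rewrite subrr normr0 mulr0.
move: h; rewrite ltr_normr /theta => /orP[|] h.
  have := ler_norm a; have := ler_norm (- a); rewrite normrN => h1 h2.
  by rewrite !ifT//; lra.
have := ler_norm a; have := ler_norm (- a); rewrite normrN => h1 h2.
by rewrite !ifF//; apply/negbTE; rewrite -ltNge; lra.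
Qed.

Section sign_correlation.
Context d (T : measurableType d) (R : realType) (P : probability T R).
Variables (n : nat) (G : 'I_n -> {RV P >-> R}) (mu : probability R R).
Hypotheses (indepG : mutually_independent G) (lawG : forall i, has_law P (G i) mu).
Hypotheses (std : standardized mu).

Let mG i : measurable_fun setT (G i). Proof. exact: measurable_funP. Qed.

Let iG i : P.-integrable setT (fun w => (G i w)%:E).
Proof. by apply: integrable_of_sqr => //; exact: integrable_component_sqr. Qed.

Section component_bound.
Hypothesis sym : symmetric_dist mu.
Variable m : R.
Hypotheses (i3 : mu.-integrable setT (fun x => (`|x| ^+ 3)%:E))
  (mE : m = \int[mu]_x `|x| ^+ 3).

(** [x^2 <= 2/3 |x|^3 + 1/3] by the inequality of arithmetic and geometric
    means. *)
Lemma third_moment_ge1 : 1 <= m.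
Proof.
case: std => i1 i2 e1 e2.
have icst (c : R) : mu.-integrable setT (fun=> c%:E) by exact: finite_measure_integrable_cst.
have cst (c : R) : \int[mu]_w c = c.
  by rewrite Rintegral_cst// [X in fine X]probability_setT mulr1.
have j3 := integrable_scale (2 / 3) i3.
have : \int[mu]_x x ^+ 2 <= \int[mu]_x (2 / 3 * `|x| ^+ 3 + 3^-1).
  apply: le_Rintegral => //; first exact: integrable_add.
  move=> x _; rewrite -[leLHS]real_normK ?num_real//.
  move: (normr_ge0 x); move: (`|x|) => u u0.
  have : 0 <= (u - 1) ^+ 2 * (2 * u + 1) by rewrite mulr_ge0 ?sqr_ge0//; lra.
  have -> : (u - 1) ^+ 2 * (2 * u + 1) = 2 * u ^+ 3 - 3 * u ^+ 2 + 1 by ring.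
  by lra.
rewrite (RintegralD _ j3 (icst _))// cst (RintegralZl _ _ i3)// -mE e2.
by lra.
Qed.

Variables (x : 'I_n -> R) (X : R).
Hypotheses (x1 : \sum_(i < n) x i ^+ 2 = 1) (xX : forall i, `|x i| <= X) (X2 : X <= 2^-1).

Let W w := \sum_(i < n) x i * G i w.

(** By symmetry of [G_i], half of the difference between the signs of
    [x_i G_i + S] and [- x_i G_i + S] may replace the sign of [W]; by
    [theta_flip] what is left is [E[|G_i| 1(|S| <= |x_i G_i|)]], and integrating
    over [S] first brings in [concentration]. *)
Lemma sign_component_le i : `|\int[P]_w (theta (W w) * G i w)| <= 4 * (X * m).
Proof.
have m1 := third_moment_ge1; have m0 : 0 < m by exact: lt_le_trans m1.
have X0 : 0 < X.
  rewrite lt_neqAle (le_trans _ (xX i))// andbT; apply/eqP => X0.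
  have : \sum_(i < n) x i ^+ 2 = 0.
    apply: big1 => j _; have := xX j; rewrite -X0 normr_le0 => /eqP ->.
    by rewrite expr0n.
  by rewrite x1 => /eqP; rewrite oner_eq0.
pose z j := if j == i then 0 else x j.
pose S w := \sum_(j < n) z j * G j w.
have WE w : W w = x i * G i w + S w.
  rewrite /W /S (bigD1 i)//= [in RHS](bigD1 i)//= /z eqxx mul0r add0r.
  by congr (_ + _); apply: eq_bigr => j /negbTE ->.
have zE : \sum_(j < n) z j ^+ 2 = 1 - x i ^+ 2.
  rewrite -x1 [in RHS](bigD1 i)//= (bigD1 i)//= /z eqxx expr0n add0r addrAC subrr add0r.
  by apply: eq_bigr => j /negbTE ->.
have xi2 : x i ^+ 2 <= 4^-1.
  rewrite -[leLHS]real_normK ?num_real//.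
  have := le_trans (xX i) X2; move: (normr_ge0 (x i)); move: (`|x i|) => u u0 u1.
  have := ler_pM u0 u0 u1 u1; rewrite -expr2; lra.
pose s := Num.sqrt (1 - x i ^+ 2).
have s2 : s ^+ 2 = 1 - x i ^+ 2 by rewrite sqr_sqrtr//; lra.
(* s^2 >= 3/4 > 25/36; with this, 4 / (3 s) <= 8/5 and 8/5 (1 + 3/2) = 4. *)
have s56 : 5 / 6 <= s.
  have s0 : 0 <= s by exact: sqrtr_ge0.
  rewrite leNgt; apply/negP => s1; have : s * s <= 5 / 6 * (5 / 6) by apply: ler_pM => //; lra.
  by rewrite -expr2 s2; lra.
have s0 : 0 < s by lra.
pose delta := X * m; have delta0 : 0 < delta by exact: mulr_gt0.
have lyap : (\sum_(j < n) `|z j| ^+ 3) * m <= delta * s ^+ 2.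
  rewrite /delta mulrAC ler_wpM2r ?(ltW m0)// s2 -zE mulr_sumr; apply: ler_sum => j _.
  rewrite exprSr mulrC real_normK ?num_real// ler_wpM2r ?sqr_ge0//.
  by rewrite /z; case: ifP => _ //; rewrite normr0 ltW.
have sz : s ^+ 2 = \sum_(j < n) z j ^+ 2 by rewrite zE.
have conc := concentration indepG lawG std i3 mE delta0 s0 sz lyap.
have mS : measurable_fun setT S by exact: measurable_linear_combination.
pose SRV : {RV P >-> R} := HB.pack S (isMeasurableFun.Build _ _ _ _ S mS).
pose nu : probability R R := distribution P SRV.
have lS : has_law P S nu by [].
have indS : independent_RV P (G i) S.
  by apply: independent_linear_combination => //; rewrite /z eqxx.
pose h (p : R * R) := theta (x i * p.1 + p.2) * p.1.
have mh : measurable_fun setT h.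
  apply: measurable_funM; last exact: measurable_fst.
  apply: measurableT_comp; first exact: measurable_theta.
  apply: measurable_funD; last exact: measurable_snd.
  by apply: measurable_funM => //; exact: measurable_fst.
have mopp : measurable_fun setT (-%R : R -> R).
  by apply: continuous_measurable_fun; exact: opp_continuous.
have mNG : measurable_fun setT (fun w => - G i w) by exact: measurableT_comp.
have lNG : has_law P (fun w => - G i w) mu.
  move=> B mB; have mNB : measurable (-%R @^-1` B).
    by rewrite -[X in measurable X]setTI; exact: mopp.
  by rewrite -(sym mB) -(lawG i mNB).
have indNS : independent_RV P (fun w => - G i w) S.
  apply: (@independent_RV_comp _ _ _ P (G i) S -%R id) => //.
have flip : \int[P]_w h (G i w, S w) = \int[P]_w h (- G i w, S w).
  rewrite (Rintegral_law (measurable_fun_pair (mG i) mS)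
    (independent_joint_law (mG i) mS (lawG i) lS indS) mh).
  by rewrite -(Rintegral_law (measurable_fun_pair mNG mS)
    (independent_joint_law mNG mS lNG lS indNS) mh).
have ih (Y : T -> R) : measurable_fun setT Y -> (forall w, `|Y w| = `|G i w|) ->
    P.-integrable setT (fun w => (h (Y w, S w))%:E).
  move=> mY YG; apply: (@integrable_le _ _ _ P _ (fun w => `|G i w|)).
  - exact: (measurableT_comp mh (measurable_fun_pair mY mS)).
  - exact: integrable_norm (iG i).
  - by move=> w; rewrite /h normrM theta_norm mul1r YG.
have ih1 := ih _ (mG i) (fun=> erefl).
have ih2 := ih _ mNG (fun w => normrN (G i w)).
pose I (t u : R) : R := if `|u| <= t then 1 else 0.
have mI : measurable_fun setT (fun p : R * R => `|p.2| * I (`|x i| * `|p.2|) p.1).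
  apply: measurable_funM; first by apply: measurableT_comp => //; exact: measurable_snd.
  apply: measurable_fun_ifT => //; apply: measurable_fun_ler.
    by apply: measurableT_comp => //; exact: measurable_fst.
  apply: measurable_funM => //.
  by apply: measurableT_comp => //; exact: measurable_snd.
have I01 t u : `|I t u| <= 1 by rewrite /I; case: ifP; rewrite ?normr1 ?normr0.
have iI : P.-integrable setT (fun w => (`|G i w| * I (`|x i| * `|G i w|) (S w))%:E).
  apply: (@integrable_le _ _ _ P _ (fun w => `|G i w|)).
  - exact: (measurableT_comp mI (measurable_fun_pair mS (mG i))).
  - exact: integrable_norm (iG i).
  - by move=> w; rewrite normrM normr_id ler_piMr.
have step1 : `|\int[P]_w (theta (W w) * G i w)| <=
    \int[P]_w (`|G i w| * I (`|x i| * `|G i w|) (S w)).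
  have -> : \int[P]_w (theta (W w) * G i w) =
      \int[P]_w (2^-1 * (h (G i w, S w) + h (- G i w, S w))).
    have -> : \int[P]_w (theta (W w) * G i w) = \int[P]_w h (G i w, S w).
      by apply: eq_Rintegral => w _; rewrite WE.
    rewrite (RintegralZl _ _ (integrable_add ih1 ih2))// (RintegralD _ ih1 ih2)//.
    by rewrite -flip; field.
  apply: le_trans (le_normr_Rintegral _ _) _ => //.
    by apply: integrable_scale; exact: integrable_add.
  apply: le_Rintegral => //.
    apply: (integrable_norm (f := fun w => 2^-1 * (h (G i w, S w) + h (- G i w, S w)))).
    by apply: integrable_scale; exact: integrable_add.
  move=> w _; rewrite /h /= (mulrN (theta _)) -mulNr.
  rewrite (mulrN (x i)) -mulrDl.
  rewrite normrM normrM (ger0_norm (_ : 0 <= 2^-1))// mulrA mulrC ler_wpM2l//.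
  by rewrite ler_pdivrMl//; apply: le_trans (theta_flip _ _) _; rewrite normrM.
apply: le_trans step1 _.
have indSG : independent_RV P S (G i) by move=> B C mB mC; rewrite setIC muleC; exact: indS.
have iIt (t : R) : nu.-integrable setT (fun u => (`|t| * I (`|x i| * `|t|) u)%:E).
  apply: integrable_scale; apply: (@integrable_bounded _ _ _ _ _ 1) => //.
  apply: measurable_fun_ifT => //; apply: measurable_fun_ler => //.
have [j1 ->] := independent_Fubini mS (mG i) lS (lawG i) indSG mI iI iIt.
pose K := 4 / (3 * s).
have [iabs abs1] : mu.-integrable setT (fun x => `|x|%:E) /\ \int[mu]_x `|x| <= 1.
  case: std => k1 k2 e1 e2; split; first exact: integrable_norm k1.
  by apply: expectation_norm_le => //; rewrite e2 expr1n.
have sqr1 : \int[mu]_x x ^+ 2 = 1 by case: std.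
have isq : mu.-integrable setT (fun x => (x ^+ 2)%:E) by case: std.
have inner (t : R) : \int[nu]_u (`|t| * I (`|x i| * `|t|) u) <=
    K * `|x i| * t ^+ 2 + K * (3 / 2 * delta) * `|t|.
  have mIt : measurable_fun setT (I (`|x i| * `|t|)).
    by apply: measurable_fun_ifT => //; apply: measurable_fun_ler.
  rewrite RintegralZl//; last first.
    by apply: (@integrable_bounded _ _ _ _ _ 1).
  rewrite -(Rintegral_law mS lS mIt).
  have := conc (`|x i| * `|t|) (mulr_ge0 (normr_ge0 _) (normr_ge0 _)).
  rewrite -[X in _ * X <= _ -> _]/(\int[P]_w I (`|x i| * `|t|) (S w)).
  set p := \int[P]_w _ => hp.
  have {}hp : p <= K * (`|x i| * `|t| + 3 / 2 * delta).
    rewrite /K; have s20 : 0 < 3 / 4 * s ^+ 2 by rewrite mulr_gt0 ?exprn_gt0//; lra.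
    rewrite -(ler_pM2l s20); apply: le_trans hp _.
    rewrite [leRHS](_ : _ = s * (`|x i| * `|t| + 3 / 2 * delta))//.
    by field; rewrite gt_eqF.
  have -> : K * `|x i| * t ^+ 2 + K * (3 / 2 * delta) * `|t| =
      `|t| * (K * (`|x i| * `|t| + 3 / 2 * delta)).
    by rewrite -[t ^+ 2]real_normK ?num_real//; ring.
  by rewrite ler_wpM2l.
have k1 := integrable_scale (K * `|x i|) isq.
have k2 := integrable_scale (K * (3 / 2 * delta)) iabs.
apply: (@le_trans _ _ (\int[mu]_t (K * `|x i| * t ^+ 2 + K * (3 / 2 * delta) * `|t|))).
  by apply: le_Rintegral => //; [exact: integrable_add|move=> t _; exact: inner].
rewrite (RintegralD _ k1 k2)// (RintegralZl _ _ isq)// (RintegralZl _ _ iabs)// sqr1 mulr1.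
have K85 : K <= 8 / 5 by rewrite /K ler_pdivrMr ?mulr_gt0//; lra.
have K0 : 0 <= K by rewrite divr_ge0 ?mulr_ge0 ?(ltW s0).
have Xm : X <= X * m by rewrite ler_peMr// ltW.
have h1 : K * `|x i| <= 8 / 5 * (X * m).
  by apply: ler_pM => //; apply: le_trans Xm.
have h2 : K * (3 / 2 * delta) * \int[mu]_t `|t| <= 8 / 5 * (3 / 2 * (X * m)).
  rewrite -[leRHS]mulr1; apply: ler_pM => //.
  - by rewrite mulr_ge0// mulr_ge0 ?(ltW delta0).
  - by apply: Rintegral_ge0.
  - by apply: ler_pM => //; rewrite mulr_ge0 ?(ltW delta0).
by lra.
Qed.

End component_bound.

Section stein_bound.
Variables (D : R).
Hypothesis sd : stein_discrepancy_le mu D.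
Variable c : R.
Variables F F' : R -> R.
Hypotheses (dF : forall x : R, is_derive x (1 : R) F (F' x))
  (ode : forall x, F' x - x * F x = `|x| - c)
  (bF : forall x, `|F' x| <= c)
  (lF : forall x y, `|F' x - F' y| <= `|x - y|).

(** The Stein equation turns [E|W| - c] into [E[F'(W)] - E[W F(W)]], which is
    split along the components with weights [u_i^2]; [stein_step] bounds each
    part by [|u_i|^3 D]. *)
Lemma absolute_moment_stein (u : 'I_n -> R) : \sum_(i < n) u i ^+ 2 = 1 ->
  `|\int[P]_w `|\sum_(i < n) u i * G i w| - c| <= (\sum_(i < n) `|u i| ^+ 3) * D.
Proof.
move=> u1; pose W w := \sum_(i < n) u i * G i w.
have mW : measurable_fun setT W by exact: measurable_linear_combination.
have iW : P.-integrable setT (fun w => (W w)%:E).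
  exact: integrable_linear_combination indepG lawG std u.
have iaW : P.-integrable setT (fun w => `|W w|%:E) by exact: integrable_norm iW.
have icst (k : R) : P.-integrable setT (fun=> k%:E) by exact: finite_measure_integrable_cst.
have cst (k : R) : \int[P]_w k = k.
  by rewrite Rintegral_cst// [X in fine X]probability_setT mulr1.
have cF' : continuous F'.
  by apply: (lip_continuous (L := 1)) => // x y; rewrite mul1r.
have iF' : P.-integrable setT (fun w => (F' (W w))%:E).
  apply: (@integrable_bounded _ _ _ _ _ c) => //.
  by apply: measurableT_comp mW; exact: continuous_measurable_fun.
have lF1 x y : `|F' x - F' y| <= 1 * `|x - y| by rewrite mul1r.
pose Y i w := W w - u i * G i w.
have YE i w : W w = u i * G i w + Y i w by rewrite /Y addrC subrK.
have YS i : Y i = (fun w => \sum_(j < n) (if j == i then 0 else u j) * G j w).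
  apply/funext => w; rewrite /Y /W (bigD1 i)//= [RHS](bigD1 i)//= eqxx mul0r add0r.
  by rewrite addrAC subrr add0r; apply: eq_bigr => j /negbTE ->.
have mY i : measurable_fun setT (Y i).
  by rewrite YS; exact: measurable_linear_combination.
have indY i : independent_RV P (G i) (Y i).
  by rewrite YS; apply: independent_linear_combination => //; rewrite eqxx.
have Y2 i : P.-integrable setT (fun w => (Y i w ^+ 2)%:E).
  by rewrite YS; have [] := linear_combination_sqr indepG lawG std
    (fun j => if j == i then 0 else u j).
have X2 : mu.-integrable setT (fun x => (x ^+ 2)%:E) by case: std.
have step i : `|u i * (\int[P]_w (G i w * F (W w))) - u i ^+ 2 * \int[P]_w F' (W w)|
    <= `|u i| ^+ 3 * D.
  have := stein_step (mG i) (mY i) (lawG i) (indY i) X2 (Y2 i) ltr01 dF bF lF1 (u i) sd.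
  rewrite mul1r; apply: le_trans.
  have e1 : \int[P]_w (G i w * F (W w)) = \int[P]_w (G i w * F (u i * G i w + Y i w)).
    by apply: eq_Rintegral => w _; rewrite -YE.
  have e2 : \int[P]_w F' (W w) = \int[P]_w F' (u i * G i w + Y i w).
    by apply: eq_Rintegral => w _; rewrite -YE.
  by rewrite e1 e2.
have iGF i : P.-integrable setT (fun w => (G i w * F (W w))%:E).
  have := integrable_stein_step (mG i) (mY i) (lawG i) X2 (Y2 i) dF bF (u i).
  by under eq_fun do rewrite -YE.
have WFE w : W w * F (W w) = \sum_(i < n) u i * (G i w * F (W w)).
  by rewrite {1}/W mulr_suml; apply: eq_bigr => i _; rewrite mulrA.
have iWF : P.-integrable setT (fun w => (W w * F (W w))%:E).
  under eq_fun do rewrite WFE.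
  by apply: integrable_sumr => i; exact: integrable_scale.
have E : \int[P]_w `|W w| - c =
    \sum_(i < n) (u i ^+ 2 * \int[P]_w F' (W w) - u i * \int[P]_w (G i w * F (W w))).
  rewrite sumrB -mulr_suml u1 mul1r.
  have -> : \sum_(i < n) u i * \int[P]_w (G i w * F (W w)) = \int[P]_w (W w * F (W w)).
    under [RHS]eq_Rintegral do rewrite WFE.
    rewrite Rintegral_sum => [|i]; last exact: integrable_scale.
    by apply: eq_bigr => i _; rewrite RintegralZl//; exact: iGF.
  rewrite -(RintegralB _ iF' iWF)//.
  rewrite -[X in _ - X]cst -(RintegralB _ iaW (icst _))//.
  by apply: eq_Rintegral => w _; rewrite ode.
rewrite [X in `|X - _|]/(\int[P]_w `|W w|) E.
apply: le_trans (ler_norm_sum _ _ _) _; rewrite mulr_suml.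
by apply: ler_sum => i _; rewrite distrC.
Qed.

End stein_bound.

Section alignment.
Variables (D : R) (x : 'I_n -> R).
Hypotheses (D0 : 0 <= D) (sd : stein_discrepancy_le mu D).
Hypothesis x1 : \sum_(i < n) x i ^+ 2 = 1.

Let W w := \sum_(i < n) x i * G i w.
Let v i := \int[P]_w (theta (W w) * G i w).
Let lam := \int[P]_w `|W w|.

Let mW : measurable_fun setT W. Proof. exact: measurable_linear_combination. Qed.

Let mtW : measurable_fun setT (fun w => theta (W w)).
Proof. by apply: measurableT_comp mW; exact: measurable_theta. Qed.

Let itG i : P.-integrable setT (fun w => (theta (W w) * G i w)%:E).
Proof.
apply: (@integrable_le _ _ _ P _ (fun w => `|G i w|)).
- exact: measurable_funM.
- exact: integrable_norm (iG i).
- by move=> w; rewrite normrM theta_norm mul1r.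
Qed.

Lemma sign_pairing (u : 'I_n -> R) :
  P.-integrable setT (fun w => (theta (W w) * \sum_(i < n) u i * G i w)%:E) /\
  \int[P]_w (theta (W w) * \sum_(i < n) u i * G i w) = \sum_(i < n) u i * v i.
Proof.
have E w : theta (W w) * \sum_(i < n) u i * G i w =
    \sum_(i < n) u i * (theta (W w) * G i w).
  by rewrite mulr_sumr; apply: eq_bigr => i _; rewrite mulrCA.
split.
  by under eq_fun do rewrite E; apply: integrable_sumr => i; exact: integrable_scale.
under eq_Rintegral do rewrite E.
rewrite Rintegral_sum => [|i]; last exact: integrable_scale.
by apply: eq_bigr => i _; rewrite RintegralZl//; exact: itG.
Qed.

(** [alpha^2 = N^2 - lam^2 <= 2 N (N - lam)], and [absolute_moment_stein] for the
    unit vectors [v / N] and [x] bounds [N - lam]. Keeping [K] free covers laws of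
    zero discrepancy without third moment. *)
Lemma sign_alignment_le (K : R) (t : 'I_n -> R) : 0 <= K ->
  (forall i, `|v i| <= 4 * K) -> (forall i, `|x i| <= K) ->
  \sum_(i < n) t i ^+ 2 <= 1 ->
  `|\sum_(i < n) t i * v i - lam * \sum_(i < n) x i * t i| <= Num.sqrt (10 * D * K).
Proof.
move=> K0 vX xX t1.
have lamE : lam = \sum_(i < n) x i * v i.
  by rewrite -(sign_pairing x).2; apply: eq_Rintegral => w _; rewrite theta_mul.
have lam0 : 0 <= lam by exact: Rintegral_ge0.
pose a i := v i - lam * x i.
pose A := \sum_(i < n) a i ^+ 2.
pose V := \sum_(i < n) v i ^+ 2.
have V0 : 0 <= V by apply: sumr_ge0 => i _; exact: sqr_ge0.
have A0 : 0 <= A by apply: sumr_ge0 => i _; exact: sqr_ge0.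
have AE : A = V - lam ^+ 2.
  have -> : A = V - 2 * lam * \sum_(i < n) x i * v i + lam ^+ 2 * \sum_(i < n) x i ^+ 2.
    rewrite /A /V !mulr_sumr -sumrB -big_split/=; apply: eq_bigr => i _.
    by rewrite /a; ring.
  by rewrite -lamE x1; ring.
have A_le : A <= 10 * D * K.
  have rhs0 : 0 <= 10 * D * K by rewrite !mulr_ge0.
  pose N := Num.sqrt V.
  have N0 : 0 <= N by exact: sqrtr_ge0.
  have N2 : N ^+ 2 = V by rewrite sqr_sqrtr.
  have [Nz|Nn0] := eqVneq N 0.
    apply: le_trans rhs0; rewrite AE -N2 Nz expr0n sub0r oppr_le0; exact: sqr_ge0.
  have Np : 0 < N by rewrite lt_neqAle eq_sym Nn0.
  pose u i := v i / N.
  have u1 : \sum_(i < n) u i ^+ 2 = 1.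
    rewrite /u; under eq_bigr do rewrite expr_div_n.
    by rewrite -mulr_suml -/V -N2 divff// expf_neq0.
  pose U w := \sum_(i < n) u i * G i w.
  have mU : measurable_fun setT U by exact: measurable_linear_combination.
  have [iU2 EU2] := linear_combination_sqr indepG lawG std u.
  have iU := integrable_linear_combination indepG lawG std u.
  have NU : N <= \int[P]_w `|U w|.
    have -> : N = \int[P]_w (theta (W w) * U w).
      rewrite (sign_pairing u).2 /u; under eq_bigr do rewrite mulrAC -expr2.
      by rewrite -mulr_suml -/V -N2 expr2 mulfK.
    apply: le_Rintegral => //; first exact: (sign_pairing u).1.
      exact: integrable_norm iU.
    by move=> w _; apply: le_trans (ler_norm _) _; rewrite normrM theta_norm mul1r.
  have U1 : \int[P]_w `|U w| <= 1.
    by apply: expectation_norm_le => //; rewrite EU2 u1 expr1n.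
  have [c [F [F' [dF ode bF lF]]]] := @stein_abs R.
  have sU : `|\int[P]_w `|U w| - c| <= _ := absolute_moment_stein sd dF ode bF lF u1.
  have sW : `|lam - c| <= _ := absolute_moment_stein sd dF ode bF lF x1.
  have Nlam : N - lam <= D * (\sum_(i < n) `|u i| ^+ 3 + \sum_(i < n) `|x i| ^+ 3).
    by move: sU sW; rewrite !ler_norml => /andP[_ h1] /andP[h2 _]; lra.
  have lamN : lam <= N.
    rewrite -(@ler_pXn2r _ 2) ?nnegrE// N2.
    by rewrite -subr_ge0 -AE.
  have Nu : N * \sum_(i < n) `|u i| ^+ 3 <= 4 * K.
    apply: (@le_trans _ _ (\sum_(i < n) 4 * K * u i ^+ 2)); last first.
      by rewrite -mulr_sumr u1 mulr1.
    rewrite mulr_sumr; apply: ler_sum => i _; rewrite exprS real_normK ?num_real// (mulrA N).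
    rewrite ler_wpM2r ?sqr_ge0//.
    rewrite normrM normfV (ger0_norm N0) mulrC divfK//; exact: vX.
  have Nx : N * \sum_(i < n) `|x i| ^+ 3 <= K.
    rewrite -[leRHS]mul1r; apply: ler_pM => //; [|exact: le_trans U1|].
      by apply: sumr_ge0 => i _; rewrite exprn_ge0.
    apply: (@le_trans _ _ (\sum_(i < n) K * x i ^+ 2)); last first.
      by rewrite -mulr_sumr x1 mulr1.
    apply: ler_sum => i _.
    by rewrite exprS real_normK ?num_real// ler_wpM2r ?sqr_ge0.
  have h1 : A <= 2 * (N * (N - lam)).
    rewrite AE -N2; have : lam * (N - lam) <= N * (N - lam).
      by rewrite ler_wpM2r// subr_ge0.
    by rewrite !expr2; lra.
  apply: le_trans h1 _.
  have h2 := ler_wpM2l N0 Nlam.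
  have h3 : D * (N * \sum_(i < n) `|u i| ^+ 3 + N * \sum_(i < n) `|x i| ^+ 3) <=
      D * (5 * K) by rewrite ler_wpM2l//; lra.
  by move: h2 h3; lra.
pose b := \sum_(i < n) a i * t i.
have bE : \sum_(i < n) t i * v i - lam * \sum_(i < n) x i * t i = b.
  by rewrite mulr_sumr -sumrB; apply: eq_bigr => i _; rewrite /a; ring.
rewrite bE -sqrtr_sqr ler_wsqrtr//; apply: le_trans A_le.
have : 0 <= \sum_(i < n) (a i - b * t i) ^+ 2 by apply: sumr_ge0 => i _; exact: sqr_ge0.
(* Cauchy-Schwarz: b^2 <= A because the sum of (a_i - b t_i)^2 is
   A - 2 b^2 + b^2 |t|^2 with |t| <= 1. *)
have sq (k : R) : \sum_(i < n) (a i - k * t i) ^+ 2 =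
    A - 2 * k * (\sum_(i < n) a i * t i) + k ^+ 2 * \sum_(i < n) t i ^+ 2.
  rewrite /A !mulr_sumr -sumrB -big_split/=; apply: eq_bigr => i _.
  by move: (a i) (t i) => p q; ring.
rewrite sq -/b.
have : b ^+ 2 * \sum_(i < n) t i ^+ 2 <= b ^+ 2 by rewrite ler_piMr ?sqr_ge0.
by rewrite !expr2; lra.
Qed.

Lemma sign_alignment (m X : R) (t : 'I_n -> R) : symmetric_dist mu ->
  mu.-integrable setT (fun x => (`|x| ^+ 3)%:E) -> m = \int[mu]_x `|x| ^+ 3 ->
  (forall i, `|x i| <= X) -> X <= 2^-1 -> \sum_(i < n) t i ^+ 2 <= 1 ->
  `|\sum_(i < n) t i * v i - lam * \sum_(i < n) x i * t i| <=
    Num.sqrt (10 * D * (X * m)).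
Proof.
move=> sym i3 mE xX X2 t1; have m1 := third_moment_ge1 i3 mE.
have X0 : 0 <= X.
  have [i _|n0] := pickP 'I_n; first exact: le_trans (normr_ge0 _) (xX i).
  by move: x1; rewrite big1 => [|i]; [move/esym/eqP; rewrite oner_eq0|have := n0 i].
have Xm : X <= X * m by rewrite ler_peMr.
apply: sign_alignment_le => //; first exact: le_trans Xm.
- by move=> i; have := sign_component_le sym i3 mE x1 xX X2 i.
- by move=> i; exact: le_trans (xX i) Xm.
Qed.

Lemma sign_alignment0 (t : 'I_n -> R) : D = 0 -> \sum_(i < n) t i ^+ 2 <= 1 ->
  \sum_(i < n) t i * v i - lam * \sum_(i < n) x i * t i = 0.
Proof.
move=> Dz t1; apply/eqP; rewrite -normr_le0.
pose K := \sum_(i < n) (`|v i| + `|x i|).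
have le_K i : `|v i| + `|x i| <= K.
  by rewrite /K (bigD1 i)//= lerDl sumr_ge0// => j _; exact: addr_ge0.
have K0 : 0 <= K by apply: sumr_ge0 => j _; exact: addr_ge0.
have := @sign_alignment_le K t K0; rewrite Dz mulr0 mul0r sqrtr0; apply => // i.
  by have := le_K i; have := normr_ge0 (x i); lra.
by have := le_K i; have := normr_ge0 (v i); lra.
Qed.

End alignment.
End sign_correlation.

(** * Conditional expectations *)
Section pull_out.
Context d (T : measurableType d) (R : realType) (P : probability T R).

Lemma density_finite_measure (p : T -> R) : P.-integrable setT (EFin \o p) ->
  (forall w, 0 <= p w) -> exists nu : {finite_measure set T -> \bar R},
    forall A, measurable A -> nu A = (\int[P]_(w in A) (p w)%:E)%E.
Proof.
move=> ip p0; have mp : measurable_fun setT (EFin \o p) by exact: measurable_int ip.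
have p0e w : (0 <= (EFin \o p) w)%E by rewrite lee_fin.
have fin : fin_num_fun (density_measure P mp p0e).
  by move=> A mA; apply: integrable_fin_num => //; exact: integrableS ip.
pose nu : {finite_measure set T -> \bar R} :=
  HB.pack (density_measure P mp p0e) (Measure_isFinite.Build _ T R _ fin).
by exists nu.
Qed.

(** The measures of densities [E1] and [E2] have the same image under [X]. *)
Lemma ge0_integral_pull_out (E1 E2 X : T -> R) (h : R -> R) :
  measurable_fun setT X -> measurable_fun setT h -> (forall x, 0 <= h x) ->
  P.-integrable setT (EFin \o E1) -> P.-integrable setT (EFin \o E2) ->
  (forall w, 0 <= E1 w) -> (forall w, 0 <= E2 w) ->
  (forall B, measurable B -> \int[P]_(w in X @^-1` B) (E1 w)%:E =
    \int[P]_(w in X @^-1` B) (E2 w)%:E)%E ->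
  (\int[P]_w (h (X w) * E1 w)%:E = \int[P]_w (h (X w) * E2 w)%:E)%E.
Proof.
move=> mX mh h0 i1 i2 p1 p2 E12.
have [n1 n1E] := density_finite_measure i1 p1.
have [n2 n2E] := density_finite_measure i2 p2.
have mhX : measurable_fun setT (h \o X) by exact: measurableT_comp.
rewrite -(integral_density i1 p1 n1E mhX) -(integral_density i2 p2 n2E mhX).
have push (nu : {finite_measure set T -> \bar R}) :
    (\int[nu]_w ((h \o X) w)%:E = \int[pushforward nu X]_x (h x)%:E)%E.
  rewrite ge0_integral_pushforward//; first exact/measurable_EFinP.
  by move=> x _; rewrite lee_fin.
rewrite !push; apply: eq_measure_integral => B mB _.
have mXB : measurable (X @^-1` B) by rewrite -[X in measurable X]setTI; exact: mX.
exact: (eq_trans (n1E _ mXB) (eq_trans (E12 _ mB) (esym (n2E _ mXB)))).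
Qed.

(** The positive and negative parts of [y - Z] have the same integral over every
    event on [X]; the products with the positive and with the negative part of
    [X] are compared separately, where all integrands are nonnegative. Only the
    integrability of [y X] and [Z X] is at hand, not that of [X]. *)
Lemma cond_expectation_pull_out (F : set (set T)) (y Z X : T -> R) :
  is_cond_expectation P F y Z -> measurable_fun setT X ->
  (forall B, measurable B -> F (X @^-1` B)) ->
  P.-integrable setT (fun w => (y w * X w)%:E) ->
  P.-integrable setT (fun w => (Z w * X w)%:E) ->
  \int[P]_w (y w * X w) = \int[P]_w (Z w * X w).
Proof.
move=> [iy iZ _ yZ] mX FX iyX iZX.
pose D w := y w - Z w.
have iD : P.-integrable setT (fun w => (D w)%:E) by exact: integrable_sub.
have mD : measurable_fun setT D by apply/measurable_EFinP; exact: measurable_int iD.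
pose pos (u : R) := Num.max u 0; pose neg (u : R) := Num.max (- u) 0.
have mpos : measurable_fun setT pos by apply: measurable_maxr.
have mneg : measurable_fun setT neg.
  by apply: measurable_maxr => //; exact: oppr_measurable.
have pos0 u : 0 <= pos u by rewrite le_max lexx orbT.
have neg0 u : 0 <= neg u by rewrite le_max lexx orbT.
have pos_le u : pos u <= `|u| by rewrite ge_max ler_norm normr_ge0.
have neg_le u : neg u <= `|u| by rewrite ge_max -normrN ler_norm normr_ge0.
have posneg u : u = pos u - neg u.
  by rewrite /pos /neg; have [h|h] := leP 0 u; have [h'|h'] := leP 0 (- u); lra.
have ip : P.-integrable setT (EFin \o (pos \o D)).
  apply: (@integrable_le _ _ _ P (pos \o D) (fun w => `|D w|)).
  - exact: measurableT_comp.
  - exact: integrable_norm iD.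
  - by move=> w /=; rewrite (ger0_norm (pos0 _)).
have iN : P.-integrable setT (EFin \o (neg \o D)).
  apply: (@integrable_le _ _ _ P (neg \o D) (fun w => `|D w|)).
  - exact: measurableT_comp.
  - exact: integrable_norm iD.
  - by move=> w /=; rewrite (ger0_norm (neg0 _)).
have DB B : measurable B -> (\int[P]_(w in X @^-1` B) ((pos \o D) w)%:E =
    \int[P]_(w in X @^-1` B) ((neg \o D) w)%:E)%E.
  move=> mB; have mXB : measurable (X @^-1` B).
    by rewrite -[X in measurable X]setTI; exact: mX.
  have D0 : (\int[P]_(w in X @^-1` B) (D w)%:E = 0)%E.
    have jy := integrableS measurableT mXB (@subsetT _ _) iy.
    have jZ := integrableS measurableT mXB (@subsetT _ _) iZ.
    rewrite /D; under eq_integral do rewrite EFinB.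
    by rewrite integralB// yZ ?subee//; [exact: integrable_fin_num|exact: FX].
  have jp := integrableS measurableT mXB (@subsetT _ _) ip.
  have jN := integrableS measurableT mXB (@subsetT _ _) iN.
  have fN := integrable_fin_num mXB jN.
  have : (\int[P]_(w in X @^-1` B) ((pos \o D) w)%:E -
      \int[P]_(w in X @^-1` B) ((neg \o D) w)%:E = 0)%E.
    rewrite -[RHS]D0 -integralB//; apply: eq_integral => w _.
    by rewrite /= -EFinB -posneg.
  by move=> e; rewrite -[LHS](subeK _ fN) e add0e.
have iXD : P.-integrable setT (fun w => (`|X w| * `|D w|)%:E).
  apply: (@integrable_le _ _ _ P _ (fun w => `|y w * X w| + `|Z w * X w|)).
  - by apply: measurable_funM; exact: measurableT_comp.
  - by apply: integrable_add; [exact: integrable_norm iyX|exact: integrable_norm iZX].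
  - move=> w; rewrite -normrM normr_id /D mulrBr ![X w * _]mulrC.
    exact: ler_normB.
have iq (f g : R -> R) : measurable_fun setT f -> measurable_fun setT g ->
    (forall u, 0 <= f u) -> (forall u, 0 <= g u) ->
    (forall u, f u <= `|u|) -> (forall u, g u <= `|u|) ->
    P.-integrable setT (fun w => (f (X w) * g (D w))%:E).
  move=> mf mg f0 g0 fl gl.
  apply: (@integrable_le _ _ _ P _ (fun w => `|X w| * `|D w|)) => //.
  - by apply: measurable_funM; exact: measurableT_comp.
  - by move=> w; rewrite ger0_norm ?mulr_ge0// ler_pM.
have e1 : \int[P]_w (pos (X w) * pos (D w)) = \int[P]_w (pos (X w) * neg (D w)).
  congr fine; exact: ge0_integral_pull_out.
have e2 : \int[P]_w (neg (X w) * pos (D w)) = \int[P]_w (neg (X w) * neg (D w)).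
  congr fine; exact: ge0_integral_pull_out.
have i1 := iq _ _ mpos mpos pos0 pos0 pos_le pos_le.
have i2 := iq _ _ mpos mneg pos0 neg0 pos_le neg_le.
have i3 := iq _ _ mneg mpos neg0 pos0 neg_le pos_le.
have i4 := iq _ _ mneg mneg neg0 neg0 neg_le neg_le.
apply/eqP; rewrite -subr_eq0 -RintegralB//; apply/eqP.
transitivity (\int[P]_w ((pos (X w) * pos (D w) - pos (X w) * neg (D w))
    - (neg (X w) * pos (D w) - neg (X w) * neg (D w)))).
  apply: eq_Rintegral => w _; rewrite -mulrBl -/(D w).
  by rewrite {1}(posneg (X w)) {1}(posneg (D w)); ring.
rewrite (RintegralB _ (integrable_sub i1 i2) (integrable_sub i3 i4))//.
by rewrite (RintegralB _ i1 i2)// (RintegralB _ i3 i4)// e1 e2 !subrr.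
Qed.

End pull_out.

(** * Third moments *)
Section third_moment.
Context d (T : measurableType d) (R : realType) (P : probability T R).
Local Open Scope ereal_scope.

Lemma minkowski_cube (f g : T -> R) (p q : R) :
  measurable_fun setT f -> measurable_fun setT g ->
  \int[P]_w (`|f w| ^+ 3)%:E = p%:E -> \int[P]_w (`|g w| ^+ 3)%:E = q%:E ->
  \int[P]_w (`|f w + g w| ^+ 3)%:E <= ((p `^ 3^-1 + q `^ 3^-1) ^+ 3)%:E.
Proof.
move=> mf mg fp gq.
have powE (h : T -> R) : \int[P]_w (`|(h w)%:E| `^ 3%:R) = \int[P]_w (`|h w| ^+ 3)%:E.
  by apply: eq_integral => w _; rewrite abse_EFin poweR_EFin powR_mulrn.
have normE (h : T -> R) : 'N[P]_(3%:R)%:E[EFin \o h] = (\int[P]_w (`|h w| ^+ 3)%:E) `^ 3^-1.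
  by rewrite unlock powE.
have := @minkowski_EFin _ _ _ P f g 3%:R mf mg; rewrite ler1n => /(_ isT) mk.
have := @poweR_Lnorm _ _ _ P (EFin \o (f \+ g)%R) 3%:R.
rewrite pnatr_eq0 => /(_ isT); rewrite powE => <-.
apply: (@le_trans _ _ (('N[P]_(3%:R)%:E[EFin \o f] + 'N[P]_(3%:R)%:E[EFin \o g]) `^ 3%:R)).
  have Nf0 := Lnorm_ge0 P 3%:R%:E (EFin \o f); have Ng0 := Lnorm_ge0 P 3%:R%:E (EFin \o g).
  by apply: gt0_ler_poweR mk => //; rewrite !in_itv/= leey andbT ?Lnorm_ge0 ?adde_ge0.
have -> : 'N[P]_(3%:R)%:E[EFin \o f] = (p `^ 3^-1)%:E by rewrite normE fp.
have -> : 'N[P]_(3%:R)%:E[EFin \o g] = (q `^ 3^-1)%:E by rewrite normE gq.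
rewrite -EFinD poweR_EFin powR_mulrn ?addr_ge0 ?powR_ge0//.
Qed.

End third_moment.

(** * The bound on alpha for a component law of small discrepancy *)
Section response.
Context d (T : measurableType d) (R : realType) (P : probability T R).
Variables (n : nat) (G : 'I_n -> {RV P >-> R}) (mu : probability R R).
Variables (x : 'rV[R]_n) (y : {RV P >-> R}).
Hypotheses (indepG : mutually_independent G) (lawG : forall i, has_law P (G i) mu).
Hypotheses (std : standardized mu) (x_unit : norm2 x = 1).
Hypothesis y_cond : is_cond_expectation P (g_sigma_preimage (fun i => G i : T -> R))
  y (fun w => theta (dot (rvec G w) x)).
Hypothesis y_int : forall t : 'rV[R]_n,
  P.-integrable setT (fun w => (y w * dot (rvec G w) t)%:E).

Let v i := \int[P]_w (theta (\sum_(j < n) x 0 j * G j w) * G i w).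
Let lam := \int[P]_w `|\sum_(j < n) x 0 j * G j w|.

Lemma sum_sqr_le1 (t : 'rV[R]_n) : norm2 t <= 1 -> \sum_(i < n) t 0 i ^+ 2 <= 1.
Proof.
rewrite /norm2 => t1.
have s0 : 0 <= \sum_(i < n) t 0 i ^+ 2 by apply: sumr_ge0 => i _; exact: sqr_ge0.
by rewrite -(sqr_sqrtr s0) expr_le1// sqrtr_ge0.
Qed.

Let x1 : \sum_(i < n) x 0 i ^+ 2 = 1.
Proof.
have s0 : 0 <= \sum_(i < n) x 0 i ^+ 2 by apply: sumr_ge0 => i _; exact: sqr_ge0.
by rewrite -(sqr_sqrtr s0) -[Num.sqrt _]/(norm2 x) x_unit expr1n.
Qed.

Lemma dot_rvec (t : 'rV[R]_n) w : dot (rvec G w) t = \sum_(i < n) t 0 i * G i w.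
Proof. by rewrite /dot; apply: eq_bigr => i _; rewrite mxE mulrC. Qed.

Lemma component_preimage i B : measurable B ->
  g_sigma_preimage (fun i => G i : T -> R) (G i @^-1` B).
Proof.
move=> mB; apply: sub_sigma_algebra; rewrite (bigD1 i)//=; left.
by exists B => //; rewrite setTI.
Qed.

Lemma integrable_response_component i : P.-integrable setT (fun w => (y w * G i w)%:E).
Proof.
have := y_int (\row_j (j == i)%:R).
suff E w : dot (rvec G w) (\row_j (j == i)%:R) = G i w by under eq_fun do rewrite E.
rewrite dot_rvec (bigD1 i)//= mxE eqxx mul1r big1 ?addr0// => j ji.
by rewrite mxE (negbTE ji) mul0r.
Qed.

Lemma response_component i : \int[P]_w (y w * G i w) = v i.
Proof.
have -> : v i = \int[P]_w (theta (dot (rvec G w) x) * G i w).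
  by apply: eq_Rintegral => w _; rewrite dot_rvec.
apply: cond_expectation_pull_out y_cond _ _ _ _ => //.
- by move=> B; exact: component_preimage.
- exact: integrable_response_component.
- under eq_fun do rewrite dot_rvec.
  have [+ _] := sign_pairing lawG std (fun j => x 0 j) (fun j => (j == i)%:R).
  suff E w : \sum_(j < n) (j == i)%:R * G j w = G i w by under eq_fun do rewrite E.
  rewrite (bigD1 i)//= eqxx mul1r big1 ?addr0// => j ji.
  by rewrite (negbTE ji) mul0r.
Qed.

Lemma expectation_response (t : 'rV[R]_n) :
  ('E_P[fun w => (y w * dot (rvec G w) t)%R] = (\sum_(i < n) t 0 i * v i)%:E)%E.
Proof.
have E w : y w * dot (rvec G w) t = \sum_(i < n) t 0 i * (y w * G i w).
  by rewrite dot_rvec mulr_sumr; apply: eq_bigr => i _; rewrite mulrCA.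
have <- : \int[P]_w (y w * dot (rvec G w) t) = \sum_(i < n) t 0 i * v i.
  under eq_Rintegral do rewrite E.
  rewrite Rintegral_sum => [|i].
    apply: eq_bigr => i _; rewrite RintegralZl ?response_component//.
    exact: integrable_response_component.
  by apply: integrable_scale; exact: integrable_response_component.
rewrite expectation.unlock /Rintegral fineK//.
exact: integrable_fin_num (y_int t).
Qed.

Lemma lambdaE : lambda G x y = lam%:E.
Proof.
rewrite /lambda expectation_response; congr EFin.
rewrite -(sign_pairing lawG std (fun j => x 0 j) (fun j => x 0 j)).2.
by apply: eq_Rintegral => w _; rewrite theta_mul.
Qed.

Lemma alpha_le (B : R) :
  (forall t : 'I_n -> R, \sum_(i < n) t i ^+ 2 <= 1 ->
    `|\sum_(i < n) t i * v i - lam * \sum_(i < n) x 0 i * t i| <= B) ->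
  (alpha G x y <= B%:E)%E.
Proof.
move=> bound; apply: ub_ereal_sup => _ [t /sum_sqr_le1 t1 <-].
rewrite expectation_response lambdaE -EFinM -EFinB abse_EFin lee_fin.
exact: (bound (fun i => t 0 i) t1).
Qed.

Lemma le_norm_infty i : `|x 0 i| <= norm_infty x.
Proof. by rewrite /norm_infty; exact: le_bigmax_cond. Qed.

Lemma norm_infty_gt0 : 0 < norm_infty x.
Proof.
rewrite lt_neqAle; apply/andP; split; last first.
  by rewrite /norm_infty; apply: bigmax_ge_id.
apply/eqP => X0; move: x1; rewrite big1 => [/esym/eqP|i _]; first by rewrite oner_eq0.
by have := le_norm_infty i; rewrite -X0 normr_le0 => /eqP ->; rewrite expr0n.
Qed.

Lemma alpha_le0 : stein_discrepancy_le mu 0 -> (alpha G x y <= 0)%E.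
Proof.
move=> sd; apply: alpha_le => t t1.
by rewrite (sign_alignment0 indepG lawG std (lexx 0) sd x1 erefl t1) normr0.
Qed.

(** [k gam] bounds the discrepancy of a component and [C] the cube root of its
    third moment. If [k gam = 0] the discrepancy vanishes and so does [alpha];
    otherwise the right-hand side is infinite as soon as [gam] or [C] is. *)
Lemma alpha_bound (k : R) (gam C : \bar R) : symmetric_dist mu -> norm_infty x <= 2^-1 ->
  0 <= k -> (0 <= gam)%E -> (0 <= C)%E -> (0 < k -> (0 < C)%E) ->
  (forall D, 0 <= D -> (gam <= D%:E)%E -> 0 < k -> stein_discrepancy_le mu (k * D)) ->
  (k = 0 -> stein_discrepancy_le mu 0) ->
  (forall r, C = r%:E -> 0 < k -> mu.-integrable setT (fun x => (`|x| ^+ 3)%:E) /\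
    \int[mu]_x `|x| ^+ 3 <= r ^+ 3) ->
  (alpha G x y <= (10%:E * k%:E * gam * C ^+ 3 * (norm_infty x)%:E) `^ 2^-1)%E.
Proof.
move=> sym X2; rewrite le_eqVlt => /predU1P[<-|k0] gam0 C0 kC sd sd0 mom.
  by apply: le_trans (poweR_ge0 _ _); apply: alpha_le0; exact: sd0.
have X0 := norm_infty_gt0.
have toy : (10%:E * k%:E * gam * C ^+ 3 * (norm_infty x)%:E = +oo)%E ->
    (alpha G x y <= (10%:E * k%:E * gam * C ^+ 3 * (norm_infty x)%:E) `^ 2^-1)%E.
  by move=> ->; rewrite poweRyr ?invr_eq0// leey.
have k10 : (0 < 10%:E * k%:E :> \bar R)%E by rewrite -EFinM lte_fin mulr_gt0.
have {kC} C0' := kC k0.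
case: gam gam0 sd toy => [g g0 sd toy|_ _ toy|//]; last first.
  by apply: toy; rewrite gt0_muley// gt0_mulye ?expe_gt0// gt0_mulye ?lte_fin.
move: g0; rewrite lee_fin le_eqVlt => /predU1P[g0|g0].
  apply: le_trans (poweR_ge0 _ _); apply: alpha_le0.
  by have := sd 0 (lexx _); rewrite mulr0; apply; rewrite // -g0.
have kg0 : (0 < 10%:E * k%:E * g%:E :> \bar R)%E by rewrite mule_gt0.
case: C C0 C0' mom toy => [c c0 c0' mom toy|_ _ _ toy|//]; last first.
  apply: toy; have -> : (+oo ^+ 3 = +oo :> \bar R)%E by [].
  by rewrite gt0_muley// gt0_mulye ?lte_fin.
have [i3 mc] := mom c erefl k0.
move: c0; rewrite lee_fin => c0.
rewrite -EFin_expe -!EFinM poweR_EFin powR12_sqrt; last first.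
  by rewrite !mulr_ge0 ?exprn_ge0 ?(ltW k0) ?(ltW g0) ?(ltW X0).
apply: alpha_le => t t1.
have kg : 0 <= k * g by rewrite mulr_ge0// ltW.
have sdg := sd g (ltW g0) (lexx _) k0.
apply: le_trans (sign_alignment indepG lawG std kg sdg x1 sym i3 erefl le_norm_infty X2 t1) _.
rewrite ler_wsqrtr//.
have : norm_infty x * \int[mu]_x `|x| ^+ 3 <= norm_infty x * c ^+ 3.
  by rewrite ler_wpM2l// ltW.
have k10g : 0 <= 10 * (k * g) by rewrite mulr_ge0.
by move=> /(ler_wpM2l k10g); congr (_ <= _); ring.
Qed.

End response.

(** * The two noise models *)
Section noise_law.
Context d (T : measurableType d) (R : realType) (P : probability T R).
Variable X : {RV P >-> R}.
Let mu : probability R R := distribution P X.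

Let mX : measurable_fun setT X. Proof. exact: measurable_funP. Qed.
Let lawX : has_law P X mu. Proof. by []. Qed.

(** Since the mean is [0] the variance is the integral of [X^2]; that it is finite
    makes [X] integrable. *)
Lemma standardized_distribution : ('E_P[X] = 0)%E -> ('V_P[X] = 1)%E -> standardized mu.
Proof.
move=> E0 V1.
have V : (\int[P]_w (X w ^+ 2)%:E = 1)%E.
  move: V1; rewrite /variance covariance.unlock E0 expectation.unlock => <-.
  by apply: eq_integral => w _; rewrite expr2 -[X w]subr0.
have i2 : P.-integrable setT (fun w => (X w ^+ 2)%:E).
  apply/integrableP; split; first exact/measurable_EFinP/measurable_funX.
  rewrite (_ : (\int[P]_w _)%E = 1%E) ?ltry// -V.
  by apply: eq_integral => w _; rewrite abse_EFin ger0_norm ?sqr_ge0.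
have i1 : P.-integrable setT (fun w => (X w)%:E) by exact: integrable_of_sqr.
split.
- by apply/(integrable_law mX lawX (h := id)).
- by apply/(integrable_law mX lawX (exprn_measurable 2)).
- rewrite -(Rintegral_law mX lawX (h := id))//.
  by move: E0; rewrite expectation.unlock /Rintegral => ->.
- by rewrite -(Rintegral_law mX lawX (exprn_measurable 2)) /Rintegral V.
Qed.

Lemma symmetric_distribution : symmetric_law X -> symmetric_dist mu.
Proof. by move=> sX B mB; rewrite [RHS]sX. Qed.

Lemma gamma_ge0 : (0 <= gamma X)%E.
Proof.
apply: le_ereal_inf_tmp => _ [pi _ <-]; apply: integral_ge0 => z _.
by rewrite lee_fin.
Qed.

Lemma stein_discrepancy_gamma (D : R) : standardized mu -> (gamma X <= D%:E)%E ->
  stein_discrepancy_le mu D.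
Proof.
move=> std gD; have [i1 i2 _ _] := std; have [e1 e2] := standardized_expectations std.
apply: stein_discrepancy_zero_bias gD.
  have [nu nuP] := zero_bias_exists i1 i2 e1 e2.
  exact: (@xgetPex _ mu [set nu | is_zero_bias mu nu] (ex_intro _ nu nuP)).
rewrite /variance covariance.unlock.
have -> : ('E_mu[idfun] = 0)%E by rewrite expectation.unlock.
rewrite expectation.unlock -[RHS]e2.
by apply: eq_integral => x _; rewrite expr2 -[x in RHS]subr0.
Qed.

Lemma third_moment_distribution (r : R) : (\int[P]_w (`|X w| ^+ 3)%:E <= r%:E)%E ->
  mu.-integrable setT (fun x => (`|x| ^+ 3)%:E) /\ \int[mu]_x `|x| ^+ 3 <= r.
Proof.
have m3 : measurable_fun setT (fun x : R => `|x| ^+ 3).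
  by apply: measurable_funX; exact: normr_measurable.
rewrite (integral_law mX lawX m3) => le_r.
have i3 : mu.-integrable setT (fun x => (`|x| ^+ 3)%:E).
  apply/integrableP; split; first exact/measurable_EFinP.
  apply: le_lt_trans (ltry r); apply: le_trans le_r; rewrite le_eqVlt; apply/predU1P; left.
  by apply: eq_integral => x _; rewrite abse_EFin ger0_norm// exprn_ge0.
split=> //; rewrite -lee_fin /Rintegral fineK//.
exact: integrable_fin_num i3.
Qed.

Lemma scaled_third_moment (c : R) : 0 <= c ->
  (\int[P]_w (`|c * X w| ^+ 3)%:E = (c ^+ 3)%:E * \int[P]_w (`|X w| ^+ 3)%:E)%E.
Proof.
move=> c0; rewrite -ge0_integralZl_EFin//.
- by apply: eq_integral => w _; rewrite normrM (ger0_norm c0) exprMn EFinM.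
- by apply/measurable_EFinP; apply: measurable_funX; exact: measurableT_comp.
- exact: exprn_ge0.
Qed.

(** Were it [0], it would be finite and hence at least the variance. *)
Lemma third_moment_gt0 : standardized mu -> (0 < \int[P]_w (`|X w| ^+ 3)%:E)%E.
Proof.
move=> std; have : (0 <= \int[P]_w (`|X w| ^+ 3)%:E)%E.
  by apply: integral_ge0 => w _; rewrite lee_fin exprn_ge0.
rewrite le_eqVlt => /predU1P[e0|//].
have [i3 le0] : mu.-integrable setT (fun x => (`|x| ^+ 3)%:E) /\
    \int[mu]_x `|x| ^+ 3 <= 0.
  by apply: third_moment_distribution; rewrite -e0.
by have := le_trans (third_moment_ge1 std i3 erefl) le0; rewrite ler10.
Qed.

End noise_law.

Section normal_law.
Context d (T : measurableType d) (R : realType) (P : probability T R).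
Variable g : {RV P >-> R}.
Hypothesis g_normal : same_law (distribution P g) (normal_prob 0 1).

Lemma gaussian_third_moment :
  (\int[P]_w (`|g w| ^+ 3)%:E = (Num.sqrt (8 / pi))%:E)%E.
Proof.
have mg : measurable_fun setT g by exact: measurable_funP.
have lg : has_law P g (distribution P g) by [].
rewrite (integral_law mg lg (h := fun x => `|x| ^+ 3)); first exact: normal_third_moment.
by apply: measurable_funX; exact: normr_measurable.
Qed.

End normal_law.

Section powers.
Context {R : realType}.

Lemma powR_cube_root (c p : R) : 0 <= c -> 0 <= p ->
  (c ^+ 3 * p) `^ 3^-1 = c * p `^ 3^-1.
Proof.
move=> c0 p0; rewrite powRM ?exprn_ge0//; congr (_ * _).
by rewrite -powR_mulrn// -powRrM mulfV ?powRr1// pnatr_eq0.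
Qed.

Lemma cube_root_cube (p : R) : 0 <= p -> (p `^ 3^-1) ^+ 3 = p.
Proof.
by move=> p0; rewrite -powR_mulrn ?powR_ge0// -powRrM mulVf ?powRr1// pnatr_eq0.
Qed.

Lemma sqrt_cube (e : R) : 0 <= e -> Num.sqrt e ^+ 3 = e `^ (3 / 2).
Proof.
move=> e0; rewrite -powR12_sqrt// -powR_mulrn ?powR_ge0// -powRrM.
by rewrite mulrC.
Qed.

Lemma le_cube_add (u v : R) : 0 <= u -> 0 <= v -> u ^+ 3 + v ^+ 3 <= (u + v) ^+ 3.
Proof.
move=> u0 v0; rewrite -subr_ge0.
have -> : (u + v) ^+ 3 - (u ^+ 3 + v ^+ 3) = 3 * (u * v) * (u + v) by ring.
by rewrite mulr_ge0 ?addr_ge0// mulr_ge0// mulr_ge0.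
Qed.

End powers.

Theorem theorem2p5 (R : realType)
    (* the space of a, g, g_eps *)
    (d0 : measure_display) (T0 : measurableType d0) (P0 : probability T0 R)
    (a g geps : {RV P0 >-> R}) (eps : R)
    (* the space of the random vector and of y *)
    (d : measure_display) (T : measurableType d) (P : probability T R)
    (n : nat) (G : 'I_n -> {RV P >-> R}) (x : 'rV[R]_n) (y : {RV P >-> R})
    (a_mean : ('E_P0[a] = 0)%E) (a_var : ('V_P0[a] = 1)%E)
    (a_sym : symmetric_law a)
    (g_normal : same_law (distribution P0 g) (normal_prob 0 1))
    (eps_itv : 0 <= eps <= 1)
    (G_indep : mutually_independent G)
    (G_law : forall i, same_law (distribution P (G i)) (distribution P0 geps))
    (x_unit : norm2 x = 1)
    (y_cond : is_cond_expectation P (g_sigma_preimage (fun i => G i : T -> R))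
                y (fun w => theta (dot (rvec G w) x)))
    (y_int : forall t : 'rV[R]_n,
       P.-integrable setT (fun w => (y w * dot (rvec G w) t)%:E))
    (x_norm3 : ((norm3_cubed x)%:E <= (c1 R)%:E / gamma geps)%E)
    (x_infty : norm_infty x <= 2^-1) :
  (additive_model eps g a geps ->
     (alpha G x y <=
       (10%:E * (eps `^ (3 / 2))%:E * gamma a
        * ((Num.sqrt (1 - eps) * Num.sqrt (8 / pi) `^ 3^-1)%:E
           + (Num.sqrt eps)%:E * 'E_P0[fun w => (`|a w| ^+ 3)%R] `^ 3^-1) ^+ 3
        * (norm_infty x)%:E) `^ 2^-1)%E)
  /\
  (mixture_model eps g a geps ->
     (alpha G x y <=
       (10%:E * eps%:E * gamma a
        * ((((1 - eps) * Num.sqrt (8 / pi)) `^ 3^-1)%:E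
           + (eps%:E * 'E_P0[fun w => (`|a w| ^+ 3)%R]) `^ 3^-1) ^+ 3
        * (norm_infty x)%:E) `^ 2^-1)%E).
Proof.
have mG i : has_law P (G i) (distribution P0 geps) by exact: G_law.
have [e0 e1] := andP eps_itv; have e1' : 0 <= 1 - eps by rewrite subr_ge0.
pose q : \bar R := (\int[P0]_w (`|a w| ^+ 3)%:E)%E.
have qE : ('E_P0[fun w => (`|a w| ^+ 3)%R] = q)%E by rewrite expectation.unlock.
have g_std : standardized (distribution P0 g) by exact: normal_standardized.
have g_sym : symmetric_dist (distribution P0 g) by exact: normal_symmetric.
have g_sd : stein_discrepancy_le (distribution P0 g) 0 by exact: normal_stein.
have a_std := standardized_distribution a_mean a_var.
have a_symd := symmetric_distribution a_sym.
have q0 : (0 < q)%E by exact: third_moment_gt0.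
have p0 : 0 <= Num.sqrt (8 / pi) :> R by exact: sqrtr_ge0.
rewrite qE; split.
- move=> [indep gepsE].
  have ce : Num.sqrt (1 - eps) ^+ 2 + Num.sqrt eps ^+ 2 = 1.
    by rewrite !sqr_sqrtr// subrK.
  have std := independent_sum_standardized indep gepsE ce a_std g_std.
  have keps : 0 < eps `^ (3 / 2) -> 0 < eps.
    move=> k0; rewrite lt_neqAle e0 andbT; apply/eqP => eps0; move: k0.
    by rewrite -eps0 powR0 ?ltxx// mulf_neq0.
  apply: (alpha_bound G_indep mG std x_unit y_cond y_int) => //.
  + exact: independent_sum_symmetric indep gepsE a_symd g_sym.
  + exact: powR_ge0.
  + exact: gamma_ge0.
  + by rewrite adde_ge0// ?mule_ge0 ?lee_fin ?mulr_ge0 ?powR_ge0 ?poweR_ge0.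
  + move=> /keps eps0; apply: (@lt_le_trans _ _ ((Num.sqrt eps)%:E * q `^ 3^-1)%E).
      by rewrite mule_gt0 ?poweR_gt0// lte_fin sqrtr_gt0.
    by rewrite leeDr// lee_fin mulr_ge0 ?powR_ge0.
  + move=> D D0 gD _; have sdA := stein_discrepancy_gamma a_std gD.
    have := independent_sum_stein indep gepsE ce a_std g_std sdA g_sd.
    by rewrite mulr0 addr0 ger0_norm ?sqrtr_ge0// sqrt_cube.
  + move=> /powR_eq0_eq0 eps0; apply: normal_stein => B mB.
    rewrite -g_normal//; congr (P0 _); apply/seteqP; split => w /=;
      by rewrite gepsE eps0 subr0 sqrtr1 sqrtr0 mul1r mul0r addr0.
  + move=> r Cr /keps eps0; case: q q0 qE Cr => [t t0 qE Cr|_ _|//]; last first.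
      by rewrite poweRyr// gt0_muley ?lte_fin ?sqrtr_gt0.
    move: Cr; rewrite poweR_EFin -EFinM -EFinD => -[<-].
    apply: third_moment_distribution.
    have t0' : 0 <= t by rewrite -lee_fin ltW.
    have ta : (\int[P0]_w (`|a w| ^+ 3)%:E = t%:E)%E by move: qE; rewrite expectation.unlock.
    have gm := gaussian_third_moment g_normal.
    have c0 : 0 <= Num.sqrt (1 - eps) by exact: sqrtr_ge0.
    have s0 : 0 <= Num.sqrt eps by exact: sqrtr_ge0.
    under eq_integral do rewrite gepsE.
    rewrite -!powR_cube_root//; apply: minkowski_cube.
    * exact: measurable_funM.
    * exact: measurable_funM.
    * by rewrite scaled_third_moment// gm -EFinM.
    * by rewrite scaled_third_moment// ta -EFinM.
- move=> [A [mA PA indep gepsE]].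
  have std := mixture_standardized eps_itv mA PA indep gepsE a_std g_std.
  apply: (alpha_bound G_indep mG std x_unit y_cond y_int) => //.
  + exact: mixture_symmetric mA PA indep gepsE a_symd g_sym.
  + exact: gamma_ge0.
  + by rewrite adde_ge0// ?lee_fin ?powR_ge0 ?poweR_ge0.
  + move=> eps0; apply: (@lt_le_trans _ _ ((eps%:E * q) `^ 3^-1)%E).
      by rewrite poweR_gt0// mule_gt0.
    by rewrite leeDr// lee_fin powR_ge0.
  + move=> D D0 gD _; have sdA := stein_discrepancy_gamma a_std gD.
    have := mixture_stein eps_itv mA PA indep gepsE a_std g_std sdA g_sd.
    by rewrite mulr0 add0r.
  + move=> eps0; apply: normal_stein => B mB.
    apply: eq_trans (mixture_law mA PA indep gepsE mB) _.
    by rewrite eps0 subr0 mul1e mul0e adde0; exact: g_normal.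
  + move=> r Cr eps0; case: q q0 qE Cr => [t t0 qE Cr|_ _|//]; last first.
      by rewrite gt0_muley// poweRyr.
    have t0' : 0 <= t by rewrite -lee_fin ltW.
    move: Cr; rewrite -EFinM poweR_EFin -EFinD => -[<-].
    apply: third_moment_distribution.
    have m3 : measurable_fun setT (fun x : R => (`|x| ^+ 3)%:E).
      by apply/measurable_EFinP; apply: measurable_funX; exact: normr_measurable.
    have n3 (u : R) : (0 <= (`|u| ^+ 3)%:E)%E by rewrite lee_fin exprn_ge0.
    have law3 (X : {RV P0 >-> R}) : (\int[P0]_w (`|X w| ^+ 3)%:E =
        \int[distribution P0 X]_u (`|u| ^+ 3)%:E)%E.
      by apply: (@ge0_integral_law _ _ _ P0 _ R X (distribution P0 X)
        _ _ (fun u => (`|u| ^+ 3)%:E)).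
    rewrite law3 (ge0_mixture_integral eps_itv mA PA indep gepsE m3 n3) -!law3.
    rewrite (gaussian_third_moment g_normal).
    have -> : (\int[P0]_w (`|a w| ^+ 3)%:E = t%:E)%E by move: qE; rewrite expectation.unlock.
    rewrite -!EFinM -EFinD lee_fin.
    have p1 : 0 <= (1 - eps) * Num.sqrt (8 / pi) by exact: mulr_ge0.
    have p2 : 0 <= eps * t by exact: mulr_ge0.
    rewrite -{1}(cube_root_cube p1) -{1}(cube_root_cube p2).
    by apply: le_cube_add; exact: powR_ge0.
Qed.
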